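(* Let $\mathbb{F}_q$ be a finite field of odd characteristic and order $q$, and let $n\ge 1$. Let $f_1,\ldots,f_n$ be hypersurfaces in $\mathbb{P}^n_{\mathbb{F}_q}$, and let $d_i\ge 1$ be the degree of $f_i$. Assume that $f_1,\ldots,f_n$ intersect transversely (at every common point) and that $-n-1+\sum_{i=1}^n d_i\equiv0\pmod 2$. Let $A$ be the number of positive intersection points with field of definition $\mathbb{F}_{q^b}$ for $b$ even, and let $B$ be the number of negative intersection points with field of definition $\mathbb{F}_{q^b}$ for $b$ odd. (a) If $\frac{d_1\cdots d_n}{2}$ is even or $q\equiv1\pmod 4$, then $A+B\equiv0\pmod 2$. (b) If $\frac{d_1\cdots d_n}{2}$ is odd and $q\not\equiv1\pmod 4$, then $A+B\equiv1\pmod 2$.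
   Context: A hypersurface of degree $d_i$ is the vanishing locus of a nonzero homogeneous polynomial of degree $d_i$ in $\mathbb{F}_q[x_0,\ldots,x_n]$, also denoted $f_i$. Intersection points are closed points of $f_1\cap\cdots\cap f_n\subset\mathbb{P}^n_{\mathbb{F}_q}$; the field of definition of $p$ is its residue field $k(p)\cong\mathbb{F}_{q^b}$. The parity condition forces some $d_i$ to be even. Transversality: $f_1,\ldots,f_n$ intersect transversely at $p$ if each $f_i$ is smooth at $p$ and $\operatorname{codim}(\bigcap_iT_pf_i)=\sum_i\operatorname{codim}T_pf_i$ in $T_p\mathbb{P}^n\cong k(p)^n$. Charts and Jacobians: for $0\le\ell\le n$ let $U_\ell=\{x_\ell\neq0\}$ with coordinates $\tilde\varphi_\ell:U_\ell\to\mathbb{A}^n$, where $\tilde\varphi_0([p_0:\cdots:p_n])=(\frac{p_1}{p_0},\ldots,\frac{p_n}{p_0})$ and, for $\ell\ge1$, $\tilde\varphi_\ell([p_0:\cdots:p_n])=((-1)^\ell\frac{p_0}{p_\ell},\frac{p_1}{p_\ell},\ldots,\frac{p_{\ell-1}}{p_\ell},\frac{p_{\ell+1}}{p_\ell},\ldots,\frac{p_n}{p_\ell})$. With coordinates $y_j$ ($j\ne\ell$, increasing order) on $\mathbb{A}^n$, put $f_i^0=f_i(1,y_1,\ldots,y_n)$ and, for $\ell\ge1$, $f_i^\ell=f_i((-1)^\ell y_0,y_1,\ldots,y_{\ell-1},1,y_{\ell+1},\ldots,y_n)$. Let $J_\ell=\det(\partial f_i^\ell/\partial y_j)_{1\le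 i\le n,\,j\neq\ell}$ and $J_\ell(p)=J_\ell(\tilde\varphi_\ell(p))\in k(p)$ for $p\in U_\ell$. A transverse intersection point $p\in U_\ell$ with field of definition $\mathbb{F}_{q^b}$ is called positive if $J_\ell(p)$ is a square in $\mathbb{F}_{q^b}^\times$, and negative if it is not a square in $\mathbb{F}_{q^b}^\times$ (under the parity hypothesis this does not depend on the choice of $\ell$). *)

(* Defs.v *)
From HB Require Import structures.
From mathcomp Require Import all_boot all_order all_algebra all_field.
From mathcomp Require Import boolp classical_sets cardinality.
From mathcomp Require Import mpoly.

Set Implicit Arguments.
Unset Strict Implicit.
Unset Printing Implicit Defensive.

Import GRing.Theory.
Local Open Scope ring_scope.

(* F is the finite base field and L an algebraic closure of F, embedded by    *)
(* iota; points of P^n(L) are nonzero row vectors up to scalars.              *)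

Section ResidueField.
Variables (F : finFieldType) (L : closedFieldType) (iota : {rmorphism F -> L}).
Variables (n : nat) (x : 'rV[L]_n.+1).

Definition geval (g : {mpoly F[n.+1]}) : L := mmap iota (fun i => x 0 i) g.

(* The residue field k(p) at the closed point p below x is the quotient of    *)
(* the local ring of fractions g/h, with g, h forms of equal degree and       *)
(* h not vanishing at x; evaluation at x identifies it with a subfield of L.  *)
Definition in_residue : set L := fun a =>
  exists (e : nat) (g h : {mpoly F[n.+1]}),
    [/\ g \is e.-homog, h \is e.-homog, geval h != 0 & a = geval g / geval h].

Definition residue_pred : pred L := fun a => `[< in_residue a >].

Lemma residue_divring_closed : divring_closed residue_pred.
Proof.
split.
- apply/asboolP; exists 0%N, 1, 1.
  by rewrite /geval rmorph1 divr1 oner_neq0 dhomog1.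
- move=> _ _ /asboolP[e [g [h [gH hH h0 ->]]]] /asboolP[e' [g' [h' [gH' hH' h0' ->]]]].
  apply/asboolP; exists (e + e')%N, (g * h' - g' * h), (h * h'); split.
  + by apply: rpredB; [|rewrite addnC]; apply: dhomogM.
  + exact: dhomogM.
  + by rewrite /geval rmorphM mulf_neq0.
  + by rewrite /geval rmorphB !rmorphM /= -[- (_ / _)]mulNr addf_div // mulNr.
- move=> _ _ /asboolP[e [g [h [gH hH h0 ->]]]] /asboolP[e' [g' [h' [gH' hH' h0' ->]]]].
  apply/asboolP; have [g0'|g0'] := eqVneq (geval g') 0.
    exists 0%N, 0, 1; rewrite g0' mul0r invr0 mulr0 /geval rmorph0 mul0r.
    by rewrite rmorph1 oner_neq0 dhomog1 rpred0.
  exists (e + e')%N, (g * h'), (h * g'); split; try exact: dhomogM.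
  + by rewrite /geval rmorphM mulf_neq0.
  + by rewrite /geval !rmorphM /= invf_div mulf_div.
Qed.

HB.instance Definition _ :=
  GRing.isDivringClosed.Build L residue_pred residue_divring_closed.

Definition residue_field : Type := {a : L | a \in residue_pred}.

HB.instance Definition _ := SubType.on residue_field.
HB.instance Definition _ := Choice.on residue_field.
HB.instance Definition _ :=
  [SubChoice_isSubIntegralDomain of residue_field by <:].
HB.instance Definition _ :=
  [SubIntegralDomain_isSubField of residue_field by <:].

Lemma base_in_residue (a : F) : iota a \in residue_pred.
Proof.
apply/asboolP; exists 0%N, a%:MP, 1.
rewrite /geval rmorph1 divr1 oner_neq0 dhomog1 mmapC; split=> //.
by rewrite -[_%:MP]mulr1 mul_mpolyC dhomogZ ?dhomog1.
Qed.

Definition base_residue (a : F) : residue_field :=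
  exist _ (iota a) (base_in_residue a).

Fact base_residue_is_zmod_morphism : zmod_morphism base_residue.
Proof. by move=> a b; apply: val_inj; rewrite /= rmorphB. Qed.

Fact base_residue_is_monoid_morphism : monoid_morphism base_residue.
Proof.
by split=> [|a b]; apply: val_inj; rewrite /= ?rmorph1 ?rmorphM.
Qed.

HB.instance Definition _ := GRing.isZmodMorphism.Build F residue_field
  base_residue base_residue_is_zmod_morphism.
HB.instance Definition _ := GRing.isMonoidMorphism.Build F residue_field
  base_residue base_residue_is_monoid_morphism.

Lemma ratio_in_residue (i l : 'I_n.+1) : x 0 i / x 0 l \in residue_pred.
Proof.
apply/asboolP; have [xl0|xl0] := eqVneq (x 0 l) 0.
  exists 0%N, 0, 1; rewrite xl0 invr0 mulr0 /geval rmorph0 mul0r.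
  by rewrite rmorph1 oner_neq0 dhomog1 rpred0.
by exists 1%N, 'X_i, 'X_l; rewrite /geval !mmapX !mmap1U !dhomogX /= !mdeg1; split=> //.
Qed.

Definition ratio (i l : 'I_n.+1) : residue_field :=
  exist _ (x 0 i / x 0 l) (ratio_in_residue i l).

Definition field_of_definition (b : nat) : Prop :=
  ([set: residue_field]%classic #= `I_(#|F| ^ b))%card.

End ResidueField.

(* In the chart x_l != 0 the affine coordinates y_j (j != l, increasing) are  *)
(* the 'X_k for k : 'I_n, with j = lift l k.  The sign (-1)^l is carried by   *)
(* the coordinate j = 0, which is present only when l >= 1.                   *)

Section Charts.
Variables (F : finFieldType) (n : nat).

Definition chart_sign {R : nzRingType} (l j : 'I_n.+1) : R :=
  if j == ord0 then (-1) ^+ l else 1.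

Definition chart_subst (l j : 'I_n.+1) : {mpoly F[n]} :=
  if unlift l j is Some k then chart_sign l j * 'X_k else 1.

Definition dehomog (l : 'I_n.+1) (g : {mpoly F[n.+1]}) : {mpoly F[n]} :=
  g \mPo [tuple chart_subst l j | j < n.+1].

Definition jacobian_mx (l : 'I_n.+1) (f : 'I_n -> {mpoly F[n.+1]}) :
    'M[{mpoly F[n]}]_n :=
  \matrix_(i < n, k < n) (dehomog l (f i))^`M(k).

Definition jacobian l f : {mpoly F[n]} := \det (jacobian_mx l f).

Variables (L : closedFieldType) (iota : {rmorphism F -> L}).

Definition chart (l : 'I_n.+1) (x : 'rV[L]_n.+1) (k : 'I_n) :
    residue_field iota x :=
  chart_sign l (lift l k) * ratio iota x (lift l k) l.

Definition eval_chart (l : 'I_n.+1) (x : 'rV[L]_n.+1) (g : {mpoly F[n]}) :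
    residue_field iota x :=
  mmap (base_residue iota x) (chart l x) g.

Definition gradient (l : 'I_n.+1) (x : 'rV[L]_n.+1) (g : {mpoly F[n.+1]}) :
    'cV[residue_field iota x]_n :=
  \col_(k < n) eval_chart l x (dehomog l g)^`M(k).

Definition smooth_at l x (g : {mpoly F[n.+1]}) : Prop := gradient l x g != 0.

(* T_p P^n = k(p)^n through the chart l; subspaces are row spaces. *)
Definition tangent l x (g : {mpoly F[n.+1]}) : 'M[residue_field iota x]_n :=
  kermx (gradient l x g).

Definition codim (K : fieldType) (V : 'M[K]_n) : nat := (n - \rank V)%N.

(* The conditions do not depend on the chart l containing the point. *)
Definition transverse_at (f : 'I_n -> {mpoly F[n.+1]}) (x : 'rV[L]_n.+1) :=
  forall l, x 0 l != 0 ->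
    (forall i, smooth_at l x (f i)) /\
    codim (\bigcap_i tangent l x (f i))%MS =
      (\sum_(i < n) codim (tangent l x (f i)))%N.

Definition common_point (f : 'I_n -> {mpoly F[n.+1]}) (x : 'rV[L]_n.+1) :=
  x != 0 /\ forall i, geval iota x (f i) = 0.

(* A closed point of P^n_F is represented by its set of geometric points in   *)
(* homogeneous coordinates: a Galois orbit of P^n(L).  As L is algebraic over *)
(* F, endomorphisms of L over F are automorphisms.                            *)
Definition closed_point (x : 'rV[L]_n.+1) : set 'rV[L]_n.+1 := fun y =>
  exists (sigma : {rmorphism L -> L}) (c : L),
    [/\ forall a, sigma (iota a) = iota a, c != 0 & y = c *: map_mx sigma x].

Definition jacobian_square f l (x : 'rV[L]_n.+1) : Prop :=
  exists u : residue_field iota x,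
    u != 0 /\ eval_chart l x (jacobian l f) = u ^+ 2.

Definition positive_at f (x : 'rV[L]_n.+1) : Prop :=
  transverse_at f x /\ exists2 l, x 0 l != 0 & jacobian_square f l x.

Definition negative_at f (x : 'rV[L]_n.+1) : Prop :=
  transverse_at f x /\ exists2 l, x 0 l != 0 & ~ jacobian_square f l x.

Definition positive_even_points f : set (set 'rV[L]_n.+1) := fun p =>
  exists x b, [/\ p = closed_point x, common_point f x,
    field_of_definition iota x b, ~~ odd b & positive_at f x].

Definition negative_odd_points f : set (set 'rV[L]_n.+1) := fun p =>
  exists x b, [/\ p = closed_point x, common_point f x,
    field_of_definition iota x b, odd b & negative_at f x].

End Charts.

(* Main.v *)
From HB Require Import structures.
Require Import Defs.
From mathcomp Require Import all_boot all_order all_fingroup all_solvable.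
From mathcomp Require Import all_algebra all_field zify ring.
From mathcomp Require Import boolp classical_sets cardinality.
From mathcomp Require Import mpoly.

Set Implicit Arguments.
Unset Strict Implicit.
Unset Printing Implicit Defensive.

Import GRing.Theory.
Local Open Scope ring_scope.

(* Write L for the algebraic closure, q for the order of the base field, D    *)
(* for the product of the degrees d_i, and 2 s for sum d_i - n - 1.  At a     *)
(* common zero x, the determinant bordering the Jacobian matrix of the f_i by *)
(* a linear form a equals lambda(x) a(x); in each chart it is the Jacobian up *)
(* to the 2 s-th power of a coordinate.  In the affine space where a = 1, the *)
(* Bezoutian of the f_i and a - 1 shows that the relations among the values   *)
(* of forms of degree s at the common zeros form an isotropic subspace for    *)
(* the diagonal form (lambda(x))_x; comparing with the number of monomials    *)
(* gives D common zeros and shows that the rank of these values is D / 2, so  *)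
(* this subspace is Lagrangian.  It is defined over the base field, hence the *)
(* discriminant (-1)^(D/2) prod lambda(x) has a square root on which          *)
(* Frobenius acts by the sign of its permutation pi of the common zeros.      *)
(* Raising to the power (q - 1)/2 yields                                      *)
(*   (-1)^(D/2 (q-1)/2) = sgn(pi) (prod lambda(x))^((q-1)/2),                 *)
(* and the right-hand side is a product over the orbits of pi, that is, over  *)
(* the closed points.  An orbit of length b contributes (-1)^(b-1) times the  *)
(* quadratic character of lambda in F_(q^b), which is -1 exactly for positive *)
(* points with b even and negative points with b odd.                         *)

(** The hard point is that the rank is exactly D / 2. In an affine slice a = 1 meeting all the
    common zeros, let u_k ([urank]) be the rank of the evaluation of polynomials of degree at most k
    at these c zeros, and let sigma = sum (d_i - 1) = 2 s + 1. On pairs of zeros the Bezoutian is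
    the diagonal matrix of Jacobians ([bezoutian_points]), so relations of degrees j and k are
    orthogonal when j + k + 1 >= sigma ([jac_isotropic]), and u_j + u_k >= c ([urank_add]).

    The opposite bound comes from counting monomials. Products F^a times monomials independent on
    the zeros stay independent ([sum_urank_le]), and products of F^a with interpolating polynomials
    span up to a boundary term ([card_monomials_le]). Dividing exponents by the degrees organizes
    the monomials by the same weights. First-order growth gives c = D ([card_eq_prod]); second-order
    growth bounds sum (c - u_j) over j < sigma below by c sigma / 2 ([sum_bdeg_le]). This forces
    equality for the self-paired index s, that is 2 u_s = c ([u_middle]). [forms_lagrangian]
    transports the result to forms.

    For the arithmetic, a Frobenius-equivariant function on the zeros is the evaluation of a form
    over the base field ([equivariant_interpolation]). Hence residue fields are fixed fields of
    powers of Frobenius ([in_residueP]) and closed points are orbits of pi ([closed_pointE]).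
    [lagrangian_determinant] and [orbit_sign] then combine in [orbit_count_parity]. *)

Section PolynomialSupport.
Variables (N : nat) (R : comNzRingType).
Implicit Types (p q : {mpoly R[N]}) (P Q S : pred nat).

Lemma mpoly_algebra_ind (T : {mpoly R[N]} -> Prop) :
    (forall c, T c%:MP) -> (forall i, T 'X_i) ->
    (forall p q, T p -> T q -> T (p + q)) ->
    (forall p q, T p -> T q -> T (p * q)) ->
  forall p, T p.
Proof.
move=> TC TX TD TM; elim/mpolyind => [|c m p _ _ Tp]; first exact: (TC 0).
apply: TD => //; rewrite -mul_mpolyC; apply: (TM) => //.
rewrite mpolyXE_id; apply: (big_ind T) => [|f g Tf Tg|i _]; first exact: (TC 1).
  exact: TM.
elim: (m i) => [|a IH]; first exact: (TC 1).
by rewrite exprS; apply: (TM).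
Qed.

(** A single predicate covers bounded degree ([degle]), order of vanishing at 0 ([low]) and
    homogeneity ([homog_supp]), so that stability under sums and products is proved once. *)
Definition supp_in (P : pred nat) p := forall m, ~~ P (mdeg m) -> p@_m = 0.

Lemma supp_in0 P : supp_in P 0.
Proof. by move=> m _; rewrite mcoeff0. Qed.

Lemma supp_inD P p q : supp_in P p -> supp_in P q -> supp_in P (p + q).
Proof. by move=> Pp Pq m Pm; rewrite mcoeffD Pp // Pq // addr0. Qed.

Lemma supp_inN P p : supp_in P p -> supp_in P (- p).
Proof. by move=> Pp m Pm; rewrite mcoeffN Pp // oppr0. Qed.

Lemma supp_inB P p q : supp_in P p -> supp_in P q -> supp_in P (p - q).
Proof. by move=> Pp Pq; apply/supp_inD/supp_inN. Qed.

Lemma supp_inZ P c p : supp_in P p -> supp_in P (c *: p).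
Proof. by move=> Pp m Pm; rewrite mcoeffZ Pp // mulr0. Qed.

Lemma supp_in_sum P (I : Type) (r : seq I) (C : pred I) (F : I -> {mpoly R[N]}) :
  (forall i, C i -> supp_in P (F i)) -> supp_in P (\sum_(i <- r | C i) F i).
Proof.
by move=> PF; apply: (big_ind (supp_in P)) => //; [exact: supp_in0|exact: supp_inD].
Qed.

Lemma supp_inX P m : P (mdeg m) -> supp_in P 'X_[m].
Proof. by move=> Pm m' Pm'; rewrite mcoeffX; case: eqP => // e; rewrite -e Pm in Pm'. Qed.

Lemma supp_inC P c : P 0%N -> supp_in P c%:MP.
Proof.
move=> P0 m Pm; rewrite mcoeffC; case: eqP => [e|_]; last by rewrite mulr0.
by rewrite e mdeg0 P0 in Pm.
Qed.

Lemma supp_in_sub P Q p : (forall k, P k -> Q k) -> supp_in P p -> supp_in Q p.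
Proof. by move=> PQ Pp m Qm; apply: Pp; apply: contra Qm; apply: PQ. Qed.

Lemma supp_in_msupp P p m : supp_in P p -> m \in msupp p -> P (mdeg m).
Proof. by move=> Pp; rewrite mcoeff_msupp; apply: contraNT => /Pp ->. Qed.

Lemma supp_inM P Q S p q : (forall a b, P a -> Q b -> S (a + b)%N) ->
  supp_in P p -> supp_in Q q -> supp_in S (p * q).
Proof.
move=> PQS Pp Qq; rewrite (mpolyE p) (mpolyE q) big_distrl /= big_seq.
apply: supp_in_sum => m1 m1p; rewrite big_distrr /= big_seq.
apply: supp_in_sum => m2 m2q.
rewrite -scalerAl -scalerAr -mpolyXD; do 2!apply: supp_inZ.
by apply: supp_inX; rewrite mdegD; apply: PQS; [exact: supp_in_msupp m1p|exact: supp_in_msupp m2q].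
Qed.

Definition degle (k : nat) := supp_in (fun j => j <= k)%N.
Definition low (k : nat) := supp_in (fun j => k <= j)%N.

Lemma degleM a b p q : degle a p -> degle b q -> degle (a + b) (p * q).
Proof. by apply: supp_inM => i j; apply: leq_add. Qed.

Lemma lowM a b p q : low a p -> low b q -> low (a + b) (p * q).
Proof. by apply: supp_inM => i j; apply: leq_add. Qed.

Lemma degleW a b p : (a <= b)%N -> degle a p -> degle b p.
Proof. by move=> ab; apply: supp_in_sub => k ka; apply: leq_trans ka ab. Qed.

Lemma lowW a b p : (b <= a)%N -> low a p -> low b p.
Proof. by move=> ab; apply: supp_in_sub => k; apply: leq_trans ab. Qed.

Lemma degle_msize p : degle (msize p).-1 p.
Proof.
move=> m; rewrite -ltnNge => lt; apply/memN_msupp_eq0/msize_mdeg_ge.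
by case: (msize p) lt.
Qed.

Lemma homog_supp d p : p \is d.-homog <-> supp_in (pred1 d) p.
Proof.
split=> [h m /= md|h]; first exact: dhomog_nemf_coeff h md.
by apply/dhomogP => m /(supp_in_msupp h) /eqP.
Qed.

Lemma mcoeff_pihomog k p m :
  (pihomog mdeg k p)@_m = if mdeg m == k then p@_m else 0.
Proof.
elim/mpolyind: p => [|c m' p _ _ IH]; first by rewrite pihomog0 mcoeff0 if_same.
rewrite pihomogD linearZ /= pihomogX !mcoeffD {}IH !mcoeffZ.
have [<-|mk] := eqVneq m' m; first by case: ifP => _; rewrite ?mcoeff0 ?mulr0 ?add0r.
rewrite mcoeffX (negPf mk) mulr0 add0r.
by case: (mdeg m' == k); rewrite ?mcoeffX ?(negPf mk) ?mcoeff0 ?mulr0 add0r.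
Qed.

Lemma pihomogM e k p q : q \is e.-homog ->
  pihomog mdeg k (p * q) = if (e <= k)%N then pihomog mdeg (k - e) p * q else 0.
Proof.
move=> qh; elim/mpolyind: p => [|c m p _ _ IH].
  by rewrite !(mul0r, pihomog0) if_same.
rewrite mulrDl pihomogD {}IH -scalerAl linearZ /= pihomogD linearZ /= pihomogX.
have h : 'X_[m] * q \is (mdeg m + e).-homog by apply: dhomogM; rewrite ?dhomogX /=.
case: ifP => [ek|ek].
  case: (eqVneq (mdeg m) (k - e)%N) => mk.
    by rewrite mulrDl -scalerAl pihomog_dE // -[k](subnK ek) -mk.
  rewrite (pihomog_ne0 _ h) ?scaler0 ?add0r //.
  by apply: contraNneq mk => <-; rewrite addnK.
rewrite (pihomog_ne0 _ h) ?scaler0 ?addr0 //.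
by apply: contraFneq ek => <-; rewrite leq_addl.
Qed.

End PolynomialSupport.

(** * Zeros of ideals *)

Section Ideals.
Variables (N : nat) (L : closedFieldType).
Implicit Types (f g a : {mpoly L[N]}) (I : {mpoly L[N]} -> Prop).

Definition ideal I :=
  [/\ I 0, forall f g, I f -> I g -> I (f + g) & forall a f, I f -> I (a * f)].

Definition adjoin I g : {mpoly L[N]} -> Prop := fun f => exists a, I (f - a * g).

Lemma idealB I f g : ideal I -> I f -> I g -> I (f - g).
Proof. by case=> I0 ID IM If Ig; apply: ID => //; rewrite -mulN1r; apply: IM. Qed.

Lemma idealMr I f g : ideal I -> I f -> I (f * g).
Proof. by case=> I0 ID IM If; rewrite mulrC; apply: IM. Qed.

Lemma idealZ I c f : ideal I -> I f -> I (c *: f).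
Proof. by case=> I0 ID IM If; rewrite -mul_mpolyC; apply: IM. Qed.

Lemma ideal_sum I (J : Type) (r : seq J) (C : pred J) (F : J -> {mpoly L[N]}) :
  ideal I -> (forall i, C i -> I (F i)) -> I (\sum_(i <- r | C i) F i).
Proof. by case=> I0 ID _ IF; apply: (big_ind I). Qed.

Lemma adjoin_ideal I g : ideal I -> ideal (adjoin I g).
Proof.
move=> hI; case: (hI) => I0 ID IM; split.
- by exists 0; rewrite mul0r subr0.
- move=> f f' [a Ia] [a' Ia']; exists (a + a').
  by rewrite mulrDl opprD addrACA; apply: ID.
- by move=> b f [a Ia]; exists (b * a); rewrite -mulrA -mulrBr; apply: IM.
Qed.

Lemma adjoin_sub I g f : I f -> adjoin I g f.
Proof. by move=> If; exists 0; rewrite mul0r subr0. Qed.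

Lemma adjoin_gen I g : ideal I -> adjoin I g g.
Proof. by case=> I0 _ _; exists 1; rewrite mul1r subrr. Qed.

(** P splits into factors X - z. If every f - z were invertible modulo I, these factors could be
    cancelled one after the other from P(f) in I, leaving 1 in I. *)
Lemma proper_adjoin_root I f (P : {poly L}) : ideal I -> ~ I 1 -> P != 0 ->
    I (map_poly (@mpolyC N L) P).[f] ->
  exists r, ~ adjoin I (f - r%:MP) 1.
Proof.
move=> hI I1 P0 IP; apply: contrapT => /forallNP noroot; apply: I1.
have [I0 ID IM] := hI.
have [rs Prs] := closed_field_poly_normal P.
have prodI (s : seq L) a : I (\prod_(z <- s) (f - z%:MP) * a) -> I a.
  elim: s a => [|z s IH] a; first by rewrite big_nil mul1r.
  rewrite big_cons => Ia; apply: IH; set b := _ * a.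
  have [c Ic] := contrapT (noroot z).
  rewrite -[b]mul1r -[1](subrK (c * (f - z%:MP))) mulrDl; apply: ID.
    exact: idealMr.
  by rewrite -mulrA; apply: IM; rewrite /b mulrA.
apply: (prodI rs); rewrite mulr1.
have -> : \prod_(z <- rs) (f - z%:MP) =
    (lead_coef P)^-1 *: (map_poly (@mpolyC N L) P).[f].
  rewrite {2}Prs linearZ /= rmorph_prod /= hornerZ horner_prod mul_mpolyC scalerA.
  rewrite mulVf ?lead_coef_eq0 // scale1r; apply: eq_bigr => z _.
  by rewrite rmorphB /= map_polyX map_polyC /= hornerXsubC.
exact: idealZ.
Qed.

(** Nullstellensatz for ideals modulo which every coordinate is algebraic: adjoin some 'X_j - p_j
    for one j after the other, keeping the ideal proper. *)
Lemma ideal_has_zero I : ideal I -> ~ I 1 ->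
    (forall j : 'I_N, exists2 P : {poly L}, P != 0 &
       I (map_poly (@mpolyC N L) P).['X_j]) ->
  exists p : 'I_N -> L, forall f, I f -> f.@[p] = 0.
Proof.
move=> hI I1 Ialg.
have step (s : seq 'I_N) : exists (p : 'I_N -> L) I',
    [/\ ideal I', forall f, I f -> I' f, ~ I' 1 &
        forall j, j \in s -> I' ('X_j - (p j)%:MP)].
  elim: s => [|j s [p [I' [hI' II' I'1 I's]]]]; first by exists (fun=> 0), I.
  have [js|js] := boolP (j \in s).
    by exists p, I'; split=> // k; rewrite inE => /predU1P[->|]; apply: I's.
  have [P P0 IP] := Ialg j.
  have [r rP] := proper_adjoin_root hI' I'1 P0 (II' _ IP).
  exists (fun k => if k == j then r else p k), (adjoin I' ('X_j - r%:MP)).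
  split=> // [|f /II' If|k]; [exact: adjoin_ideal|exact: adjoin_sub|].
  rewrite inE; case: eqP => [-> _|_ /= ks]; first exact: adjoin_gen.
  exact/adjoin_sub/I's.
have [p [I' [hI' II' I'1 I's]]] := step (enum 'I_N).
have [I0 ID IM] := hI'.
(* Modulo I' every polynomial is its value at p, so a nonzero value of a member of I would make I'
   the unit ideal. *)
have cong f : I' (f - (f.@[p])%:MP).
  elim/mpoly_algebra_ind: f => [c|i|f g Hf Hg|f g Hf Hg].
  - by rewrite mevalC subrr.
  - by rewrite mevalXU; apply: I's; rewrite mem_enum.
  - by rewrite mevalD mpolyCD opprD addrACA; apply: ID.
  - rewrite mevalM mpolyCM.
    have -> : f * g - (f.@[p])%:MP * (g.@[p])%:MP =
       g * (f - (f.@[p])%:MP) + (f.@[p])%:MP * (g - (g.@[p])%:MP).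
      by rewrite !mulrBr (mulrC g f) (mulrC g) addrA subrK.
    by apply: ID; apply: IM.
exists p => f /II' If; apply/eqP; apply: contra_notT I'1 => fp.
have : I' (f.@[p])%:MP by rewrite -[_%:MP](subKr f); apply: idealB.
by move/(IM (f.@[p])^-1%:MP); rewrite -mpolyCM mulVf.
Qed.

Lemma exists_left_kernel (m n : nat) (A : 'M[L]_(m, n)) : (n < m)%N ->
  exists2 v : 'rV_m, v != 0 & v *m A = 0.
Proof.
move=> nm; have : kermx A != 0.
  by rewrite kermx_eq0 /row_free neq_ltn (leq_ltn_trans (rank_leq_col A) nm).
case/rowV0Pn => v /sub_kermxP vA v0; by exists v.
Qed.

(** Modulo I the powers of f live in the span of the K monomials of degree at most k, so K + 1 of
    them satisfy a linear relation. *)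
Lemma fintype_algebraic I k (f : {mpoly L[N]}) : ideal I ->
    (forall f, exists2 g, degle k g & I (f - g)) ->
  exists2 P : {poly L}, P != 0 & I (map_poly (@mpolyC N L) P).[f].
Proof.
move=> hI red.
pose K := #|{: 'X_{1..N < k.+1}}|.
have /choice[g gP] (i : 'I_K.+1) : exists g, degle k g /\ I (f ^+ i - g).
  by have [g g1 g2] := red (f ^+ i); exists g.
pose A : 'M_(K.+1, K) := \matrix_(i, j) (g i)@_(enum_val j : 'X_{1..N < k.+1}).
have [v v0 vA] := exists_left_kernel A (ltnSn K).
have vg : \sum_i v 0 i *: g i = 0.
  apply/mpolyP => m; rewrite mcoeff0 raddf_sum /=.
  have [mk|mk] := leqP (mdeg m) k; last first.
    rewrite big1 // => i _; rewrite mcoeffZ (gP i).1 ?mulr0 //.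
    by rewrite -ltnNge.
  have mk' : (mdeg m < k.+1)%N by [].
  transitivity ((v *m A) 0 (enum_rank (BMultinom mk'))); last by rewrite vA mxE.
  by rewrite mxE; apply: eq_bigr => i _; rewrite mcoeffZ mxE enum_rankK.
exists (\poly_(i < K.+1) v 0 (inord i)).
  apply: contraNneq v0 => /polyP v0; apply/eqP/rowP => i; rewrite mxE.
  by have := v0 i; rewrite coef_poly ltn_ord inord_val coef0.
rewrite poly_def rmorph_sum /= horner_sum.
set S := (X in I X); have -> : S = S - \sum_i v 0 i *: g i by rewrite vg subr0.
rewrite -sumrB.
apply: ideal_sum => // i _.
rewrite map_polyZ /= map_polyXn hornerZ hornerXn inord_val mul_mpolyC -scalerBr.
by apply: idealZ => //; case: (gP i).
Qed.

Definition homog_ideal I :=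
  ideal I /\ forall f k, I f -> I (pihomog mdeg k f).

Lemma adjoin_homog_ideal I e g : homog_ideal I -> g \is e.-homog ->
  homog_ideal (adjoin I g).
Proof.
move=> [hI hh] gh; split=> [|f k [a Ia]]; first exact: adjoin_ideal.
exists (if (e <= k)%N then pihomog mdeg (k - e) a else 0).
have := hh _ k Ia; rewrite pihomogB (pihomogM _ _ gh).
by case: ifP => //; rewrite mul0r.
Qed.

Lemma ideal_of_monomials I (P : pred nat) f : ideal I ->
  (forall m, P (mdeg m) -> I 'X_[m]) -> supp_in P f -> I f.
Proof.
move=> hI IX Pf; rewrite (mpolyE f) big_seq; apply: ideal_sum => // m mf.
by apply: idealZ => //; apply: IX; apply: supp_in_msupp mf.
Qed.

Lemma pihomog_mul_var k f (j : 'I_N) :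
  pihomog mdeg k (f * 'X_j) = if (0 < k)%N then pihomog mdeg k.-1 f * 'X_j else 0.
Proof. by rewrite (@pihomogM _ _ 1) ?dhomogX /= ?mdeg1 // subn1. Qed.

(* Setting 'X_j = 1: if 1 = i + b ('X_j - 1) with i in I, then the components *)
(* of degree k of both sides give b_k = b_(k-1) 'X_j mod I, so b_k = - 'X_j^k *)
(* and this vanishes for large k.                                             *)
Lemma homog_ideal_power I (j : 'I_N) : homog_ideal I ->
  adjoin I ('X_j - 1) 1 -> exists K, I ('X_j ^+ K).
Proof.
move=> [hI hh] [b Ib]; have [I0 ID IM] := hI.
have comp k : I (pihomog mdeg k b + 'X_j ^+ k).
  elim: k => [|k IH].
    have := hh _ 0%N Ib; rewrite mulrBr mulr1 opprB pihomogD pihomogB.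
    by rewrite pihomog_mul_var /= subr0 pihomog_dE ?dhomog1 // addrC.
  have := hh _ k.+1 Ib; rewrite mulrBr mulr1 opprB pihomogD pihomogB.
  rewrite pihomog_mul_var /= (pihomog_ne0 _ (dhomog1 _ _)) // add0r => Ik.
  have := ID _ _ Ik (idealMr 'X_j hI IH).
  by rewrite mulrDl addrA subrK -exprSr.
exists (msize b); rewrite -['X_j ^+ _]add0r.
have <- : pihomog mdeg (msize b) b = 0; last exact: comp.
rewrite pihomogE big_seq_cond big1 // => m /andP[/msize_mdeg_lt mb /eqP e].
by rewrite e ltnn in mb.
Qed.

(** Projective Nullstellensatz, by induction on the number t of variables that may lie outside I.
    The induction hypothesis for I + ('X_j0) makes high-degree monomials divisible by 'X_j0 modulo
    I; then some power of 'X_j0 is shown to lie in I. *)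
Lemma homog_ideal_contains_power (I : {mpoly L[N]} -> Prop) (t : nat) :
    homog_ideal I -> (forall j : 'I_N, (t <= j)%N -> I 'X_j) ->
    (forall p : 'I_N -> L, (forall f, I f -> f.@[p] = 0) -> forall j, p j = 0) ->
  exists k0, forall f, low k0 f -> I f.
Proof.
elim: t I => [|t IHt] I hI IX nozero.
  have [[I0 ID IM] _] := hI; exists 1%N => f f1.
  apply: (ideal_of_monomials (proj1 hI) _ f1) => m /= m0.
  have /existsP[j mj] : [exists j : 'I_N, m j != 0%N].
    rewrite -negb_forall; apply: contraL m0 => /forallP m0.
    by rewrite mdegE big1 // => i _; apply/eqP/m0.
  rewrite -[m](@submK _ U_(j)%MM) ?lep1mP // mpolyXD.
  by apply: IM; apply: IX.
have [Nt|tN] := leqP N t.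
  by apply: IHt => // j tj; have := ltn_ord j; rewrite ltnNge (leq_trans Nt tj).
pose j0 := Ordinal tN; have [hI0 hh] := hI; have [I0 ID IM] := hI0.
have X1 : ('X_j0 : {mpoly L[N]}) \is 1.-homog by rewrite dhomogX /= mdeg1.
have [|j tj|p pP j|k1 k1P] := IHt (adjoin I 'X_j0).
- exact: adjoin_homog_ideal X1.
- have [->|jt] := eqVneq j j0; first exact: adjoin_gen.
  by apply/adjoin_sub/IX; rewrite ltn_neqAle tj andbT eq_sym.
- by apply: nozero => f If; apply/pP/adjoin_sub.
pose k0 := k1.+1.
have monom m : (k0 <= mdeg m)%N ->
    exists2 a, a \is (mdeg m).-1.-homog & I ('X_[m] - a * 'X_j0).
  move=> mk; have [a Ia] := k1P 'X_[m] (supp_inX _ (ltnW mk)).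
  exists (pihomog mdeg (mdeg m).-1 a); first exact: pihomogP.
  have := hh _ (mdeg m) Ia.
  by rewrite pihomogB pihomog_mul_var (leq_trans _ mk) // pihomog_dE ?dhomogX.
(* Dehomogenize at 'X_j0 = 1. There the divisibility [monom] lowers degrees, so the quotient by J is
   spanned by polynomials of degree at most k0. *)
pose J := adjoin I ('X_j0 - 1).
have hJ : ideal J by exact: adjoin_ideal.
have [J0 JD JM] := hJ.
have red f : exists2 g, degle k0 g & J (f - g).
  have [k fk] : exists k, degle (k0 + k) f.
    by exists (msize f).-1; apply: (degleW _ (@degle_msize _ _ f)); rewrite leq_addl.
  elim: k f fk => [|k IH] f fk; first by exists f; rewrite ?subrr // -[k0]addn0.
  suff [g gk Jg] : exists2 g, degle (k0 + k) g & J (f - g).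
    have [h hk Jh] := IH g gk; exists h => //.
    by rewrite -(subrK g f) -addrA; apply: JD.
  rewrite (mpolyE f) big_seq; apply: (big_ind (fun f => exists2 g, degle (k0 + k) g & J (f - g))).
  - by exists 0; rewrite ?subrr //; apply: supp_in0.
  - move=> f1 f2 [g1 g1k J1] [g2 g2k J2]; exists (g1 + g2); first exact: supp_inD.
    by rewrite opprD addrACA; apply: JD.
  - move=> m /(supp_in_msupp fk) /= mk.
    have [mk'|mk'] := leqP (mdeg m) (k0 + k).
      by exists (f@_m *: 'X_[m]); rewrite ?subrr //; apply/supp_inZ/supp_inX.
    have [|a ah Ia] := monom m; first by rewrite (leq_trans _ mk') // leqW ?leq_addr.
    exists (f@_m *: a).
      apply: supp_inZ; move/homog_supp: ah; apply: supp_in_sub => i /eqP ->.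
      by rewrite -ltnS prednK ?(leq_trans _ mk') // -addnS.
    rewrite -scalerBr; apply: idealZ => //.
    rewrite -(subrK (a * 'X_j0) 'X_[m]) -addrA -[X in _ + (_ - X)]mulr1 -mulrBr.
    by apply: JD; [exact: adjoin_sub|apply/JM/adjoin_gen].
(* A zero of J would be a zero of I whose coordinate j0 is 1, which [nozero] forbids. *)
have J1 : J 1.
  apply: contrapT => J1; have [|p pP] := ideal_has_zero hJ J1.
    by move=> j; apply: fintype_algebraic hJ red.
  have := nozero p (fun f If => pP f (adjoin_sub _ If)) j0.
  have := pP _ (adjoin_gen ('X_j0 - 1) hI0); rewrite mevalB mevalXU meval1.
  by move=> /eqP; rewrite subr_eq0 => /eqP -> /eqP; rewrite oner_eq0.
have [K IK] := homog_ideal_power hI J1.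
exists (k0 + K)%N => f.
(* Each unit of degree above k0 yields one more factor 'X_j0 modulo I; K of them suffice. *)
have divis i g : low (k0 + i) g -> exists a, I (g - a * 'X_j0 ^+ i).
  elim: i g => [|i IH] g gi; first by exists g; rewrite expr0 mulr1 subrr.
  suff [g' g'i Ig] : exists2 g', low (k0 + i) g' & I (g - g' * 'X_j0).
    have [a Ia] := IH g' g'i; exists a.
    rewrite -(subrK (g' * 'X_j0) g) -addrA; apply: ID => //.
    by rewrite exprSr mulrA -mulrBl; apply: idealMr.
  rewrite (mpolyE g) big_seq; apply: (big_ind (fun f => exists2 g, low (k0 + i) g & I (f - g * 'X_j0))).
  - by exists 0; rewrite ?mul0r ?subrr //; apply: supp_in0.
  - move=> f1 f2 [g1 g1k J1'] [g2 g2k J2]; exists (g1 + g2); first exact: supp_inD.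
    by rewrite mulrDl opprD addrACA; apply: ID.
  - move=> m /(supp_in_msupp gi) /= mk.
    have [|a ah Ia] := monom m; first by rewrite (leq_trans _ mk) ?leq_addr.
    exists (g@_m *: a); last by rewrite -scalerAl -scalerBr; apply: idealZ.
    apply: supp_inZ; move/homog_supp: ah; apply: supp_in_sub => l /eqP ->.
    by rewrite -ltnS prednK ?(leq_trans _ mk) // -addnS.
by case/divis => a Ia; rewrite -(subrK (a * 'X_j0 ^+ K) f); apply/ID/IM.
Qed.

End Ideals.

(** * Bezoutians *)

Section Bezoutian.
Variables (N : nat) (L : closedFieldType).
Implicit Types (f g h : {mpoly L[N]}) (p z : 'rV[L]_N).

Local Notation ev p f := (f.@[fun i => p 0 i]).

(** Polynomials in two groups of variables, X and z, of total degree at most k, seen as functions of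
    the point z with values in polynomials in X. Keeping them as sums of products u(X) v(z) is what
    [bez_orthogonal] exploits. *)
Inductive bez (k : nat) : ('rV[L]_N -> {mpoly L[N]}) -> Prop :=
| Bez0 : bez k (fun=> 0)
| BezD Phi Psi : bez k Phi -> bez k Psi -> bez k (fun z => Phi z + Psi z)
| BezM a b u v : degle a u -> degle b v -> (a + b <= k)%N ->
    bez k (fun z => ev z v *: u).

Lemma eq_bez k Phi Psi : Phi =1 Psi -> bez k Phi -> bez k Psi.
Proof. by move=> /funext ->. Qed.

Lemma bezW k l Phi : (k <= l)%N -> bez k Phi -> bez l Phi.
Proof.
move=> kl; elim=> [|P Q _ HP _ HQ|a b u v ua vb abk]; first exact: Bez0.
  exact: BezD.
by apply: BezM ua vb _; apply: leq_trans kl.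
Qed.

Lemma bez_mul k l Phi Psi :
  bez k Phi -> bez l Psi -> bez (k + l) (fun z => Phi z * Psi z).
Proof.
move=> HP HQ; elim: HP => [|P P' _ IH _ IH'|a b u v ua vb abk].
- by apply: eq_bez (Bez0 _) => z; rewrite mul0r.
- by apply: eq_bez (BezD IH IH') => z; rewrite mulrDl.
elim: HQ => [|P P' _ IH _ IH'|c e x y xc ye cel].
- by apply: eq_bez (Bez0 _) => z; rewrite mulr0.
- by apply: eq_bez (BezD IH IH') => z; rewrite mulrDr.
apply: eq_bez (BezM (degleM ua xc) (degleM vb ye) _) => [z|].
  by rewrite mevalM -scalerAl -scalerAr scalerA.
by rewrite addnACA leq_add.
Qed.

Lemma bez_degle k Phi z : bez k Phi -> degle k (Phi z).
Proof.
elim=> [|P Q _ HP _ HQ|a b u v ua vb abk]; first exact: supp_in0.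
  exact: supp_inD.
by apply: supp_inZ; apply: degleW ua; apply: leq_trans abk; apply: leq_addr.
Qed.

Lemma bezZ k c Phi : bez k Phi -> bez k (fun z => c *: Phi z).
Proof.
move=> HP; rewrite -[k]add0n.
apply: eq_bez (bez_mul (@BezM 0%N 0 0 c%:MP 1 _ _ _) HP) => [z|||//].
- by rewrite meval1 scale1r mul_mpolyC.
- exact: supp_inC.
- exact: supp_inC.
Qed.

Lemma bez_sum k (J : Type) (r : seq J) (C : pred J) Phi :
  (forall j, C j -> bez k (Phi j)) ->
  bez k (fun z => \sum_(j <- r | C j) Phi j z).
Proof.
move=> H; elim: r => [|j r IH]; first by apply: eq_bez (Bez0 _) => z; rewrite big_nil.
case: (boolP (C j)) => Cj.
  by apply: eq_bez (BezD (H j Cj) IH) => z; rewrite big_cons Cj.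
by apply: eq_bez IH => z; rewrite big_cons (negPf Cj).
Qed.

Lemma bez_prod (J : Type) (r : seq J) (k : J -> nat) Phi :
  (forall j, bez (k j) (Phi j)) ->
  bez (\sum_(j <- r) k j) (fun z => \prod_(j <- r) Phi j z).
Proof.
move=> H; elim: r => [|j r IH].
  rewrite big_nil; apply: (@eq_bez _ (fun z => ev z 1 *: 1)) => [z|].
    by rewrite big_nil meval1 scale1r.
  by apply: (@BezM _ 0%N 0%N); rewrite // -mpolyC1; apply: supp_inC.
rewrite big_cons; apply: eq_bez (bez_mul (H j) IH) => z.
by rewrite big_cons.
Qed.

Lemma bez_det (k : 'I_N -> nat) (Phi : 'I_N -> 'I_N -> 'rV[L]_N -> {mpoly L[N]}) :
  (forall i j, bez (k i) (Phi i j)) ->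
  bez (\sum_i k i) (fun z => \det (\matrix_(i, j) Phi i j z)).
Proof.
move=> H; apply: bez_sum => s _.
apply: (@eq_bez _ (fun z => ((-1) ^+ s : L) *: \prod_i Phi i (s i) z)) => [z|].
  rewrite -mul_mpolyC rmorphXn rmorphN1; congr (_ * _).
  by apply: eq_bigr => i _; rewrite mxE.
by apply: bezZ; apply: bez_prod.
Qed.

(* For fixed z, the quotients Theta_j z are those of the telescoping          *)
(* expansion of f(X) - f(z) along the coordinates; they agree with the        *)
(* partial derivatives of f on the diagonal.                                  *)
Definition divided_difference k f (Theta : 'I_N -> 'rV[L]_N -> {mpoly L[N]}) :=
  [/\ forall j, bez k (Theta j),
      forall z, f = (ev z f)%:MP + \sum_j ('X_j - (z 0 j)%:MP) * Theta j z &
      forall z j, ev z (Theta j z) = ev z (f^`M(j))].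

Lemma divided_differenceD k f g Theta Psi :
  divided_difference k f Theta -> divided_difference k g Psi ->
  divided_difference k (f + g) (fun j z => Theta j z + Psi j z).
Proof.
move=> [F1 F2 F3] [G1 G2 G3]; split=> [j|z|z j]; first exact: BezD.
  rewrite {1}(F2 z) {1}(G2 z) mevalD mpolyCD addrACA -big_split /=.
  by congr (_ + _); apply: eq_bigr => j _; rewrite mulrDr.
by rewrite mderivD !mevalD F3 G3.
Qed.

Lemma divided_differenceZ k c f Theta :
  divided_difference k f Theta ->
  divided_difference k (c *: f) (fun j z => c *: Theta j z).
Proof.
move=> [F1 F2 F3]; split=> [j|z|z j]; first exact: bezZ.
  rewrite {1}(F2 z) scalerDr mevalZ mpolyCM mul_mpolyC scaler_sumr.
  by congr (_ + _); apply: eq_bigr => j _; rewrite -scalerAr.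
by rewrite mderivZ !mevalZ F3.
Qed.

Lemma divided_differenceC k c : divided_difference k c%:MP (fun _ _ => 0).
Proof.
split=> [j|z|z j]; first exact: Bez0.
  by rewrite mevalC big1 ?addr0 // => j _; rewrite mulr0.
by rewrite mderivC meval0.
Qed.

Lemma divided_differenceX j :
  divided_difference 0 'X_j (fun k _ => (k == j)%:R).
Proof.
split=> [k|z|z k].
- apply: (@eq_bez _ (fun z => ev z ((k == j)%:R)%:MP *: 1)) => [z|].
    by rewrite mevalC -mul_mpolyC mulr1 mpolyC_nat.
  by apply: (@BezM _ 0%N 0%N); rewrite // -?mpolyC1; apply: supp_inC.
- rewrite mevalXU (bigD1 j) //= eqxx mulr1 big1 ?addr0 => [|k /negPf ->].
    by rewrite addrC subrK.
  by rewrite mulr0.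
- rewrite mderivX mnm1E (eq_sym k j); case: eqP => [->|_]; last first.
    by rewrite scale0r meval0.
  have -> : (U_(k) - U_(k) = 0)%MM by apply/mnmP => i; rewrite mnmBE subnn mnm0E.
  by rewrite scale1r mpolyX0 meval1.
Qed.

(** From X_j f - z_j f(z) = (X_j - z_j) f + z_j (f - f(z)). *)
Lemma divided_difference_mul k f Theta j :
  divided_difference k f Theta -> degle k.+1 f ->
  divided_difference k.+1 ('X_j * f)
    (fun i z => (i == j)%:R * f + (z 0 j)%:MP * Theta i z).
Proof.
move=> [F1 F2 F3] fk; split=> [i|z|z i].
- apply: BezD.
    apply: (@eq_bez _ (fun z => ev z ((i == j)%:R)%:MP *: f)) => [z|].
      by rewrite mevalC -mpolyC_nat mul_mpolyC.
    by apply: (@BezM _ k.+1 0%N) => //; [exact: supp_inC|rewrite addn0].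
  rewrite -add1n; apply: bez_mul (F1 i).
  apply: (@eq_bez _ (fun z => ev z 'X_j *: 1)) => [z|].
    by rewrite mevalXU -mul_mpolyC mulr1.
  apply: (@BezM _ 0%N 1%N) => //; first by rewrite -mpolyC1; apply: supp_inC.
  by apply: supp_inX; rewrite mdeg1.
- have E i : ('X_i - (z 0 i)%:MP) * ((i == j)%:R * f + (z 0 j)%:MP * Theta i z) =
      (i == j)%:R * (('X_j - (z 0 j)%:MP) * f) +
      (z 0 j)%:MP * (('X_i - (z 0 i)%:MP) * Theta i z).
    rewrite mulrDr; congr (_ + _); last by rewrite mulrCA.
    by case: eqP => [->|_]; rewrite ?mul1r // !mul0r mulr0.
  rewrite (eq_bigr _ (fun i _ => E i)) big_split /= -big_distrr /=.
  rewrite (bigD1 j) //= eqxx mul1r big1 => [|i /negPf ->]; last by rewrite mul0r.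
  rewrite addr0 mevalM mevalXU mpolyCM addrCA -mulrDr -F2.
  by rewrite mulrBl subrK.
- rewrite mderivM mevalD !mevalM mevalD !mevalM F3 mevalC mevalXU; congr (_ + _).
  have [_ _ <-] := divided_differenceX j; by [].
Qed.

Lemma divided_difference_monomial d m : mdeg m = d.+1 ->
  exists Theta, divided_difference d 'X_[m] Theta.
Proof.
elim: d m => [|d IH] m md.
  have /mdeg1P[j /eqP ->] : mdeg m == 1%N by rewrite md.
  by eexists; apply: divided_differenceX.
have /existsP[j mj] : [exists j : 'I_N, m j != 0%N].
  apply: contra_eqT md; rewrite negb_exists => /forallP m0.
  by rewrite mdegE big1 // => i _; apply/eqP; have := m0 i; rewrite negbK.
have mE : (U_(j) + (m - U_(j)))%MM = m by rewrite addmC submK ?lep1mP.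
have mE' : mdeg (m - U_(j)) = d.+1.
  by apply: succn_inj; rewrite -md -[in RHS]mE mdegD mdeg1.
have [Theta ThetaP] := IH _ mE'.
rewrite -mE mpolyXD; eexists; apply: divided_difference_mul ThetaP _.
by apply: supp_inX; rewrite mE'.
Qed.

Lemma divided_difference_exists d f : degle d.+1 f ->
  exists Theta, divided_difference d f Theta.
Proof.
move=> fd; rewrite (mpolyE f) big_seq.
apply: (big_ind (fun f => exists Theta, divided_difference d f Theta)).
- by rewrite -mpolyC0; eexists; apply: divided_differenceC.
- by move=> g h [T HT] [T' HT']; eexists; apply: divided_differenceD HT HT'.
move=> m /(supp_in_msupp fd) /= md.
suff [T HT] : exists T, divided_difference d 'X_[m] T.
  by eexists; apply: divided_differenceZ HT.
case e : (mdeg m) => [|k].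
  move/eqP: e; rewrite mdeg_eq0 => /eqP ->; rewrite mpolyX0 -mpolyC1.
  by eexists; apply: divided_differenceC.
have [T [T1 T2 T3]] := divided_difference_monomial e.
by exists T; split=> // j; apply: bezW (T1 j); rewrite -ltnS -e.
Qed.

End Bezoutian.

(** * Simple zeros: radical ideals and orthogonality of relations *)

Section Bezout.
Variables (N : nat) (L : closedFieldType).
Implicit Types (f g h : {mpoly L[N]}) (p z : 'rV[L]_N).
Variables (F : 'I_N -> {mpoly L[N]}) (d : 'I_N -> nat).
Hypothesis Fd : forall i, degle (d i).+1 (F i).

Local Notation ev p f := (f.@[fun i => p 0 i]).

Definition jac p : 'M[L]_N := \matrix_(i, j) ev p ((F i)^`M(j)).

Definition zero_of p := forall i, ev p (F i) = 0.

Lemma bezoutian_exists : exists Theta : 'I_N -> 'I_N -> 'rV[L]_N -> {mpoly L[N]},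
  forall i, divided_difference (d i) (F i) (Theta i).
Proof.
have /choice[Theta HT] (i : 'I_N) : exists T, divided_difference (d i) (F i) T.
  exact: divided_difference_exists.
by exists Theta.
Qed.

Lemma ev_det p (M : 'M[{mpoly L[N]}]_N) : ev p (\det M) = \det (map_mx (meval (fun i => p 0 i)) M).
Proof. by rewrite -det_map_mx. Qed.

(* By Cramer's rule det Theta kills every 'X_j - p_j modulo the F_i.          *)
Lemma local_annihilator (I : {mpoly L[N]} -> Prop) p :
    ideal I -> (forall i, I (F i)) -> zero_of p ->
  exists2 h, ev p h = \det (jac p) & forall g, ev p g = 0 -> I (h * g).
Proof.
move=> hI IF p0; have [Theta HT] := bezoutian_exists.
pose M := \matrix_(i, j) Theta i j p; exists (\det M).
  rewrite ev_det; congr (\det _); apply/matrixP => i j; rewrite !mxE.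
  by case: (HT i) => _ _ ->.
move=> g g0; have [|T [_ T2 _]] := @divided_difference_exists _ _ (msize g).-1 g.
  by apply: (degleW _ (@degle_msize _ _ g)).
rewrite (T2 p) g0 mpolyC0 add0r big_distrr /=; apply: ideal_sum => // j _.
rewrite mulrA; apply: idealMr => //.
pose v := \col_j ('X_j - (p 0 j)%:MP) : 'cV[{mpoly L[N]}]_N.
have vF : M *m v = \col_i F i.
  apply/colP => i; rewrite !mxE; case: (HT i) => _ E _; rewrite [RHS](E p) p0.
  by rewrite mpolyC0 add0r; apply: eq_bigr => k _; rewrite !mxE mulrC.
have : (\adj M *m (M *m v)) j 0 = \det M * ('X_j - (p 0 j)%:MP).
  by rewrite mulmxA mul_adj_mx mul_scalar_mx !mxE.
move=> <-; rewrite vF mxE; apply: ideal_sum => // i _.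
by rewrite !mxE; case: hI => _ _; apply.
Qed.

(** If g were not in I, the conductor C of g into I would have a zero q. The annihilator h at q
    satisfies h g in I because g(q) = 0, so h lies in C, yet h(q) is the nonzero Jacobian. *)
Lemma ideal_radical (I : {mpoly L[N]} -> Prop) k g :
    ideal I -> (forall i, I (F i)) ->
    (forall f, exists2 h, degle k h & I (f - h)) ->
    (forall p, zero_of p -> \det (jac p) != 0) ->
    (forall p, zero_of p -> ev p g = 0) ->
  I g.
Proof.
move=> hI IF red J0 g0; have [I0 ID IM] := hI.
pose C f := I (f * g).
have hC : ideal C.
  split=> [|f h If Ih|a f If]; rewrite /C; first by rewrite mul0r.
    by rewrite mulrDl; apply: ID.
  by rewrite -mulrA; apply: IM.
have IC f : I f -> C f by move=> If; apply: idealMr.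
apply: contrapT => Ig; have [||p pP] := ideal_has_zero hC.
- by rewrite /C mul1r.
- move=> j; apply: (@fintype_algebraic _ _ _ k) => // f.
  by have [h h1 h2] := red f; exists h => //; exact: (IC _ h2).
pose q := \row_i p i; have qP f : C f -> ev q f = 0.
  by move=> /pP <-; apply: meval_eq => i; rewrite mxE.
have q0 : zero_of q by move=> i; apply/qP/IC/IF.
have [h hq hP] := local_annihilator hI IF q0.
have : C h by apply/hP/g0.
by move/qP; rewrite hq; apply/eqP/J0.
Qed.

Section Points.
Variables (c : nat) (P : 'I_c -> 'rV[L]_N).
Hypotheses (P_inj : injective P) (P0 : forall a, zero_of (P a)).
Hypothesis J0 : forall a, \det (jac (P a)) != 0.

Definition eval_mx k : 'M[L]_(#|{: 'X_{1..N < k.+1}}|, c) :=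
  \matrix_(m, a) ev (P a) 'X_[enum_val m : 'X_{1..N < k.+1}].

(** The affine Hilbert function of the set of points. *)
Definition urank k := \rank (eval_mx k).

Lemma eval_mx_ker k (w : 'rV_c) : w *m (eval_mx k)^T = 0 <->
  forall f, degle k f -> \sum_a w 0 a * ev (P a) f = 0.
Proof.
split=> [wE f fk|H].
  pose T f := \sum_a w 0 a * ev (P a) f = 0.
  rewrite -/(T f) (mpolyE f) big_seq; apply: (big_ind T); rewrite /T.
  - by rewrite big1 // => a _; rewrite meval0 mulr0.
  - move=> g h Hg Hh; under eq_bigr => a _ do rewrite mevalD mulrDr.
    by rewrite big_split /= Hg Hh addr0.
  move=> m /(supp_in_msupp fk) /= mk.
  have mk' : (mdeg m < k.+1)%N by [].
  transitivity (f@_m * (w *m (eval_mx k)^T) 0 (enum_rank (BMultinom mk'))).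
    rewrite mxE big_distrr; apply: eq_bigr => a _ /=.
    by rewrite !mxE enum_rankK /= mevalZ mulrCA.
  by rewrite wE mxE mulr0.
apply/rowP => m; rewrite !mxE.
rewrite -[RHS](H 'X_[(enum_val m : 'X_{1..N < k.+1})]); last first.
  by apply: supp_inX; rewrite -ltnS bmdeg.
by apply: eq_bigr => a _; rewrite !mxE.
Qed.

(** On the diagonal the divided differences are partial derivatives. At two distinct zeros their
    matrix kills the vector P a - P b, so its determinant vanishes. *)
Lemma bezoutian_points : exists2 Phi, bez (\sum_i d i) Phi &
  forall a b, ev (P a) (Phi (P b)) = (a == b)%:R * \det (jac (P b)).
Proof.
have [Theta HT] := bezoutian_exists.
exists (fun z => \det (\matrix_(i, j) Theta i j z)).
  by apply: bez_det => i j; case: (HT i).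
move=> a b; rewrite ev_det; have [<-|ab] := eqVneq a b.
  rewrite mul1r; congr (\det _); apply/matrixP => i j; rewrite !mxE.
  by case: (HT i) => _ _ ->.
rewrite mul0r -det_tr; apply/eqP/det0P; exists (P a - P b).
  by rewrite subr_eq0 (inj_eq P_inj).
apply/rowP => i; rewrite !mxE; have [_ E _] := HT i.
transitivity (ev (P a) (F i)); last exact: P0.
rewrite (E (P b)) P0 mpolyC0 add0r raddf_sum /=.
by apply: eq_bigr => j _; rewrite !mxE mevalM mevalB mevalXU mevalC.
Qed.

(** A term u(X) v(z) of total degree at most s + t + 1 has deg u <= s or deg v <= t, and then one of
    the two relations annihilates it. *)
Lemma bez_orthogonal k s t Phi (w w' : 'I_c -> L) :
    bez k Phi -> (k <= (s + t).+1)%N ->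
    (forall f, degle s f -> \sum_a w a * ev (P a) f = 0) ->
    (forall f, degle t f -> \sum_a w' a * ev (P a) f = 0) ->
  \sum_b \sum_a w' b * w a * ev (P a) (Phi (P b)) = 0.
Proof.
move=> + kst ws wt; elim=> [|P1 P2 _ H1 _ H2|i j u v ui vj ijk].
- by rewrite big1 // => b _; rewrite big1 // => a _; rewrite meval0 mulr0.
- under eq_bigr => b _ do under eq_bigr => a _ do rewrite mevalD mulrDr.
  under eq_bigr => b _ do rewrite big_split /=.
  by rewrite big_split /= H1 H2 addr0.
have -> : \sum_b \sum_a w' b * w a * ev (P a) (ev (P b) v *: u) =
    (\sum_b w' b * ev (P b) v) * (\sum_a w a * ev (P a) u).
  rewrite big_distrl; apply: eq_bigr => b _; rewrite big_distrr /=.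
  by apply: eq_bigr => a _; rewrite mevalZ mulrACA mulrA.
have [is_|si] := leqP i s; first by rewrite (ws u) ?mulr0 //; apply: degleW ui.
rewrite (wt v) ?mul0r //; apply: degleW vj.
by rewrite -(leq_add2l i); apply: leq_trans ijk (leq_trans kst _); rewrite -addSn leq_add2r.
Qed.

Definition jac_diag : 'M[L]_c := diag_mx (\row_a \det (jac (P a))).

Lemma jac_isotropic s t (w w' : 'rV_c) : (\sum_i d i <= (s + t).+1)%N ->
    w *m (eval_mx s)^T = 0 -> w' *m (eval_mx t)^T = 0 ->
  w *m jac_diag *m w'^T = 0.
Proof.
move=> st /eval_mx_ker ws /eval_mx_ker wt.
have [Phi bPhi PhiE] := bezoutian_points.
apply/matrixP => i j; rewrite !ord1 [RHS]mxE -(bez_orthogonal bPhi st ws wt).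
rewrite mxE; apply: eq_bigr => b _.
rewrite (bigD1 b) //= PhiE eqxx mul1r big1 => [|a /negPf ab].
  by rewrite addr0 mul_mx_diag !mxE mulrC mulrA.
by rewrite PhiE ab mul0r mulr0.
Qed.

Lemma urank_ker s : \rank (kermx (eval_mx s)^T) = (c - urank s)%N.
Proof. by rewrite mxrank_ker mxrank_tr. Qed.

Lemma jac_isotropic_ker s t : (\sum_i d i <= (s + t).+1)%N ->
  kermx (eval_mx s)^T *m jac_diag *m (kermx (eval_mx t)^T)^T = 0.
Proof.
move=> st; apply/row_matrixP => i; rewrite row0; apply/rowP => j.
transitivity ((row i (kermx (eval_mx s)^T) *m jac_diag *m
                (row j (kermx (eval_mx t)^T))^T) 0 0).
  by rewrite -row_mul !mxE; apply: eq_bigr => k _; rewrite !mxE.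
by rewrite (jac_isotropic st) ?mxE // -row_mul mulmx_ker row0.
Qed.

Lemma jac_diag_unit : jac_diag \in unitmx.
Proof.
rewrite unitmxE det_diag unitfE; apply/prodf_neq0 => a _.
by rewrite mxE J0.
Qed.

(** The relation spaces have dimensions c - u_s and c - u_t and are orthogonal for a nondegenerate
    form on a space of dimension c. *)
Lemma urank_add s t : (\sum_i d i <= (s + t).+1)%N -> (c <= urank s + urank t)%N.
Proof.
move=> st; have := mulmx0_rank_max (jac_isotropic_ker st).
rewrite mxrankMfree ?row_free_unit ?jac_diag_unit // mxrank_tr !urank_ker.
have us : (urank s <= c)%N by apply: rank_leq_col.
have ut : (urank t <= c)%N by apply: rank_leq_col.
by rewrite -(leq_add2r (urank s + urank t)) addnACA !subnK // leq_add2l.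
Qed.

(** The Bezoutian with z fixed at P b is a polynomial vanishing at all the points but P b, so these
    degrees already separate the points. *)
Lemma urank_max k : (\sum_i d i <= k)%N -> urank k = c.
Proof.
move=> dk; rewrite /urank -mxrank_tr; apply/eqP; rewrite -/(row_free _).
apply/inj_row_free => w /eval_mx_ker wE; apply/rowP => b; rewrite mxE.
have [Phi bPhi PhiE] := bezoutian_points.
have := wE (Phi (P b)) (degleW dk (bez_degle (P b) bPhi)).
rewrite (bigD1 b) //= PhiE eqxx mul1r big1 => [|a /negPf ab].
  by rewrite addr0 => /eqP; rewrite mulf_eq0 (negPf (J0 b)) orbF => /eqP.
by rewrite PhiE ab mul0r mulr0.
Qed.

Lemma card_points_le : (c <= #|{: 'X_{1..N < (\sum_i d i).+1}}|)%N.
Proof. by rewrite -[c in (c <= _)%N](urank_max (leqnn _)) rank_leq_row. Qed.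

End Points.
End Bezout.

(** * Expansion in powers of a regular sequence *)

Section LocalExpansion.
Variables (N : nat) (L : closedFieldType).
Implicit Types (f g h : {mpoly L[N]}).
Variables (F : 'I_N -> {mpoly L[N]}) (p : 'rV[L]_N).
Hypotheses (p0 : zero_of F p) (Jp : \det (jac F p) != 0).

Local Notation ev p f := (f.@[fun i => p 0 i]).

(* An affine change of coordinates sending 0 to p and turning the             *)
(* differentials of the F_i at p into the coordinate forms.                   *)
Definition straightening : N.-tuple {mpoly L[N]} :=
  [tuple (p 0 j)%:MP + \sum_k (invmx (jac F p)) j k *: 'X_k | j < N].

Local Notation straighten := (comp_mpoly straightening).

Lemma straighten_var j :
  straighten ('X_j - (p 0 j)%:MP) = \sum_k (invmx (jac F p)) j k *: 'X_k.
Proof.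
rewrite comp_mpolyB comp_mpolyXU comp_mpolyC.
by rewrite -tnth_nth tnth_mktuple addrC addKr.
Qed.

Lemma low1_straighten_var j : low 1 (straighten ('X_j - (p 0 j)%:MP)).
Proof.
rewrite straighten_var; apply: supp_in_sum => k _.
by apply/supp_inZ/supp_inX; rewrite mdeg1.
Qed.

Lemma straighten_constant f : low 1 (straighten f - (ev p f)%:MP).
Proof.
have [|T [_ T2 _]] := @divided_difference_exists _ _ (msize f).-1 f.
  by apply: (degleW _ (@degle_msize _ _ f)).
rewrite {1}(T2 p) rmorphD /= [straighten _%:MP]comp_mpolyC addrAC subrr add0r.
rewrite rmorph_sum; apply: supp_in_sum => j _ /=; rewrite rmorphM.
by apply: (@lowM _ _ 1 0) => //; exact: low1_straighten_var.
Qed.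

Lemma straighten_linear i : low 2 (straighten (F i) - 'X_i).
Proof.
have [|T [_ T2 T3]] := @divided_difference_exists _ _ (msize (F i)).-1 (F i).
  by apply: (degleW _ (@degle_msize _ _ _)).
have -> : 'X_i = \sum_j straighten ('X_j - (p 0 j)%:MP) * (ev p (T j p))%:MP.
  under eq_bigr => j _ do rewrite straighten_var T3 mulrC mul_mpolyC scaler_sumr.
  rewrite exchange_big /=.
  have E k : \sum_j ev p (F i)^`M(j) *: (invmx (jac F p) j k *: 'X_k) =
      (i == k)%:R *: 'X_k :> {mpoly L[N]}.
    under eq_bigr => j _ do rewrite scalerA.
    rewrite -scaler_suml; congr (_ *: _).
    transitivity ((jac F p *m invmx (jac F p)) i k).
      by rewrite mxE; apply: eq_bigr => j _; rewrite !mxE.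
    by rewrite mulmxV ?unitmxE ?unitfE // mxE.
  rewrite (eq_bigr _ (fun k _ => E k)) (bigD1 i) //= eqxx scale1r big1 ?addr0 //.
  by move=> k /negPf ki; rewrite eq_sym ki scale0r.
rewrite {1}(T2 p) p0 mpolyC0 add0r rmorph_sum -sumrB /=.
apply: supp_in_sum => j _; rewrite rmorphM /= -mulrBr.
by apply: (@lowM _ _ 1 1); [exact: low1_straighten_var|exact: straighten_constant].
Qed.

(** In the new coordinates F_i is 'X_i plus terms of order at least 2, hence F^alpha has leading
    form X^alpha. *)
Lemma straighten_power (alpha : 'X_{1..N}) :
  low (mdeg alpha).+1 (straighten (mmap1 F alpha) - 'X_[alpha]).
Proof.
(* [A g k X] says that X has order at least k and agrees with g up to terms of higher order; it is
   multiplicative. *)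
pose A g k X := low k.+1 (g - X) /\ low k X.
have AM g g' k k' X X' : A g k X -> A g' k' X' -> A (g * g') (k + k')%N (X * X').
  move=> [g1 X1] [g2 X2]; split; last exact: lowM.
  have -> : g * g' - X * X' = (g - X) * (g' - X') + X * (g' - X') + (g - X) * X'.
    by rewrite -mulrDl subrK mulrBr mulrBl addrA subrK.
  apply: supp_inD; first apply: supp_inD.
  - by apply: lowW (lowM g1 g2); rewrite addSn addnS leqW.
  - by rewrite -addnS; apply: lowM.
  - by rewrite -addSn; apply: lowM.
rewrite mpolyXE_id rmorph_prod /= mdegE; apply: (proj1 (B := low _ _)).
apply: (big_ind3 A) => [|g k X g' k' X'|i _].
- by split; rewrite ?subrr //; apply: supp_in0.
- exact: AM.
rewrite rmorphXn /=; elim: (alpha i) => [|a IH].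
  by rewrite !expr0; split; rewrite ?subrr //; apply: supp_in0.
rewrite !exprS -add1n; apply: AM => //; split; first exact: straighten_linear.
by apply: supp_inX; rewrite mdeg1.
Qed.

Lemma leading_coefficient q (a b : 'X_{1..N}) : (mdeg a <= mdeg b)%N ->
  (straighten (q * mmap1 F b))@_a = ev p q * (b == a)%:R.
Proof.
move=> ab; set G := mmap1 F b.
have -> : straighten (q * G) = (ev p q)%:MP * 'X_[b] +
    ((straighten q - (ev p q)%:MP) * 'X_[b] + straighten q * (straighten G - 'X_[b])).
  by rewrite rmorphM /= mulrBl mulrBr addrA [X in _ = X + _]addrC subrK [RHS]addrC subrK.
have hi f : low (mdeg b).+1 f -> f@_a = 0 by apply; rewrite -ltnNge ltnS.
rewrite mcoeffD mcoeffCM mcoeffX hi ?addr0 //; apply: supp_inD.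
  rewrite -add1n; apply: (@lowM _ _ 1 _); first exact: straighten_constant.
  exact: supp_inX.
by rewrite -[_.+1]add0n; apply: (@lowM _ _ 0 _) => //; exact: straighten_power.
Qed.

(** Look at the coefficient of X^a after straightening. Terms of lower order are absent, and any
    other term of the same or higher order does not reach X^a, so only Q_a(p) remains. *)
Lemma leading_value K (Q : 'X_{1..N < K} -> {mpoly L[N]}) (a : 'X_{1..N < K}) :
    \sum_b Q b * mmap1 F b = 0 ->
    (forall b : 'X_{1..N < K}, (mdeg b < mdeg a)%N -> Q b = 0) ->
  ev p (Q a) = 0.
Proof.
move=> sum0 Q0.
have : (straighten (\sum_b Q b * mmap1 F b))@_a = 0 by rewrite sum0 rmorph0 mcoeff0.
rewrite rmorph_sum raddf_sum (bigD1 a) //= leading_coefficient // eqxx mulr1.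
rewrite big1 ?addr0 // => b ba; have [lt|le] := ltnP (mdeg b) (mdeg a).
  by rewrite Q0 // mul0r rmorph0 mcoeff0.
by rewrite leading_coefficient // -bmeqP (negPf ba) mulr0.
Qed.

End LocalExpansion.

(** * Independent products, bounding the number of monomials from below *)

Section Independence.
Variables (N : nat) (L : closedFieldType).
Variables (F : 'I_N -> {mpoly L[N]}) (e : 'I_N -> nat).
Hypothesis Fe : forall i, degle (e i) (F i).
Variables (c : nat) (P : 'I_c -> 'rV[L]_N).
Hypothesis P0 : forall a, zero_of F (P a).
Hypothesis J0 : forall a, \det (jac F (P a)) != 0.

Local Notation ev p f := (f.@[fun i => p 0 i]).
Local Notation urank := (urank P).

(** The degree bound of F^a when F_i has degree at most [e i]. *)
Definition wdeg (a : 'X_{1..N}) := (\sum_i a i * e i)%N.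

(** Induction on |a|: once the coefficients of lower order vanish, Q_a vanishes at every zero, and
    evaluation is assumed faithful on the coefficients. *)
Lemma power_products_independent K (Q : 'X_{1..N < K} -> {mpoly L[N]}) :
    (forall a, (forall b, ev (P b) (Q a) = 0) -> Q a = 0) ->
  \sum_a Q a * mmap1 F a = 0 -> forall a, Q a = 0.
Proof.
move=> Qinj sum0 a.
have [r] := ubnP (mdeg a); elim: r a => // r IH a ar.
apply: (Qinj) => b; apply: (leading_value (P0 b) (J0 b) sum0) => a' aa'.
by apply: IH; apply: leq_trans aa' _.
Qed.

Lemma degle_power a : degle (wdeg a) (mmap1 F a).
Proof.
rewrite /wdeg /mmap1; apply: (big_ind2 (fun k f => degle k f)) => [|k f l g|i _].
- by rewrite -[X in degle _ X]mpolyC1; apply: supp_inC.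
- exact: degleM.
elim: (a i) => [|m IH]; first by rewrite expr0 -mpolyC1; apply: supp_inC.
by rewrite exprS mulSn; apply: degleM.
Qed.

Lemma card_independent_le (J : finType) k (b : J -> {mpoly L[N]}) :
    (forall j, degle k (b j)) ->
    (forall x : J -> L, \sum_j x j *: b j = 0 -> forall j, x j = 0) ->
  (#|J| <= #|{: 'X_{1..N < k.+1}}|)%N.
Proof.
move=> bk bfree.
pose A : 'M[L]_(#|J|, #|{: 'X_{1..N < k.+1}}|) :=
  \matrix_(i, m) (b (enum_val i))@_(enum_val m : 'X_{1..N < k.+1}).
suff : row_free A by move=> /eqP <-; apply: rank_leq_col.
apply/inj_row_free => v vA; apply/rowP => i; rewrite mxE.
rewrite -[i]enum_valK; apply: (bfree (fun j => v 0 (enum_rank j))).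
apply/mpolyP => m; rewrite mcoeff0 raddf_sum /=.
have [mk|mk] := leqP (mdeg m) k; last first.
  by rewrite big1 // => j _; rewrite mcoeffZ bk ?mulr0 // -ltnNge.
have mk' : (mdeg m < k.+1)%N by [].
transitivity ((v *m A) 0 (enum_rank (BMultinom mk'))); last by rewrite vA mxE.
rewrite mxE (reindex_onto enum_rank enum_val) => [|j _] /=; last exact: enum_valK.
rewrite [RHS](eq_bigl xpredT) => [|j]; last by rewrite enum_rankK eqxx.
by apply: eq_bigr => j _; rewrite mcoeffZ mxE !enum_rankK.
Qed.

(** For each a, multiply F^a by [urank (k - wdeg a)] monomials of degree at most k - wdeg a whose
    values at the zeros are independent. The resulting family is free in degree at most k. *)
Lemma sum_urank_le K k :
  (\sum_(a : 'X_{1..N < K} | wdeg a <= k) urank (k - wdeg a)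
     <= #|{: 'X_{1..N < k.+1}}|)%N.
Proof.
(* The value 0 empties the fibre of J over the exponents of weight above k. *)
pose u (a : 'X_{1..N < K}) := if (wdeg a <= k)%N then urank (k - wdeg a) else 0%N.
pose J : finType := {a : 'X_{1..N < K} & 'I_(u a)}.
have -> : (\sum_(a : 'X_{1..N < K} | wdeg a <= k) urank (k - wdeg a) = #|J|)%N.
  rewrite -sum1_card (eq_bigl (fun p : J => xpredT (tag p) && xpredT (tagged p))) //.
  rewrite -(sig_big_dep xpredT (fun a (j : 'I_(u a)) => true) (fun _ _ => 1%N)) big_mkcond.
  by apply: eq_bigr => a _; rewrite sum1_card card_ord /u.
have um (a : 'X_{1..N < K}) (j : 'I_(u a)) : (j < urank (k - wdeg a))%N.
  by apply: leq_trans (ltn_ord j) _; rewrite /u; case: ifP.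
pose mon (a : 'X_{1..N < K}) (j : 'I_(u a)) : 'X_{1..N < (k - wdeg a).+1} :=
  enum_val (maxrankfun (eval_mx P (k - wdeg a)) (Ordinal (um a j))).
pose T a (j : 'I_(u a)) : J := existT (fun a => 'I_(u a)) a j.
pose b (p : J) := 'X_[mon (tag p) (tagged p)] * mmap1 F (tag p) : {mpoly L[N]}.
apply: (@card_independent_le J k b) => [[a j]|x].
  have wk : (wdeg a <= k)%N by move: j; rewrite /u; case: ifP => // _ [].
  suff : degle (k - wdeg a + wdeg a) (b (T a j)) by rewrite subnK.
  apply: degleM; last exact: degle_power.
  by apply: supp_inX; rewrite -ltnS bmdeg.
pose Q a := \sum_(j < u a) x (T a j) *: 'X_[mon a j] : {mpoly L[N]}.
have -> : \sum_j x j *: b j = \sum_a Q a * mmap1 F a.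
  rewrite [RHS](eq_bigr (fun a => \sum_(j < u a) x (T a j) *: b (T a j))).
    by rewrite sig_big_dep /=; apply: eq_bigr => [[a j]].
  by move=> a _; rewrite big_distrl; apply: eq_bigr => j _ /=; rewrite -scalerAl.
have Qfree a : (forall i, ev (P i) (Q a) = 0) -> forall j, x (T a j) = 0.
  move=> Q0 j.
  have := maxrowsub_free (eval_mx P (k - wdeg a)).
  set M := rowsub _ _ => /row_freeP[M' MM'].
  have uE : u a = urank (k - wdeg a).
    by move: j; rewrite /u; case: ifP => // _ [].
  pose v : 'rV_(urank (k - wdeg a)) := \row_i x (T a (cast_ord (esym uE) i)).
  suff : v = 0.
    move/rowP/(_ (cast_ord uE j)); rewrite !mxE => <-.
    by congr (x (T a _)); apply: val_inj.
  rewrite -[v]mulmx1 -MM' mulmxA; suff -> : v *m M = 0 by rewrite mul0mx.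
  apply/rowP => i; rewrite [RHS]mxE -[RHS](Q0 i) raddf_sum /= mxE.
  rewrite (reindex (cast_ord uE)) /=; last first.
    by exists (cast_ord (esym uE)) => l _; rewrite ?cast_ordK ?cast_ordKV.
  apply: eq_bigr => l _; rewrite mevalZ !mxE; congr (_ * _).
    by congr (x (T a _)); apply: val_inj.
  by rewrite /mon; have -> : cast_ord uE l = Ordinal (um a l) by apply: val_inj.
move=> sum0 [a j]; apply: (Qfree) => i.
rewrite (power_products_independent _ sum0) ?meval0 // => a' Q0.
by rewrite /Q big1 // => l _; rewrite (Qfree a' Q0) scale0r.
Qed.

End Independence.

(** * Spanning products, bounding the number of monomials from above *)

Section Spanning.
Variables (N : nat) (L : closedFieldType).
Implicit Types (f g h : {mpoly L[N]}).
Variables (F G : 'I_N -> {mpoly L[N]}) (e : 'I_N -> nat).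
Hypothesis e0 : forall i, (0 < e i)%N.
Hypothesis Gh : forall i, G i \is (e i).-homog.
Hypothesis FG : forall i, supp_in (fun j => j < e i)%N (F i - G i).

Local Notation ev p f := (f.@[fun i => p 0 i]).

Hypothesis Gzero : forall y : 'rV[L]_N, (forall i, ev y (G i) = 0) -> y = 0.
Hypothesis J0 : forall p, zero_of F p -> \det (jac F p) != 0.

Definition generated (H : 'I_N -> {mpoly L[N]}) f :=
  exists a, f = \sum_i a i * H i.

Lemma degle_pred i : degle (e i).-1.+1 (F i).
Proof.
rewrite prednK // -(subrK (G i) (F i)); apply: supp_inD.
  by apply: supp_in_sub (@FG i) => j; apply: ltnW.
by have /homog_supp := Gh i; apply: supp_in_sub => j /eqP ->.
Qed.

Lemma generated_ideal H : ideal (generated H).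
Proof.
split=> [|f g [a ->] [b ->]|a f [b ->]].
- by exists (fun=> 0); rewrite big1 // => i _; rewrite mul0r.
- exists (fun i => a i + b i); rewrite -big_split.
  by apply: eq_bigr => i _; rewrite mulrDl.
- exists (fun i => a * b i); rewrite big_distrr /=.
  by apply: eq_bigr => i _; rewrite mulrA.
Qed.

Lemma generated_gen H i : generated H (H i).
Proof.
exists (fun j => (j == i)%:R); rewrite (bigD1 i) //= eqxx mul1r big1 ?addr0 //.
by move=> j /negPf ->; rewrite mul0r.
Qed.

(** Membership in the ideal of the F_i by an expression whose terms all stay within degree k; plain
    membership would lose the degrees needed for counting. *)
Definition bounded_generated k f := exists2 a : 'I_N -> {mpoly L[N]},
  forall i, supp_in (fun j => j + e i <= k)%N (a i) & f = \sum_i a i * F i.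

Lemma bounded_generated0 k : bounded_generated k 0.
Proof.
exists (fun=> 0) => [i|]; first exact: supp_in0.
by rewrite big1 // => i _; rewrite mul0r.
Qed.

Lemma bounded_generatedD k f g :
  bounded_generated k f -> bounded_generated k g -> bounded_generated k (f + g).
Proof.
move=> [a aP ->] [b bP ->]; exists (fun i => a i + b i) => [i|].
  exact: supp_inD.
by rewrite -big_split; apply: eq_bigr => i _; rewrite mulrDl.
Qed.

Lemma bounded_generatedZ k c f :
  bounded_generated k f -> bounded_generated k (c *: f).
Proof.
move=> [a aP ->]; exists (fun i => c *: a i) => [i|]; first exact: supp_inZ.
by rewrite scaler_sumr; apply: eq_bigr => i _; rewrite scalerAl.
Qed.

Lemma bounded_generatedW k l f : (k <= l)%N ->
  bounded_generated k f -> bounded_generated l f.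
Proof.
move=> kl [a aP ->]; exists a => // i; apply: supp_in_sub (aP i) => j jk.
exact: leq_trans jk kl.
Qed.

Lemma generated_bounded f : generated F f -> exists k, bounded_generated k f.
Proof.
case=> a ->; exists (\max_i ((msize (a i)).-1 + e i))%N; exists a => // i.
apply: supp_in_sub (@degle_msize _ _ (a i)) => j ja.
by apply: leq_trans (leq_bigmax i); rewrite leq_add2r.
Qed.

Lemma high_degree_generated : exists k0, forall f, low k0 f -> generated G f.
Proof.
(* With t = N no variable is assumed to lie in the ideal. *)
apply: (@homog_ideal_contains_power _ _ _ N) => [|j|p pG j].
- split=> [|f k [a ->]]; first exact: generated_ideal.
  exists (fun i => if (e i <= k)%N then pihomog mdeg (k - e i) (a i) else 0).
  rewrite raddf_sum; apply: eq_bigr => i _ /=; rewrite (pihomogM _ _ (Gh i)).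
  by case: ifP; rewrite ?mul0r.
- by rewrite leqNgt ltn_ord.
have /rowP/(_ j) : \row_i p i = 0; last by rewrite !mxE.
apply: Gzero => i; rewrite -[RHS](pG (G i)); last exact: generated_gen.
by apply: meval_eq => l; rewrite mxE.
Qed.

(** The top component of f is a combination of the G_i. Subtracting the same combination of the F_i
    removes it and adds only terms of lower degree. *)
Lemma reduce_degree k0 k f : (forall f, low k0 f -> generated G f) ->
    (k0 <= k)%N -> degle k f ->
  exists2 g, degle k0 g & bounded_generated k (f - g).
Proof.
move=> k0P /subnK <-; elim: (k - k0)%N f => [|j IH] f fk.
  by exists f; rewrite // subrr; apply: bounded_generated0.
set k' := (j + k0)%N in IH *; rewrite addSn -/k' in fk *.
suff [g gk Bg] : exists2 g, degle k' g & bounded_generated k'.+1 (f - g).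
  have [h hk Bh] := IH g gk; exists h => //.
  rewrite -(subrK g f) -addrA; apply: bounded_generatedD => //.
  exact: bounded_generatedW Bh.
have [|a aE] := k0P (pihomog mdeg k'.+1 f).
  have /homog_supp := pihomogP mdeg k'.+1 f; apply: supp_in_sub => i /eqP ->.
  by rewrite leqW // leq_addl.
pose b i := if (e i <= k'.+1)%N then pihomog mdeg (k'.+1 - e i) (a i) else 0.
have bP i : supp_in (fun j => j + e i == k'.+1)%N (b i).
  rewrite /b; case: ifP => ek; last exact: supp_in0.
  have /homog_supp := pihomogP mdeg (k'.+1 - e i) (a i); apply: supp_in_sub => l /eqP ->.
  by rewrite subnK.
have fE : pihomog mdeg k'.+1 f = \sum_i b i * G i.
  rewrite -[LHS]pihomog_id aE raddf_sum; apply: eq_bigr => i _ /=.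
  by rewrite (pihomogM _ _ (Gh i)) /b; case: ifP; rewrite ?mul0r.
exists (f - \sum_i b i * F i); last first.
  exists b; last by rewrite subKr.
  by move=> i; apply: supp_in_sub (bP i) => l /eqP ->.
have -> : f - \sum_i b i * F i =
    (f - pihomog mdeg k'.+1 f) - \sum_i b i * (F i - G i).
  under [in RHS]eq_bigr => i _ do rewrite mulrBr.
  by rewrite sumrB -fE opprB addrA subrK.
apply: supp_inB; last first.
  apply: supp_in_sum => i _; apply: supp_inM (bP i) (@FG i) => l m /eqP lk me.
  by rewrite -ltnS -lk ltn_add2l.
move=> m; rewrite -ltnNge mcoeffB mcoeff_pihomog => km.
have [_|mk] := eqVneq (mdeg m) k'.+1; first by rewrite subrr.
by rewrite subr0 fk // -ltnNge ltn_neqAle eq_sym mk.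
Qed.

Variables (c : nat) (P : 'I_c -> 'rV[L]_N).
Hypotheses (P_inj : injective P) (PZ : forall p, zero_of F p <-> exists a, p = P a).

Lemma interpolators : exists E : 'I_c -> {mpoly L[N]},
  forall a b, ev (P a) (E b) = (a == b)%:R.
Proof.
have P0 a : zero_of F (P a) by apply/PZ; exists a.
have := urank_max degle_pred P_inj P0 (fun a => J0 (P0 a)) (leqnn _).
set k := (\sum_i _)%N => /eqP; rewrite -/(row_full _) => /row_fullP[B BE].
exists (fun b => \sum_m B b m *: 'X_[enum_val m : 'X_{1..N < k.+1}]) => a b.
transitivity ((B *m eval_mx P k) b a); last by rewrite BE mxE eq_sym.
by rewrite raddf_sum mxE; apply: eq_bigr => m _ /=; rewrite mevalZ !mxE.
Qed.

(** By [ideal_radical], f and its interpolation at the zeros agree modulo the F_i. The degree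
    control is uniform because f is first reduced to degree k0, where finitely many monomials
    remain, each with its own bound. *)
Lemma reduce_to_interpolators : exists (E : 'I_c -> {mpoly L[N]}) M,
  forall k f, (M <= k)%N -> degle k f ->
  exists x : 'I_c -> L, bounded_generated k (f - \sum_b x b *: E b).
Proof.
have [k0 k0P] := high_degree_generated.
have [E EP] := interpolators; exists E.
have IF := generated_ideal F.
have red f : exists2 h, degle k0 h & generated F (f - h).
  have [h hk [a _ aE]] := @reduce_degree k0 (k0 + (msize f).-1) f k0P (leq_addr _ _)
    (degleW (leq_addl _ _) (@degle_msize _ _ f)).
  by exists h => //; exists a.
have res f : generated F (f - \sum_b ev (P b) f *: E b).
  apply: (ideal_radical degle_pred IF (fun i => generated_gen F i) red J0) => p zp.
  have [a ->] : exists a, p = P a by apply/PZ.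
  rewrite mevalB (raddf_sum (meval _)) /= (bigD1 a) //= mevalZ EP eqxx mulr1 big1 ?addr0 ?subrr //.
  by move=> b /negPf ba; rewrite mevalZ EP eq_sym ba mulr0.
have /choice[Mm MmP] (m : 'X_{1..N < k0.+1}) : exists k,
    bounded_generated k ('X_[m] - \sum_b ev (P b) 'X_[m] *: E b).
  exact: generated_bounded (res _).
pose M1 := (\max_m Mm m)%N; exists (maxn k0 M1) => k f; rewrite geq_max => /andP[k0k M1k] fk.
have [h hk Bh] := reduce_degree k0P k0k fk.
exists (fun b => ev (P b) h); rewrite -(subrK h f) -addrA.
apply: bounded_generatedD => //; apply: (bounded_generatedW M1k).
have -> : h - \sum_b ev (P b) h *: E b =
    \sum_(m <- msupp h) h@_m *: ('X_[m] - \sum_b ev (P b) 'X_[m] *: E b).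
  under [in RHS]eq_bigr => m _ do rewrite scalerBr scaler_sumr.
  rewrite sumrB -mpolyE exchange_big; congr (_ - _); apply: eq_bigr => b _ /=.
  under [RHS]eq_bigr => m _ do rewrite scalerA.
  rewrite -scaler_suml; congr (_ *: _); rewrite {1}(mpolyE h) raddf_sum /=.
  by apply: eq_bigr => m _; rewrite mevalZ.
rewrite big_seq; apply: (big_ind (bounded_generated M1)) => [||m mh].
- exact: bounded_generated0.
- exact: bounded_generatedD.
apply: bounded_generatedZ; have mk : (mdeg m < k0.+1)%N by exact: supp_in_msupp hk mh.
by apply: (bounded_generatedW _ (MmP (BMultinom mk))); apply: (leq_bigmax (BMultinom mk)).
Qed.

Lemma card_spanning_ge (J : finType) k (b : J -> {mpoly L[N]}) :
    (forall f, degle k f -> exists x : J -> L, f = \sum_j x j *: b j) ->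
  (#|{: 'X_{1..N < k.+1}}| <= #|J|)%N.
Proof.
move=> span.
have /choice[x xP] (m : 'X_{1..N < k.+1}) : exists x : J -> L, 'X_[m] = \sum_j x j *: b j.
  by apply: span; apply: supp_inX; rewrite -ltnS bmdeg.
pose A : 'M[L]_(#|{: 'X_{1..N < k.+1}}|, #|J|) :=
  \matrix_(m, j) x (enum_val m) (enum_val j).
suff : row_free A by move=> /eqP <-; apply: rank_leq_col.
apply/inj_row_free => v vA; apply/rowP => i; rewrite mxE.
have s0 : \sum_m v 0 (enum_rank m) *: 'X_[m : 'X_{1..N < k.+1}] = 0 :> {mpoly L[N]}.
  under eq_bigr => m _ do rewrite xP scaler_sumr.
  rewrite exchange_big big1 // => j _ /=.
  under eq_bigr => m _ do rewrite scalerA.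
  rewrite -scaler_suml.
  have -> : \sum_m v 0 (enum_rank m) * x m j = (v *m A) 0 (enum_rank j).
    rewrite mxE (reindex_onto enum_rank enum_val) /= => [|m _]; last exact: enum_valK.
    rewrite [RHS](eq_bigl xpredT) => [|m]; last by rewrite enum_rankK eqxx.
    by apply: eq_bigr => m _; rewrite mxE !enum_rankK.
  by rewrite vA mxE scale0r.
have := congr1 (mcoeff (enum_val i : 'X_{1..N < k.+1})) s0.
rewrite mcoeff0 raddf_sum /= (bigD1 (enum_val i)) //= enum_valK.
rewrite mcoeffZ mcoeffX eqxx mulr1 big1 ?addr0 // => m mi.
by rewrite mcoeffZ mcoeffX -bmeqP (negPf mi) mulr0.
Qed.

(** Combinations of F^alpha with two kinds of coefficients: interpolators when there is room M below
    degree k, and arbitrary monomials of degree below M in the boundary zone, where reduction is no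
    longer available. *)
Inductive power_span (E : 'I_c -> {mpoly L[N]}) (M k : nat) : {mpoly L[N]} -> Prop :=
| PowerSpan0 : power_span E M k 0
| PowerSpanD f g : power_span E M k f -> power_span E M k g -> power_span E M k (f + g)
| PowerSpanE x b alpha : (wdeg e alpha + M <= k)%N ->
    power_span E M k (x *: (E b * mmap1 F alpha))
| PowerSpanX x m alpha : (wdeg e alpha <= k < wdeg e alpha + M)%N -> (mdeg m < M)%N ->
    power_span E M k (x *: ('X_[m] * mmap1 F alpha)).

Lemma wdegD a b : wdeg e (a + b)%MM = (wdeg e a + wdeg e b)%N.
Proof. by rewrite -big_split; apply: eq_bigr => i _; rewrite mnmDE mulnDl. Qed.

Lemma wdegU i : wdeg e U_(i)%MM = e i.
Proof.
rewrite /wdeg (bigD1 i) //= mnm1E eqxx mul1n big1 ?addn0 // => j /negPf ji.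
by rewrite mnm1E eq_sym ji.
Qed.

Lemma leq_mdeg_wdeg a : (mdeg a <= wdeg e a)%N.
Proof. by rewrite mdegE; apply: leq_sum => i _; rewrite leq_pmulr. Qed.

Lemma power_span_mul E M k f i :
  power_span E M k f -> power_span E M (k + e i) (f * F i).
Proof.
have FU a : mmap1 F (a + U_(i))%MM = mmap1 F a * F i.
  by rewrite commr_mmap1_M ?mmap1U // => *; apply: mulrC.
elim=> [|g h _ IHg _ IHh|x b a ak|x m a ak mM].
- by rewrite mul0r; apply: PowerSpan0.
- by rewrite mulrDl; apply: PowerSpanD.
- rewrite -scalerAl -mulrA -FU; apply: PowerSpanE.
  by rewrite wdegD wdegU addnAC leq_add2r.
- rewrite -scalerAl -mulrA -FU; apply: PowerSpanX => //.
  by rewrite wdegD wdegU addnAC leq_add2r ltn_add2r.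
Qed.

(** Iterate the reduction: the coefficients of the F_i have smaller degree and are reduced in turn,
    until their degree falls below M. *)
Lemma power_span_degle E M :
    (forall k f, (M <= k)%N -> degle k f ->
      exists x : 'I_c -> L, bounded_generated k (f - \sum_b x b *: E b)) ->
  forall k f, degle k f -> power_span E M k f.
Proof.
move=> red k; have [r] := ubnP k; elim: r k => // r IH k kr f fk.
have w0 : wdeg e 0%MM = 0%N by rewrite /wdeg big1 // => i _; rewrite mnm0E.
have [Mk|kM] := leqP M k; last first.
  rewrite (mpolyE f) big_seq; apply: (big_ind (power_span E M k)) => [||m mf].
  - exact: PowerSpan0.
  - exact: PowerSpanD.
  rewrite -['X_[m]]mulr1 -(mmap11 F); apply: PowerSpanX; first by rewrite w0.
  exact: leq_ltn_trans (supp_in_msupp fk mf) kM.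
have [x [a aP fE]] := red k f Mk fk.
rewrite -(subrK (\sum_b x b *: E b) f) fE; apply: PowerSpanD.
  apply: (big_ind (power_span E M k)) => [||i _].
  - exact: PowerSpan0.
  - exact: PowerSpanD.
  have [ek|ek] := leqP (e i) k; last first.
    have -> : a i = 0.
      apply/mpolyP => m; rewrite mcoeff0 aP // -ltnNge.
      by apply: leq_trans ek (leq_addl _ _).
    by rewrite mul0r; apply: PowerSpan0.
  rewrite -[k](subnK ek); apply: power_span_mul; apply: IH.
    by rewrite -(ltn_add2r (e i)) subnK // (leq_trans kr) // -addn1 leq_add2l.
  by apply: supp_in_sub (aP i) => j; rewrite -[in X in X -> _](subnK ek) leq_add2r.
apply: (big_ind (power_span E M k)) => [||b _].
- exact: PowerSpan0.
- exact: PowerSpanD.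
by rewrite -[E b]mulr1 -(mmap11 F); apply: PowerSpanE; rewrite w0.
Qed.

Lemma card_monomials_le : exists M, forall k,
  (#|{: 'X_{1..N < k.+1}}| <=
     #|[pred a : 'X_{1..N < k.+1} | wdeg e a + M <= k]| * c +
     #|[pred a : 'X_{1..N < k.+1} | wdeg e a <= k < wdeg e a + M]| *
       #|{: 'X_{1..N < M}}|)%N.
Proof.
have [E [M red]] := reduce_to_interpolators; exists M => k.
pose A1 := [pred a : 'X_{1..N < k.+1} | wdeg e a + M <= k]%N.
pose A2 := [pred a : 'X_{1..N < k.+1} | wdeg e a <= k < wdeg e a + M]%N.
pose J : finType := (({x | A1 x} * 'I_c) + ({x | A2 x} * 'X_{1..N < M}))%type.
pose b (j : J) : {mpoly L[N]} := match j with
  | inl (a, i) => E i * mmap1 F (val a)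
  | inr (a, m) => 'X_[m] * mmap1 F (val a) end.
have -> : (#|A1| * c + #|A2| * #|{: 'X_{1..N < M}}| = #|J|)%N.
  by rewrite card_sum !card_prod !card_sig card_ord.
have single (j : J) x : exists y : J -> L, x *: b j = \sum_l y l *: b l.
  exists (fun l => if l == j then x else 0); rewrite (bigD1 j) //= eqxx big1 ?addr0 //.
  by move=> l /negPf ->; rewrite scale0r.
apply: (@card_spanning_ge _ _ b) => f /(power_span_degle red); elim.
- by exists (fun=> 0); rewrite big1 // => j _; rewrite scale0r.
- move=> g h _ [y ->] _ [z ->]; exists (fun j => y j + z j).
  by rewrite -big_split; apply: eq_bigr => j _; rewrite scalerDl.
- move=> x i a ak.
  have ak' : (mdeg a < k.+1)%N.
    by rewrite ltnS (leq_trans (leq_mdeg_wdeg a)) // (leq_trans (leq_addr _ _) ak).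
  exact: (single (inl (exist (fun x => A1 x) (BMultinom ak') ak, i)) x).
- move=> x m a ak mM.
  have ak' : (mdeg a < k.+1)%N.
    by rewrite ltnS (leq_trans (leq_mdeg_wdeg a)) //; case/andP: ak.
  exact: (single (inr (exist (fun x => A2 x) (BMultinom ak') ak, BMultinom mM)) x).
Qed.

End Spanning.

(** * Comparing sequences of polynomial growth *)

Section Growth.
Local Open Scope nat_scope.

(** Bernoulli's inequality (1 + 1/(b+1))^(b+1) >= 2, without denominators. *)
Lemma double_expn_le b : 2 * b.+1 ^ b.+1 <= b.+2 ^ b.+1.
Proof.
have H j : b.+1 ^ j.+1 + j.+1 * b.+1 ^ j <= b.+2 ^ j.+1.
  elim: j => [|j IH]; first by rewrite !expn1 expn0 muln1 addn1.
  rewrite [b.+2 ^ _]expnS; apply: leq_trans (leq_mul (leqnn b.+2) IH).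
  by rewrite !expnS; lia.
by have := H b; rewrite -expnS mul2n -addnn.
Qed.

Lemma polynomial_lt_exp B D : exists t, (B * t.+1) ^ D < 2 ^ t.
Proof.
pose w := B * D + 2 * D + 1; pose s := 2 * w; exists (2 ^ s).-1.
rewrite prednK ?expn_gt0 //.
have Bs : B * 2 ^ s <= 2 ^ (B + s) by rewrite expnD leq_mul2r (ltnW (ltn_expl _ _)) ?orbT.
apply: leq_ltn_trans (_ : 2 ^ ((B + s) * D) < _).
  by rewrite expnM; case: D @w @s Bs => // D w s Bs; rewrite leq_exp2r.
rewrite ltn_exp2l //.
have w2 : w < 2 ^ w by exact: ltn_expl.
have -> : 2 ^ s = 2 ^ w * 2 ^ w by rewrite -expnD addnn -mul2n.
have : w.+1 * w.+1 <= 2 ^ w * 2 ^ w by apply: leq_mul.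
by rewrite /s /w; nia.
Qed.

(** This replaces a limit argument. If a > b, iterating the inequality makes g grow at least like
    ((b+1)/b)^j along steps of length C; for j a multiple of b these factors dominate powers of 2,
    against the polynomial bound. *)
Lemma polynomial_growth_le (g : nat -> nat) D C k0 a b :
    (forall k, 0 < g k) -> (forall k, g k <= k.+1 ^ D) ->
    (forall k, k0 <= k -> a * g k <= b * g (k + C)) ->
  a <= b.
Proof.
move=> g0 gD ab; rewrite leqNgt; apply/negP => ba.
have iter j : b.+1 ^ j * g k0 <= b ^ j * g (k0 + j * C).
  elim: j => [|j IH]; first by rewrite !mul1n addn0.
  rewrite expnS -mulnA; apply: leq_trans (leq_mul (leqnn _) IH) _.
  rewrite mulnCA expnSr -mulnA leq_mul2l; apply/orP; right.
  rewrite [j.+1 * C]mulSnr addnA; apply: (leq_trans _ (ab (k0 + j * C) (leq_addr _ _))).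
  by rewrite leq_mul2r ba orbT.
case: b => [|b] in ba ab iter *.
  have := ab k0 (leqnn _).
  by rewrite mul0n leqn0 muln_eq0 (gtn_eqF (g0 _)) orbF (gtn_eqF ba).
have [t tP] := polynomial_lt_exp (k0 + b.+1 * C).+1 D.
have : 2 ^ t <= (k0 + b.+1 * t * C).+1 ^ D.
  apply: leq_trans (gD _); set G := g _.
  have pos : 0 < b.+1 ^ (b.+1 * t) by rewrite expn_gt0.
  rewrite -(leq_pmul2l pos); apply: leq_trans (iter _).
  apply: leq_trans (leq_pmulr _ (g0 _)).
  rewrite !expnM -expnMn [_ * 2]mulnC.
  by case: (t) => // t'; rewrite leq_exp2r // double_expn_le.
apply/negP; rewrite -ltnNge; apply: leq_ltn_trans tP.
by case: (D) => // D'; rewrite leq_exp2r //; nia.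
Qed.
End Growth.

(** * Counting monomials *)

Section MonomialCounting.
Local Open Scope nat_scope.
Variables (N : nat) (e : 'I_N -> nat).
Hypothesis e0 : forall i, 0 < e i.

Local Notation wdeg := (wdeg e).

Definition hcount j := #|[pred b : 'X_{1..N < j.+1} | mdeg b == j]|.
Definition mcount k := #|{: 'X_{1..N < k.+1}}|.

Lemma sum_multinom_widen K K' (Q : pred 'X_{1..N}) (phi : 'X_{1..N} -> nat) :
    K <= K' -> (forall m, Q m -> mdeg m < K) ->
  \sum_(b : 'X_{1..N < K'} | Q b) phi b = \sum_(b : 'X_{1..N < K} | Q b) phi b.
Proof.
move=> KK' QK; have [K0|K0] := posnP K.
  by rewrite !big_pred0 // => b; apply/negP => /QK; move: (mdeg b) => x; rewrite K0.
pose z : 'X_{1..N < K} := @BMultinom N K 0%MM (eq_ind_r (fun x => x < K) K0 (@mdeg0 N)).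
pose z' : 'X_{1..N < K'} := @BMultinom N K' 0%MM (leq_trans (eq_ind_r (fun x => x < K) K0 (@mdeg0 N)) KK').
rewrite (reindex_onto (fun b : 'X_{1..N < K} => insubd z' (bmnm b))
                      (fun b : 'X_{1..N < K'} => insubd z (bmnm b))) /=; last first.
  move=> b Qb; apply: val_inj; rewrite !val_insubd /= (QK _ Qb).
  by rewrite (leq_trans (QK _ Qb)).
have E (b : 'X_{1..N < K}) : bmnm (insubd z' (bmnm b)) = b.
  by have := val_insubd z' (bmnm b); rewrite (leq_trans (bmdeg b)).
apply: eq_big => [b|b _]; rewrite E // andb_idr // => _.
by apply/eqP/val_inj; rewrite val_insubd bmdeg.
Qed.

Lemma sum_by_degree K (phi : nat -> nat) :
  \sum_(b : 'X_{1..N < K}) phi (mdeg b) = \sum_(j < K) phi j * hcount j.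
Proof.
rewrite (partition_big (fun b : 'X_{1..N < K} => Ordinal (bmdeg b)) xpredT) //=.
apply: eq_bigr => j _.
transitivity (\sum_(b : 'X_{1..N < K} | mdeg b == j) phi j).
  by apply: eq_big => [b|b /eqP <-].
rewrite (sum_multinom_widen (K := j.+1) (Q := fun b => mdeg b == j) (fun=> phi j)) //.
  by rewrite sum_nat_const mulnC.
by move=> m /eqP ->.
Qed.

Lemma mcountE k : mcount k = \sum_(j < k.+1) hcount j.
Proof.
rewrite /mcount -sum1_card (sum_by_degree _ (fun=> 1)).
by apply: eq_bigr => j _; rewrite mul1n.
Qed.

Lemma mcount_le k : mcount k <= k.+1 ^ N.
Proof.
pose g (b : 'X_{1..N < k.+1}) := [ffun i : 'I_N => inord (b i) : 'I_k.+1].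
have bi (b : 'X_{1..N < k.+1}) i : b i < k.+1.
  by apply: leq_ltn_trans (bmdeg b); rewrite mdegE (bigD1 i) //= leq_addr.
have /leq_card : injective g.
  move=> b b' /ffunP bb'; apply/val_inj/mnmP => i.
  by have := congr1 val (bb' i); rewrite !ffunE /= !inordK.
by rewrite card_ffun !card_ord.
Qed.

Lemma hcount_le k : hcount k <= k.+1 ^ N.
Proof. by apply: leq_trans (mcount_le k); apply: max_card. Qed.

Lemma hcountS (i : 'I_N) j : hcount j <= hcount j.+1.
Proof.
have bS (b : 'X_{1..N < j.+1}) : mdeg (b + U_(i)) < j.+2.
  by rewrite mdegD mdeg1 addn1 ltnS; exact: bmdeg.
have inj : injective (fun b : 'X_{1..N < j.+1} => BMultinom (bS b)).
  move=> b b' /(congr1 (@bmnm _ _)) /= /eqP; rewrite eqm_add2r => /eqP.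
  exact: val_inj.
rewrite /hcount -(fintype.card_image inj).
apply/subset_leq_card/fintype.subsetP => b' /fintype.imageP[b]; rewrite !inE => /eqP bj ->.
by rewrite /= mdegD mdeg1 bj addn1.
Qed.

Lemma hcount_homo (i : 'I_N) j k : j <= k -> hcount j <= hcount k.
Proof.
move=> /subnKC <-; elim: (k - j) => [|l IH]; first by rewrite addn0.
by rewrite addnS; apply: leq_trans IH (hcountS i _).
Qed.

Lemma hcount_gt0 (i : 'I_N) j : 0 < hcount j.
Proof.
apply: leq_trans (hcount_homo i (leq0n j)); apply/card_gt0P.
have m0 : mdeg (0%MM : 'X_{1..N}) < 1 by rewrite mdeg0.
by exists (BMultinom m0); rewrite inE /= mdeg0.
Qed.

Lemma mcount_gt0 k : 0 < mcount k.
Proof.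
have m0 : mdeg (0%MM : 'X_{1..N}) < k.+1 by rewrite mdeg0.
by apply/card_gt0P; exists (BMultinom m0).
Qed.

(** The remainders of exponents modulo the [e i]. A monomial is a pair of a remainder r and a
    quotient a, of degree [bdeg r + wdeg a]. *)
Definition box : finType := {dffun forall i : 'I_N, 'I_(e i)}.
Definition bdeg (r : box) := \sum_i (r i : nat).

Lemma card_box : #|box| = \prod_i e i.
Proof. by rewrite card_dep_ffun /= foldrE big_map big_enum /=; apply: eq_bigr => i _; rewrite card_ord. Qed.

Lemma bdeg_le r : bdeg r <= \sum_i (e i).-1.
Proof. by apply: leq_sum => i _; rewrite -ltnS prednK. Qed.

Definition rev_box (r : box) : box := [ffun i => rev_ord (r i)].

Lemma rev_boxK : involutive rev_box.
Proof. by move=> r; apply/ffunP => i; rewrite !ffunE rev_ordK. Qed.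

Lemma bdeg_rev r : bdeg (rev_box r) + bdeg r = \sum_i (e i).-1.
Proof.
rewrite -big_split; apply: eq_bigr => i _; rewrite ffunE /=.
move: (ltn_ord (r i)); set x := nat_of_ord _; move: x => x xe.
by rewrite -[X in _ = X.-1](subnK xe) addnS addnC.
Qed.

(** The reflection r_i -> e_i - 1 - r_i shows that the mean degree of a remainder is sigma / 2. *)
Lemma sum_bdeg : 2 * (\sum_(r : box) bdeg r) = #|box| * \sum_i (e i).-1.
Proof.
rewrite mul2n -addnn {1}(reindex_inj (inv_inj rev_boxK)) -big_split /=.
by rewrite (eq_bigr _ (fun r _ => bdeg_rev r)) sum_nat_const.
Qed.

(* Euclidean division of the exponents by the e i.                            *)
Lemma sum_box_decomposition K (phi : nat -> nat) :
  \sum_(b : 'X_{1..N < K}) phi (mdeg b) =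
  \sum_(r : box) \sum_(a : 'X_{1..N < K} | bdeg r + wdeg a < K) phi (bdeg r + wdeg a).
Proof.
rewrite pair_big_dep /=.
have divK (b : 'X_{1..N < K}) : mdeg [multinom (b i %/ e i) | i < N] < K.
  apply: leq_ltn_trans (bmdeg b); rewrite !mdegE; apply: leq_sum => i _.
  by rewrite mnmE leq_div.
pose h (b : 'X_{1..N < K}) : box * 'X_{1..N < K} :=
  ([ffun i => Ordinal (ltn_pmod (b i) (e0 i))], BMultinom (divK b)).
have hdeg b : bdeg (h b).1 + wdeg (h b).2 = mdeg b.
  rewrite mdegE -big_split; apply: eq_bigr => i _ /=.
  by rewrite ffunE mnmE /= addnC -divn_eq.
pose back (p : box * 'X_{1..N < K}) : 'X_{1..N} :=
  [multinom ((p.1 i : nat) + p.2 i * e i) | i < N].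
have backdeg p : mdeg (back p) = bdeg p.1 + wdeg p.2.
  by rewrite mdegE -big_split; apply: eq_bigr => i _ /=; rewrite mnmE.
have [K0|K0] := posnP K.
  rewrite !big1 // => [p|b _]; last by have := bmdeg b; move: (mdeg b) => x; rewrite K0.
  by move: (bdeg _ + _) => x; rewrite K0.
pose z : 'X_{1..N < K} := @BMultinom N K 0%MM (eq_ind_r (fun x => x < K) K0 (@mdeg0 N)).
rewrite [RHS](reindex_onto h (fun p => insubd z (back p))) /=.
  apply: eq_big => [b|b _]; last by rewrite hdeg.
  rewrite hdeg bmdeg /=; apply/esym/eqP/val_inj.
  have E : back (h b) = b.
    by apply/mnmP => i; rewrite /back mnmE /= ffunE mnmE /= addnC -divn_eq.
  by rewrite val_insubd E bmdeg.
move=> [r a] /= ra; have E : bmnm (insubd z (back (r, a))) = back (r, a).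
  by have := val_insubd z (back (r, a)); rewrite /= backdeg ra.
congr (_, _).
  by apply/ffunP => i; rewrite ffunE; apply: val_inj; rewrite /= E mnmE /= addnC modnMDl modn_small.
apply: val_inj; apply/mnmP => i; rewrite /= mnmE E mnmE /= addnC divnMDl //.
by rewrite divn_small // addn0.
Qed.

Lemma mcountS k : mcount k.+1 = mcount k + hcount k.+1.
Proof. by rewrite !mcountE big_ord_recr. Qed.

Lemma mcount_homo j k : j <= k -> mcount j <= mcount k.
Proof.
move=> /subnKC <-; elim: (k - j) => [|l IH]; first by rewrite addn0.
by rewrite addnS mcountS; apply: leq_trans IH (leq_addr _ _).
Qed.

(** The b degrees removed lie above k - s, so each has at least [hcount (k - s)] monomials. *)
Lemma mcount_sub (i : 'I_N) k s b : b <= s -> s <= k ->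
  mcount (k - b) + b * hcount (k - s) <= mcount k.
Proof.
move=> bs sk; elim: b bs => [|b IH] bs; first by rewrite subn0 addn0.
apply: leq_trans (IH (ltnW bs)); rewrite mulSn addnA leq_add2r.
have -> : k - b = (k - b.+1).+1 by rewrite subnSK // (leq_trans bs).
by rewrite mcountS leq_add2l (hcount_homo i) //; lia.
Qed.

Local Notation sigma := (\sum_i (e i).-1).

Lemma sum_box_below k (phi : nat -> nat) : sigma <= k ->
  \sum_(r : box) \sum_(a : 'X_{1..N < (k - bdeg r).+1} | wdeg a <= k - bdeg r)
     phi (bdeg r + wdeg a) = \sum_(j < k.+1) phi j * hcount j.
Proof.
move=> sk; rewrite -sum_by_degree sum_box_decomposition; apply: eq_bigr => r _.
have rk : bdeg r <= k by apply: leq_trans (bdeg_le r) sk.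
rewrite -(@sum_multinom_widen (k - bdeg r).+1 k.+1 (fun a => wdeg a <= k - bdeg r)
  (fun a => phi (bdeg r + wdeg a))) ?ltnS ?leq_subr //.
  by apply: eq_bigl => a; rewrite ltnS -leq_subRL.
by move=> a; rewrite ltnS; apply: leq_trans (leq_mdeg_wdeg e0 a).
Qed.

Variables (i0 : 'I_N) (c : nat) (u : nat -> nat).
Hypothesis sum_u_le : forall K k,
  \sum_(a : 'X_{1..N < K} | wdeg a <= k) u (k - wdeg a) <= mcount k.
Hypothesis u_le : forall k, u k <= c.
Hypothesis u_max : forall k, sigma <= k -> u k = c.
Hypothesis u_add : forall s t, sigma <= (s + t).+1 -> c <= u s + u t.
Variables (M G : nat).
Hypothesis mcount_spanned : forall k, mcount k <=
  #|[pred a : 'X_{1..N < k.+1} | wdeg a + M <= k]| * c +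
  #|[pred a : 'X_{1..N < k.+1} | wdeg a <= k < wdeg a + M]| * G.

(** Split the monomials on the left by remainder; the part over r is the sum bounded by [sum_u_le]
    in degree k - bdeg r. *)
Lemma convolution_le k : sigma <= k ->
  \sum_(j < k.+1) u (k - j) * hcount j <= \sum_(r : box) mcount (k - bdeg r).
Proof.
move=> sk; rewrite -(sum_box_below (fun j => u (k - j))) //; apply: leq_sum => r _.
by under eq_bigr => a _ do rewrite subnDA; apply: sum_u_le.
Qed.

(** As u is c from sigma on, [convolution_le] gives c times [mcount k] at most #|box| times
    [mcount (k + sigma)]; the shift does not matter for polynomial growth. *)
Lemma c_le_prod : c <= #|box|.
Proof.
apply: (@polynomial_growth_le mcount N sigma 0) => [k|k|k _].
- exact: mcount_gt0.
- exact: mcount_le.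
have := convolution_le (leq_addl k sigma) => H.
apply: leq_trans (leq_trans H _); last first.
  rewrite -sum_nat_const; apply: leq_sum => r _.
  by apply: mcount_homo; apply: leq_subr.
rewrite mcountE big_distrr /= -addSn (big_ord_widen _ (fun j => c * hcount j) (leq_addr sigma k.+1)).
rewrite big_mkcond; apply: leq_sum => j _; case: ifP => // jk.
by rewrite u_max // -[X in X <= _](addKn k); apply: leq_sub2l.
Qed.

Lemma prod_le_c : #|box| <= c.
Proof.
(* Adding G to both sides absorbs the boundary term: X c + Y G + G X is at most (c + G)(X + Y),
   where X + Y is [mcount k']. *)
rewrite -(leq_add2r G).
apply: (@polynomial_growth_le mcount N (sigma + M) 0) => [k|k|k _].
- exact: mcount_gt0.
- exact: mcount_le.
set k' := k + (sigma + M).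
have sk' : sigma <= k' by rewrite /k'; lia.
pose phiX j : nat := j + M <= k'; pose phiY j : nat := k' < j + M.
pose X := \sum_(j < k'.+1) phiX j * hcount j.
pose Y := \sum_(j < k'.+1) phiY j * hcount j.
have XY : X + Y = mcount k'.
  rewrite mcountE -big_split; apply: eq_bigr => j _ /=.
  by rewrite -mulnDl /phiX /phiY ltnNge; case: (_ <= _); rewrite ?addn0 mul1n.
have XE : mcount (k + sigma) = X.
  have kk : (k + sigma).+1 <= k'.+1 by rewrite /k'; lia.
  rewrite mcountE (big_ord_widen _ hcount kk) big_mkcond; apply: eq_bigr => j _ /=.
  have E : phiX j = (j < (k + sigma).+1) 
    by move: (nat_of_ord j) => x; rewrite /phiX ltnS /k' addnA leq_add2r.
  rewrite -/(phiX j) E.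
  by case: ifP; rewrite ?mul1n ?mul0n.
have sum_le : \sum_(r : box) mcount (k' - bdeg r) <= X * c + Y * G.
  rewrite /X /Y -(sum_box_below phiX) // -(sum_box_below phiY) // !big_distrl -big_split.
  apply: leq_sum => r _ /=; apply: leq_trans (mcount_spanned _) _.
  have rk : bdeg r <= k' by apply: leq_trans (bdeg_le r) sk'.
  have count_le (Q Q' : pred 'X_{1..N < (k' - bdeg r).+1}) (psi : nat -> bool) :
      (forall a, Q a -> Q' a && psi (bdeg r + wdeg a)) ->
      #|[pred a | Q a]| <= \sum_(a | Q' a) psi (bdeg r + wdeg a).
    move=> QQ'; rewrite -sum1_card big_mkcond [X in _ <= X]big_mkcond.
    by apply: leq_sum => a _; rewrite inE; case: ifP => // /QQ' /andP[-> ->].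
  apply: leq_add; rewrite leq_mul2r; apply/orP; right.
    apply: (count_le _ _ (fun j => j + M <= k')) => a; move: rk.
    by move: (wdeg a) => y; move: (bdeg r) (k') => x z; lia.
  apply: (count_le _ _ (fun j => k' < j + M)) => a; move: rk.
  by move: (wdeg a) => y; move: (bdeg r) (k') => x z; lia.
have le_sum : #|box| * mcount k <= \sum_(r : box) mcount (k' - bdeg r).
  rewrite -sum_nat_const; apply: leq_sum => r _; apply: mcount_homo.
  by have := bdeg_le r; rewrite /k'; move: (bdeg r) sigma => x y; lia.
have GX : G * mcount k <= G * X by rewrite leq_mul // -XE mcount_homo // leq_addr.
rewrite -XY mulnDl; apply: leq_trans (leq_add (leq_trans le_sum sum_le) GX) _.
have key x y : x * c + y * G + G * x <= (c + G) * (x + y) by nia.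
exact: key.
Qed.

Lemma card_eq_prod : c = \prod_i e i.
Proof. by rewrite -card_box; apply/eqP; rewrite eqn_leq c_le_prod prod_le_c. Qed.

(** The next order of the same comparison. With c = #|box| the main terms of [convolution_le]
    cancel, leaving defects c - u_j on one side and shifts bdeg r on the other, both weighted by
    [hcount]. *)
Lemma sum_bdeg_le : \sum_(r : box) bdeg r <= \sum_(j < sigma) (c - u j).
Proof.
apply: (@polynomial_growth_le hcount N sigma 0) => [k|k|k _].
- exact: (hcount_gt0 i0).
- exact: hcount_le.
set k' := k + sigma; have sk' : sigma <= k' by rewrite leq_addl.
pose V := \sum_(j < k'.+1) (c - u j) * hcount (k' - j).
have VU : V + \sum_(j < k'.+1) u (k' - j) * hcount j = c * mcount k'.
  rewrite mcountE big_distrr /= [X in _ + X](reindex_inj rev_ord_inj) [RHS](reindex_inj rev_ord_inj).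
  rewrite -big_split; apply: eq_bigr => j _ /=.
  have jk : j <= k' by rewrite -ltnS.
  by rewrite subSS subKn // -mulnDl subnK.
have Vle : V <= (\sum_(j < sigma) (c - u j)) * hcount k'.
  have kk : sigma <= k'.+1 by rewrite leqW.
  rewrite (big_ord_widen _ (fun j => c - u j) kk) big_mkcond big_distrl.
  apply: leq_sum => j _ /=; case: ifPn => js.
    by rewrite leq_mul2l (hcount_homo i0) ?leq_subr ?orbT.
  by rewrite u_max ?subnn // leqNgt.
apply: leq_trans Vle; rewrite -(leq_add2r (\sum_(j < k'.+1) u (k' - j) * hcount j)) VU.
apply: leq_trans (leq_add (leqnn _) (convolution_le sk')) _.
have -> : c = #|box| by rewrite card_box card_eq_prod.
rewrite big_distrl -big_split -sum_nat_const; apply: leq_sum => r _ /=.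
have kE : k' - sigma = k by rewrite /k' addnK.
by have := mcount_sub i0 (bdeg_le r) sk'; rewrite kE addnC.
Qed.

(** Pair j with sigma - 1 - j. Each pair of defects is at most c by [u_add], while all of them sum
    to at least c sigma by [sum_bdeg_le]. The index s is paired with itself, so 2 (c - u_s) >= c;
    [u_add] gives the reverse inequality. *)
Lemma u_middle s : sigma = s.*2.+1 -> (u s).*2 = c.
Proof.
move=> sE; have le := sum_bdeg_le.
have : 2 * \sum_(j < sigma) (c - u j) =
    \sum_(j < sigma) ((c - u j) + (c - u (sigma - j.+1))).
  by rewrite mul2n -addnn {2}(reindex_inj rev_ord_inj) big_split.
have js : s < sigma by rewrite sE; lia.
rewrite [RHS](bigD1 (Ordinal js)) //=.
have -> : sigma - s.+1 = s by rewrite sE; lia.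
have : \sum_(j < sigma | j != Ordinal js) ((c - u j) + (c - u (sigma - j.+1)))
    <= sigma.-1 * c.
  rewrite -[sigma.-1 in X in _ <= X](_ : #|[pred j | j != Ordinal js]| = sigma.-1).
    rewrite -sum_nat_const; apply: leq_sum => j _.
    have := u_add (s := j) (t := sigma - j.+1).
    by have := u_le j; have := u_le (sigma - j.+1); have := ltn_ord j; lia.
  apply: succn_inj; rewrite (prednK (leq_ltn_trans (leq0n s) js)).
  by have := cardC (pred1 (Ordinal js)); rewrite card1 card_ord.
have cs : c <= u s + u s by apply: u_add; rewrite sE addnn.
have := sum_bdeg; rewrite card_box -card_eq_prod; move: le.
set A := \sum_(r : box) _; set B := \sum_(j < sigma) _.
set C := \sum_(j < sigma | _) _; clearbody A B C; rewrite sE.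
by have := u_le s; nia.
Qed.

End MonomialCounting.

(** * Bezout's count and the middle rank for affine systems *)

Lemma finite_enumeration (T : choiceType) (Z : T -> Prop) (B : nat) :
    (forall c (P : 'I_c -> T), injective P -> (forall a, Z (P a)) -> (c <= B)%N) ->
  exists2 s : seq T, uniq s & forall x, x \in s <-> Z x.
Proof.
move=> ZB.
have sB (s : seq T) : uniq s -> (forall x, x \in s -> Z x) -> (size s <= B)%N.
  move=> us sZ; apply: (ZB _ (tnth (in_tuple s))) => [|a]; last by apply/sZ/mem_tnth.
  exact/tuple_uniqP.
pose Q k := `[< exists s : seq T, [/\ uniq s, forall x, x \in s -> Z x & size s = k] >].
have Q0 : exists k, Q k by exists 0%N; apply/asboolP; exists [::].
have QB k : Q k -> (k <= B)%N by case/asboolP=> s [us sZ <-]; apply: sB.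
case: (ex_maxnP Q0 QB) => k /asboolP[s [us sZ sk]] kmax.
exists s => // x; split=> [|Zx]; first exact: sZ.
apply: contraT => xs; have : (k.+1 <= k)%N; last by rewrite ltnn.
apply: kmax; apply/asboolP; exists (x :: s); split; rewrite /= ?us ?xs ?sk //.
by move=> y; rewrite inE => /predU1P[->|/sZ].
Qed.

Section AffineIntersection.
Variables (N : nat) (L : closedFieldType).
Variables (F G : 'I_N -> {mpoly L[N]}) (e : 'I_N -> nat).
Hypothesis e0 : forall i, (0 < e i)%N.
Hypothesis Gh : forall i, G i \is (e i).-homog.
Hypothesis FG : forall i, supp_in (fun j => j < e i)%N (F i - G i).
Hypothesis J0 : forall p, zero_of F p -> \det (jac F p) != 0.

Lemma finitely_many_zeros :
  exists2 s : seq 'rV[L]_N, uniq s & forall x, x \in s <-> zero_of F x.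
Proof.
apply: finite_enumeration => c P P_inj P0.
apply: (card_points_le (degle_pred e0 Gh FG) P_inj P0) => a.
exact/J0/P0.
Qed.

Hypothesis Gzero : forall y : 'rV[L]_N,
  (forall i, (G i).@[fun j => y 0 j] = 0) -> y = 0.
Variables (c : nat) (P : 'I_c -> 'rV[L]_N) (i0 : 'I_N).
Hypotheses (P_inj : injective P) (PZ : forall p, zero_of F p <-> exists a, p = P a).

Let P0 a : zero_of F (P a). Proof. by apply/PZ; exists a. Qed.
Let JP a : \det (jac F (P a)) != 0. Proof. exact/J0/P0. Qed.
Let Fd := degle_pred e0 Gh FG.
Let Fe i : degle (e i) (F i).
Proof. by rewrite -(prednK (e0 i)); exact: Fd. Qed.

Let sumu : forall K k, (\sum_(a : 'X_{1..N < K} | wdeg e a <= k) urank P (k - wdeg e a)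
     <= mcount N k)%N := sum_urank_le Fe P0 JP.
Let ule k : (urank P k <= c)%N := rank_leq_col _.
Let umax := urank_max Fd P_inj P0 JP.
Let uadd := urank_add Fd P_inj P0 JP.

Theorem bezout_count : c = (\prod_i e i)%N.
Proof.
have [M HM] := card_monomials_le e0 Gh FG Gzero J0 P_inj PZ.
exact: (card_eq_prod e0 sumu umax HM).
Qed.

Theorem middle_rank s : (\sum_i (e i).-1 = s.*2.+1)%N -> ((urank P s).*2 = c)%N.
Proof.
have [M HM] := card_monomials_le e0 Gh FG Gzero J0 P_inj PZ.
exact: (u_middle e0 i0 sumu ule umax uadd HM).
Qed.

End AffineIntersection.

(** * Scaling, derivatives and Euler's identity for forms *)

Section HomogeneousEvaluation.
Variables (N : nat) (R : comNzRingType).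
Implicit Types (g : {mpoly R[N]}) (x : 'rV[R]_N).

Local Notation ev p f := (f.@[fun i => p 0 i]).

Lemma meval_homog_scale k g (c : R) x : g \is k.-homog ->
  ev (c *: x) g = c ^+ k * ev x g.
Proof.
move=> gk; rewrite !mevalE big_distrr /=; apply: eq_big_seq => m mg.
rewrite mulrCA; congr (_ * _).
have <- : mdeg m = k := dhomog_mf gk mg.
rewrite mdegE -prodrXr -big_split /=.
by apply: eq_bigr => i _; rewrite mxE exprMn.
Qed.

Lemma mderiv_homog k g i : g \is k.-homog -> g^`M(i) \is k.-1.-homog.
Proof.
move=> /homog_supp gk; apply/homog_supp => m /= mk.
rewrite mcoeff_mderiv gk ?mul0rn // mdegD mdeg1 addn1 /=.
by apply: contra mk => /eqP <-.
Qed.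

Lemma euler_identity k g : g \is k.-homog -> \sum_j 'X_j * g^`M(j) = g *+ k.
Proof.
move=> gk; have E m : \sum_j 'X_j * ('X_[R, m])^`M(j) = 'X_[m] *+ mdeg m.
  rewrite mdegE -sumrMnr; apply: eq_bigr => j _; rewrite mderivX.
  have [->|mj] := eqVneq (m j) 0%N; first by rewrite scale0r mulr0.
  by rewrite -scalerAr -mpolyXD addmC submK ?lep1mP // scaler_nat.
rewrite [in LHS](mpolyE g) [in RHS](mpolyE g) -sumrMnl.
under eq_bigr => j _ do rewrite raddf_sum big_distrr /=.
rewrite exchange_big /=; apply: eq_big_seq => m mg.
under eq_bigr => j _ do rewrite mderivZ -scalerAr.
have <- : mdeg m = k := dhomog_mf gk mg.
by rewrite -scaler_sumr E scalerMnr.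
Qed.

End HomogeneousEvaluation.

(** * Common zeros of forms *)

Section Projective.
Variables (n : nat) (L : closedFieldType) (f : 'I_n -> {mpoly L[n.+1]}) (d : 'I_n -> nat).
Hypothesis d0 : forall i, (0 < d i)%N.
Hypothesis fh : forall i, f i \is (d i).-homog.
Implicit Types (a x y : 'rV[L]_n.+1).

Local Notation ev p f := (f.@[fun i => p 0 i]).

Definition linform a : {mpoly L[n.+1]} := \sum_j a 0 j *: 'X_j.
Definition dot a x := \sum_j a 0 j * x 0 j.

(** The affine system of the forms on the hyperplane a = 1, the extra equation having index [ord0];
    [slice_top] consists of the leading forms. *)
Definition slice a (i : 'I_n.+1) : {mpoly L[n.+1]} :=
  if unlift ord0 i is Some k then f k else linform a - 1.
Definition slice_top a (i : 'I_n.+1) : {mpoly L[n.+1]} :=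
  if unlift ord0 i is Some k then f k else linform a.
Definition slice_deg (i : 'I_n.+1) : nat :=
  if unlift ord0 i is Some k then d k else 1%N.

Definition bordered_jac a x := \det (jac (slice a) x).

Definition common_zero x := forall i, ev x (f i) = 0.

Lemma ev_linform a x : ev x (linform a) = dot a x.
Proof. by rewrite raddf_sum; apply: eq_bigr => j _ /=; rewrite mevalZ mevalXU. Qed.

Lemma dotZ a c x : dot a (c *: x) = c * dot a x.
Proof. by rewrite big_distrr; apply: eq_bigr => j _; rewrite mxE mulrCA. Qed.

Lemma dot_delta l x : dot (delta_mx 0 l) x = x 0 l.
Proof.
rewrite /dot (bigD1 l) //= mxE !eqxx mul1r big1 ?addr0 // => j /negPf jl.
by rewrite mxE jl andbF mul0r.
Qed.

Lemma zero_of_slice a x : zero_of (slice a) x <-> common_zero x /\ dot a x = 1.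
Proof.
split=> [z|[z a1] i]; rewrite /slice.
  split=> [i|]; first by have := z (lift ord0 i); rewrite /slice liftK.
  have := z ord0; rewrite /slice unlift_none mevalB ev_linform meval1.
  by move/eqP; rewrite subr_eq0 => /eqP.
by case: unliftP => [k _|_]; rewrite ?mevalB ?ev_linform ?meval1 ?a1 ?subrr.
Qed.

Lemma jac_slice0 a x j : jac (slice a) x ord0 j = a 0 j.
Proof.
rewrite mxE /slice unlift_none mderivB -mpolyC1 mderivC subr0.
rewrite /linform (raddf_sum (mderiv j)) /= (raddf_sum (meval _)) /= (bigD1 j) //= big1 ?addr0 => [|k /negPf kj].
  rewrite mderivZ mevalZ mderivX mnm1E eqxx scale1r.
  have -> : (U_(j) - U_(j) = 0)%MM by apply/mnmP => i; rewrite mnmBE subnn mnm0E.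
  by rewrite mpolyX0 meval1 mulr1.
by rewrite mderivZ mevalZ mderivX mnm1E kj scale0r meval0 mulr0.
Qed.

Lemma jac_slice a x i j : jac (slice a) x (lift ord0 i) j = ev x ((f i)^`M(j)).
Proof. by rewrite mxE /slice liftK. Qed.

(** So the ratio of [bordered_jac a x] to a(x) does not depend on a. By Euler's identity the
    bordered matrix sends x to (a(x), 0, ..., 0), and Cramer's rule expresses x_j times the
    determinant by a cofactor of the first row, in which a does not occur. *)
Lemma bordered_jac_dot a b x : common_zero x ->
  bordered_jac a x * dot b x = bordered_jac b x * dot a x.
Proof.
move=> x0.
have cof j : cofactor (jac (slice a) x) ord0 j = cofactor (jac (slice b) x) ord0 j.
  rewrite /cofactor; congr (_ * \det _); apply/matrixP => i k.
  by rewrite !mxE /slice liftK.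
have H j : x 0 j * bordered_jac a x = cofactor (jac (slice b) x) ord0 j * dot a x.
  have Jx : jac (slice a) x *m x^T = \col_i (if i == ord0 then dot a x else 0).
    apply/colP => i; rewrite !mxE; case: (unliftP ord0 i) => [k ->|->] /=.
      under eq_bigr => l _ do rewrite jac_slice mxE.
      transitivity (ev x (\sum_l 'X_l * (f k)^`M(l))).
        by rewrite raddf_sum; apply: eq_bigr => l _ /=; rewrite mevalM mevalXU mulrC.
      by rewrite (euler_identity (fh k)) mevalMn x0 mul0rn.
    by apply: eq_bigr => l _; rewrite jac_slice0 mxE.
  have : (\adj (jac (slice a) x) *m (jac (slice a) x *m x^T)) j 0 =
      bordered_jac a x * x 0 j by rewrite mulmxA mul_adj_mx mul_scalar_mx !mxE.
  rewrite mulrC => <-; rewrite Jx mxE (bigD1 ord0) //= big1 => [|i /negPf i0].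
    by rewrite addr0 !mxE cof.
  by rewrite !mxE i0 mulr0.
rewrite mulrC [dot b x]/dot big_distrl /= {2}/bordered_jac.
rewrite (expand_det_row (jac (slice b) x) ord0) big_distrl /=.
by apply: eq_bigr => j _; rewrite -mulrA H jac_slice0 mulrA.
Qed.

Lemma bordered_jac_scale a c x :
  bordered_jac a (c *: x) = c ^+ (\sum_i (d i).-1) * bordered_jac a x.
Proof.
pose D := diag_mx (\row_i c ^+ (slice_deg i).-1 : 'rV[L]_n.+1).
rewrite /bordered_jac; have -> : jac (slice a) (c *: x) = D *m jac (slice a) x.
  apply/matrixP => i j; rewrite mul_diag_mx [RHS]mxE [X in _ = X * _]mxE /slice_deg.
  case: (unliftP ord0 i) => [k ->|->]; last by rewrite !jac_slice0 expr0 mul1r.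
  by rewrite !jac_slice (meval_homog_scale _ _ (mderiv_homog j (fh k))).
rewrite det_mulmx det_diag; congr (_ * _).
rewrite big_ord_recl mxE /slice_deg unlift_none expr0 mul1r -prodrXr.
by apply: eq_bigr => i _; rewrite mxE liftK.
Qed.

(** Normalized vectors, whose first nonzero coordinate is 1, are the chosen representatives of
    projective points; ring endomorphisms of the field preserve them. *)
Definition lead x : 'I_n.+1 :=
  odflt ord0 [pick l | (x 0 l == 1) && [forall j : 'I_n.+1, (j < l)%N ==> (x 0 j == 0)]].
Definition normalized x :=
  (x 0 (lead x) == 1) && [forall j : 'I_n.+1, (j < lead x)%N ==> (x 0 j == 0)].

Lemma normalized_lead x : normalized x -> x 0 (lead x) = 1.
Proof. by case/andP=> /eqP. Qed.

Lemma normalizedP x l : x 0 l = 1 -> (forall j : 'I_n.+1, (j < l)%N -> x 0 j = 0) ->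
  normalized x.
Proof.
move=> xl xj; rewrite /normalized /lead; case: pickP => [k //|/(_ l)].
rewrite xl eqxx /= => /negP[]; apply/forallP => j; apply/implyP => jl.
exact/eqP/xj.
Qed.

Lemma normalized_neq0 x : normalized x -> x != 0.
Proof.
move/normalized_lead => x1; apply: contra_eq_neq x1 => ->.
by rewrite mxE eq_sym oner_eq0.
Qed.

Lemma normalizable x : x != 0 -> exists2 c, c != 0 & normalized (c *: x).
Proof.
case/rV0Pn => l xl; pose Q k := (k < n.+1)%N && (x 0 (inord k) != 0).
have Q0 : exists k, Q k by exists l; rewrite /Q ltn_ord inord_val.
case: (ex_minnP Q0) => k /andP[kn xk] kmin; exists (x 0 (inord k))^-1.
  by rewrite invr_eq0.
apply: (@normalizedP _ (inord k)) => [|j jk]; rewrite mxE ?mulVf //.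
apply/eqP; rewrite mulf_eq0; apply/orP; right; apply: contraT => xj.
have := kmin j; rewrite /Q ltn_ord inord_val => /(_ xj).
by rewrite leqNgt; move: jk; rewrite inordK // => ->.
Qed.

Lemma normalized_scale x c : normalized x -> normalized (c *: x) -> c = 1.
Proof.
move=> xn cn; have [cl] := andP cn; have [xl] := andP xn.
have c0 : c != 0.
  by have := normalized_neq0 cn; apply: contraNneq => ->; rewrite scale0r.
move=> /forallP xj /forallP cj.
have [lt|gt|e] := ltngtP (lead x) (lead (c *: x)).
- have := cj (lead x); rewrite lt /= mxE mulf_eq0 (negPf c0) /= (eqP xl).
  by rewrite oner_eq0.
- have := xj (lead (c *: x)); rewrite gt /= => /eqP x0.
  by move: cl; rewrite mxE x0 mulr0 eq_sym oner_eq0.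
- by move: cl; rewrite mxE -(val_inj e) (eqP xl) mulr1 => /eqP.
Qed.

Lemma common_zeroZ c x : common_zero x -> common_zero (c *: x).
Proof. by move=> x0 i; rewrite (meval_homog_scale _ _ (fh i)) x0 mulr0. Qed.

Hypothesis transversal : forall x l, common_zero x -> x 0 l = 1 ->
  bordered_jac (delta_mx 0 l) x != 0.

Lemma bordered_jac_neq0 a x : common_zero x -> dot a x != 0 -> bordered_jac a x != 0.
Proof.
move=> x0 ax; have /normalizable[c c0 cn] : x != 0.
  apply: contra_neq ax => ->; rewrite /dot big1 // => j _.
  by rewrite mxE mulr0.
pose y := c *: x; have y0 : common_zero y by apply: common_zeroZ.
have yl := normalized_lead cn.
have := bordered_jac_dot a (delta_mx 0 (lead y)) y0.
rewrite dot_delta yl mulr1 dotZ => E.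
have : bordered_jac a y != 0 by rewrite E !mulf_neq0 // transversal.
by rewrite bordered_jac_scale; apply: contraNneq => ->; rewrite mulr0.
Qed.

Lemma slice_deg_gt0 i : (0 < slice_deg i)%N.
Proof. by rewrite /slice_deg; case: unliftP. Qed.

Lemma slice_top_homog a i : slice_top a i \is (slice_deg i).-homog.
Proof.
rewrite /slice_top /slice_deg; case: unliftP => // _.
by apply: rpred_sum => j _; apply: dhomogZ; rewrite dhomogX /= mdeg1.
Qed.

Lemma slice_lower a i : supp_in (fun j => j < slice_deg i)%N (slice a i - slice_top a i).
Proof.
rewrite /slice_top /slice_deg /slice; case: unliftP => [k _|_].
  by rewrite subrr; apply: supp_in0.
by rewrite addrC addKr; apply/supp_inN; rewrite -mpolyC1; apply: supp_inC.
Qed.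

Lemma slice_jac_neq0 a x : zero_of (slice a) x -> \det (jac (slice a) x) != 0.
Proof.
case/zero_of_slice => x0 ax; apply: (@bordered_jac_neq0 a x x0).
by rewrite ax oner_eq0.
Qed.

(** A normalized zero lies in one of the n + 1 slices x_l = 1, each with finitely many zeros. *)
Lemma finitely_many_common_zeros : exists2 s : seq 'rV[L]_n.+1, uniq s &
  forall x, x \in s <-> common_zero x /\ normalized x.
Proof.
have /choice[s sP] (l : 'I_n.+1) : exists s : seq 'rV[L]_n.+1,
    forall x, x \in s <-> zero_of (slice (delta_mx 0 l)) x.
  have [s _ sP] := finitely_many_zeros slice_deg_gt0 (slice_top_homog _)
    (slice_lower (delta_mx 0 l)) (@slice_jac_neq0 (delta_mx 0 l)).
  by exists s.
exists (undup [seq x <- flatten (codom s) | normalized x & `[< common_zero x >] ]).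
  exact: undup_uniq.
move=> x; rewrite mem_undup mem_filter; split=> [/andP[/andP[xn /asboolP x0] _] //|[x0 xn]].
rewrite xn; apply/andP; split; first exact/asboolP.
apply/flattenP; exists (s (lead x)); first exact: codom_f.
by apply/sP/zero_of_slice; rewrite dot_delta normalized_lead.
Qed.

(** Take the form with coefficients (1, t, ..., t^n): at x it is a nonzero polynomial in t, and some
    t avoids the roots of all of these. *)
Lemma exists_avoiding_form (s : seq 'rV[L]_n.+1) : (forall x, x \in s -> x != 0) ->
  exists a, forall x, x \in s -> dot a x != 0.
Proof.
move=> s0; pose q x : {poly L} := \poly_(j < n.+1) x 0 (inord j).
have q0 x : x != 0 -> q x != 0.
  apply: contra_neq => /polyP qx; apply/rowP => j; rewrite mxE.
  by have := qx j; rewrite coef_poly ltn_ord inord_val coef0.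
have /closed_nonrootP[t] : \prod_(x <- s) q x != 0.
  by rewrite prodf_seq_neq0; apply/allP => x /s0 /q0.
rewrite /root horner_prod prodf_seq_neq0 => /allP tP.
exists (\row_j t ^+ j) => x xs; have := tP x xs; rewrite /= horner_poly.
by congr (_ != 0); apply: eq_bigr => j _; rewrite mxE inord_val mulrC.
Qed.

(** Rows of monomials of degree below s are set to 0, so the rank is that of the values of forms of
    degree exactly s. *)
Definition form_mx s c (X : 'I_c -> 'rV[L]_n.+1) : 'M[L]_(#|{: 'X_{1..n.+1 < s.+1}}|, c) :=
  \matrix_(m, b) (if mdeg (enum_val m : 'X_{1..n.+1 < s.+1}) == s
                  then ev (X b) 'X_[enum_val m : 'X_{1..n.+1 < s.+1}] else 0).

Lemma form_mx_ker s c (X : 'I_c -> 'rV[L]_n.+1) (w : 'rV_c) :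
  w *m (form_mx s X)^T = 0 <->
  forall g, g \is s.-homog -> \sum_b w 0 b * ev (X b) g = 0.
Proof.
split=> [wE g gs|H].
  pose T g := \sum_b w 0 b * ev (X b) g = 0.
  rewrite -/(T g) (mpolyE g) big_seq; apply: (big_ind T); rewrite /T.
  - by rewrite big1 // => b _; rewrite meval0 mulr0.
  - move=> g1 g2 H1 H2; under eq_bigr => b _ do rewrite mevalD mulrDr.
    by rewrite big_split /= H1 H2 addr0.
  move=> m mg; have ms : mdeg m = s := dhomog_mf gs mg.
  have ms' : (mdeg m < s.+1)%N by rewrite ms.
  transitivity (g@_m * (w *m (form_mx s X)^T) 0 (enum_rank (BMultinom ms'))).
    rewrite mxE big_distrr; apply: eq_bigr => b _ /=.
    by rewrite !mxE enum_rankK /= ms eqxx mevalZ mulrCA.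
  by rewrite wE mxE mulr0.
apply/rowP => m; rewrite !mxE; case: (eqVneq (mdeg (enum_val m)) s) => ms; last first.
  by rewrite big1 // => b _; rewrite !mxE (negPf ms) mulr0.
rewrite -[RHS](H 'X_[enum_val m]); last by rewrite dhomogX /= ms.
by apply: eq_bigr => b _; rewrite !mxE ms eqxx.
Qed.

Section FormEvaluation.
Variables (a : 'rV[L]_n.+1) (c : nat) (X : 'I_c -> 'rV[L]_n.+1).
Hypothesis aX : forall b, dot a (X b) != 0.

Let P b := (dot a (X b))^-1 *: X b.

(** Multiplying by powers of the linear form a turns polynomials of degree at most s into forms of
    degree s. Passing from X b to P b rescales the values by a(X b)^s, which the diagonal matrix
    records. *)
Lemma form_mx_kernel s m (W : 'M_(m, c)) :
  W *m (form_mx s X)^T = 0 <->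
  W *m diag_mx (\row_b dot a (X b) ^+ s) *m (eval_mx P s)^T = 0.
Proof.
set D := diag_mx _.
have wD (w : 'rV_c) b : (w *m D) 0 b = w 0 b * dot a (X b) ^+ s by rewrite mul_mx_diag !mxE.
have homogP w g k b : g \is k.-homog -> (k <= s)%N ->
    w * dot a (X b) ^+ s * ev (P b) g = w * ev (X b) (g * linform a ^+ (s - k)).
  move=> gk ks; rewrite (meval_homog_scale _ _ gk) mevalM rmorphXn /= ev_linform.
  rewrite -mulrA; congr (_ * _); rewrite mulrA mulrC; congr (_ * _).
  by rewrite -{1}(subnK ks) exprD -mulrA -exprMn mulfV // expr1n mulr1.
have kerP (w : 'rV_c) : w *m (form_mx s X)^T = 0 <-> w *m D *m (eval_mx P s)^T = 0.
  split=> [/form_mx_ker wE|/eval_mx_ker wE].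
    apply/eval_mx_ker => g gs; pose T g := \sum_b (w *m D) 0 b * ev (P b) g = 0.
    rewrite -/(T g) (mpolyE g) big_seq; apply: (big_ind T); rewrite /T.
    - by rewrite big1 // => b _; rewrite meval0 mulr0.
    - move=> g1 g2 H1 H2; under eq_bigr => b _ do rewrite mevalD mulrDr.
      by rewrite big_split /= H1 H2 addr0.
    move=> m' /(supp_in_msupp gs) /= ms.
    have mh : g@_m' *: 'X_[m'] \is (mdeg m').-homog by apply: dhomogZ; rewrite dhomogX.
    under eq_bigr => b _ do rewrite wD (homogP _ _ _ _ mh ms).
    apply: wE; rewrite -[s in s.-homog](subnKC ms); apply: dhomogM => //.
    rewrite -[X in X.-homog]mul1n; apply: dhomogMn.
    by have := slice_top_homog a ord0; rewrite /slice_top /slice_deg unlift_none.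
  apply/form_mx_ker => g gs; rewrite -[RHS](wE g).
    apply: eq_bigr => b _; rewrite wD (homogP _ _ _ _ gs) //.
    by rewrite subnn expr0 mulr1.
  by move/homog_supp: gs; apply: supp_in_sub => j /eqP ->.
split=> E; apply/row_matrixP => i; rewrite row0 !row_mul.
  by apply/kerP; rewrite -row_mul E row0.
by apply/kerP; rewrite -!row_mul E row0.
Qed.

Lemma dot_diag_unit s : diag_mx (\row_b dot a (X b) ^+ s) \in unitmx.
Proof.
by rewrite unitmxE det_diag unitfE; apply/prodf_neq0 => b _; rewrite mxE expf_neq0.
Qed.

Lemma rank_form_mx s : \rank (form_mx s X) = urank P s.
Proof.
have Du := dot_diag_unit s; set D := diag_mx _ in Du.
have ker_rank : \rank (kermx (form_mx s X)^T) = \rank (kermx (eval_mx P s)^T).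
  apply/eqP; rewrite eqn_leq; apply/andP; split.
    rewrite -(mxrankMfree (kermx (form_mx s X)^T) (B := D)) ?row_free_unit //.
    by apply/mxrankS/sub_kermxP/form_mx_kernel; rewrite mulmx_ker.
  rewrite -(mxrankMfree (kermx (eval_mx P s)^T) (B := invmx D)) ?row_free_unit ?unitmx_inv //.
  by apply/mxrankS/sub_kermxP/form_mx_kernel; rewrite mulmxKV // mulmx_ker.
have := ker_rank; rewrite !mxrank_ker !mxrank_tr => E.
have := rank_leq_col (form_mx s X); have := rank_leq_col (eval_mx P s).
by rewrite /urank => l1 l2; rewrite -(subKn l2) E subKn.
Qed.

End FormEvaluation.

Lemma lambda_scale a x : common_zero x -> normalized x -> dot a x != 0 ->
  bordered_jac a ((dot a x)^-1 *: x) =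
  (dot a x)^-1 ^+ (\sum_i (d i).-1) * dot a x * bordered_jac (delta_mx 0 (lead x)) x.
Proof.
move=> x0 xn ax; rewrite bordered_jac_scale -mulrA; congr (_ * _).
have := bordered_jac_dot a (delta_mx 0 (lead x)) x0.
by rewrite dot_delta normalized_lead // mulr1 mulrC.
Qed.

Definition lambda x := bordered_jac (delta_mx 0 (lead x)) x.

(** Choose a nonvanishing at every common zero. Then all zeros are in one slice and the leading
    forms have only the trivial zero, so the affine count and middle rank apply. *)
Theorem forms_lagrangian s : (\sum_i (d i).-1 = s.*2.+1)%N ->
  exists c (X : 'I_c -> 'rV[L]_n.+1),
  [/\ injective X /\
      (forall x, common_zero x /\ normalized x <-> exists b, x = X b),
      c = (\prod_i d i)%N, ((\rank (form_mx s X)).*2 = c)%N,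
      \rank (form_mx s.*2.+1 X) = c &
      kermx (form_mx s X)^T *m diag_mx (\row_b lambda (X b)) *m
        (kermx (form_mx s X)^T)^T = 0].
Proof.
move=> sE; have [r ur rP] := finitely_many_common_zeros.
pose c := size r; pose X (b : 'I_c) := tnth (in_tuple r) b.
have X_inj : injective X by exact/tuple_uniqP.
have XP x : common_zero x /\ normalized x <-> exists b, x = X b.
  split=> [/rP xr|[b ->]]; last by apply/rP/mem_tnth.
  by have /tnthP[b xb] : x \in in_tuple r by []; exists b.
have Xz b : common_zero (X b) by apply: proj1 (proj2 (XP _) _); exists b.
have Xn b : normalized (X b) by apply: proj2 (proj2 (XP _) _); exists b.
have [a aP] : exists a, forall x, x \in r -> dot a x != 0.
  by apply: exists_avoiding_form => x /rP[_]; apply: normalized_neq0.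
have aX b : dot a (X b) != 0 by apply/aP/mem_tnth.
pose P b := (dot a (X b))^-1 *: X b.
have P_inj : injective P.
  move=> b b' /(congr1 ( *:%R (dot a (X b)))); rewrite /P !scalerA mulfV // scale1r => E.
  have := Xn b; rewrite E => /(normalized_scale (Xn b')) k1.
  by apply: X_inj; rewrite E k1 scale1r.
have PZ p : zero_of (slice a) p <-> exists b, p = P b.
  split=> [/zero_of_slice[p0 ap]|[b ->]]; last first.
    by apply/zero_of_slice; rewrite dotZ mulVf //; split=> //; apply: common_zeroZ.
  have /normalizable[k k0 kn] : p != 0.
    apply: contra_eq_neq ap => ->; rewrite /dot big1 ?(eq_sym 0) ?oner_eq0 // => j _.
    by rewrite mxE mulr0.
  have [b bE] := proj1 (XP _) (conj (common_zeroZ k p0) kn).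
  by exists b; rewrite /P -bE dotZ ap mulr1 scalerA mulVf ?scale1r.
have Gzero y : (forall i, ev y (slice_top a i) = 0) -> y = 0.
  move=> y0; apply/eqP; apply: contraT => /normalizable[k k0 kn].
  have yz : common_zero y by move=> i; have := y0 (lift ord0 i); rewrite /slice_top liftK.
  have [b bE] := proj1 (XP _) (conj (common_zeroZ k yz) kn).
  have := aX b; rewrite -bE dotZ.
  by have := y0 ord0; rewrite /slice_top unlift_none ev_linform => ->; rewrite mulr0 eqxx.
have J0 := @slice_jac_neq0 a.
have cE := bezout_count slice_deg_gt0 (slice_top_homog a) (slice_lower a) J0 Gzero P_inj PZ.
have sE' : (\sum_i (slice_deg i).-1 = s.*2.+1)%N.
  rewrite big_ord_recl /slice_deg unlift_none add0n -sE.
  by apply: eq_bigr => i _; rewrite liftK.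
have rE := middle_rank slice_deg_gt0 (slice_top_homog a) (slice_lower a) J0 Gzero ord0 P_inj PZ sE'.
pose D := diag_mx (\row_b dot a (X b) ^+ s) : 'M[L]_c.
have P0 b : zero_of (slice a) (P b) by apply/PZ; exists b.
exists c, X; split=> //.
- rewrite {1}cE big_ord_recl /slice_deg unlift_none mul1n.
  by apply: eq_bigr => i _; rewrite liftK.
- by rewrite (rank_form_mx aX) rE.
- by rewrite (rank_form_mx aX) (urank_max (degle_pred slice_deg_gt0 (slice_top_homog a)
    (slice_lower a)) P_inj P0) ?sE' // => b; apply/J0/P0.
(* By [lambda_scale] the slice Jacobian at P b is lambda(X b) times a(X b)^(-2 s), so conjugating by
   D restores lambda. *)
have -> : diag_mx (\row_b lambda (X b)) = D *m jac_diag (slice a) P *m D.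
  apply/matrixP => b b'; rewrite mul_mx_diag mul_diag_mx !mxE.
  case: eqP => [<-|_]; last by rewrite !mulr0n mulr0 mul0r.
  rewrite !mulr1n -[\det _]/(bordered_jac a (P b)) lambda_scale // sE exprS.
  rewrite -/(lambda (X b)) -addnn exprD; set k := dot a (X b).
  have k0 : k != 0 by exact: aX.
  rewrite exprVn; field.
  by rewrite k0 expf_neq0.
have /submxP[Y YE] : (kermx (form_mx s X)^T *m D <= kermx (eval_mx P s)^T)%MS.
  by apply/sub_kermxP/(form_mx_kernel aX); rewrite mulmx_ker.
have st : (\sum_i (slice_deg i).-1 <= (s + s).+1)%N by rewrite sE' addnn.
set K := kermx (form_mx s X)^T in YE *.
have -> : K *m (D *m jac_diag (slice a) P *m D) *m K^T =
    (K *m D) *m jac_diag (slice a) P *m (K *m D)^T.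
  have DT : D^T = D by exact: tr_diag_mx.
  by rewrite (trmx_mul K D) DT !mulmxA.
rewrite YE; set K1 := kermx _.
have -> : Y *m K1 *m jac_diag (slice a) P *m (Y *m K1)^T =
    Y *m (K1 *m jac_diag (slice a) P *m K1^T) *m Y^T.
  by rewrite (trmx_mul Y K1) !mulmxA.
rewrite (jac_isotropic_ker (degle_pred slice_deg_gt0 (slice_top_homog a) (slice_lower a))
  P_inj P0 st).
by rewrite mulmx0 mul0mx.
Qed.

End Projective.

(** * Lagrangian subspaces and discriminants *)

Section LagrangianDeterminant.
Variables (K : fieldType).

Lemma det_hyperbolic h (C : 'M[K]_h) : \det (block_mx 0 1%:M 1%:M C) = (-1) ^+ h.
Proof.
have -> : block_mx 0 1%:M 1%:M C = block_mx 1%:M 0 C 1%:M *m block_mx 1%:M 0 0 (- 1%:M) *m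
    (block_mx 1%:M 1%:M 0 1%:M *m (block_mx 1%:M 0 (- 1%:M) 1%:M *m
      block_mx 1%:M 1%:M 0 1%:M)) :> 'M[K]_(h + h).
  rewrite !mulmx_block ?(mul0mx, mulmx0, mul1mx, mulmx1, add0r, addr0, mulmxN, mulNmx).
  by rewrite ?(subrr, addNr, opprK, mulmx1, mul1mx, mulmx0, add0r, addr0, subr0, oppr0).
rewrite !det_mulmx !det_lblock !det_ublock !det1 !mul1r !mulr1.
by rewrite -scaleN1r detZ det1 mulr1.
Qed.

(* If U is Lagrangian for the form with matrix Q^-1 and N is dual to a basis  *)
(* B of U, then det (B, N) does not depend on N and its square is             *)
(* (-1)^h det Q; its behaviour under phi is that of a discriminant root.      *)
Lemma lagrangian_determinant (phi : {rmorphism K -> K}) h r (E : 'M[K]_(r, h + h))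
    (la : 'I_(h + h) -> K) (pi : 'S_(h + h)) :
    \rank E = h -> (forall b, la b != 0) ->
    kermx E^T *m diag_mx (\row_b la b) *m (kermx E^T)^T = 0 ->
    map_mx phi E = col_perm pi E -> (forall b, phi (la b) = la (pi b)) ->
  exists rho, [/\ rho != 0, rho ^+ 2 = (-1) ^+ h * \prod_b la b &
                  phi rho = (-1) ^+ pi * rho].
Proof.
move=> rE la0 iso Ephi laphi.
set Q := diag_mx _ in iso.
have Qu : Q \in unitmx.
  by rewrite unitmxE det_diag unitfE; apply/prodf_neq0 => b _; rewrite mxE.
pose Q' := diag_mx (\row_b (la b)^-1).
have QQ' : Q *m Q' = 1%:M.
  apply/matrixP => i j; rewrite mul_mx_diag !mxE; case: eqP => [->|_].
    by rewrite mulr1n mulfV.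
  by rewrite mulr0n mul0r.
(* The rows of B are taken among those of E, so phi still acts on B by permuting columns. *)
have [B [BE Bfree Bphi]] : exists B : 'M[K]_(h, h + h),
    [/\ (B <= E)%MS, row_free B & map_mx phi B = col_perm pi B].
  pose B := rowsub (maxrankfun E) E.
  have BE : (B <= E)%MS by rewrite eq_maxrowsub.
  have Bf : row_free B := maxrowsub_free E.
  have Bp : map_mx phi B = col_perm pi B.
    by apply/matrixP => i j; have /matrixP/(_ (maxrankfun E i) j) := Ephi; rewrite !mxE.
  by move: (B) BE Bf Bp; rewrite rE => B'; exists B'.
set Kr := kermx E^T in iso.
have rK : \rank Kr = h by rewrite mxrank_ker mxrank_tr rE addnK.
have rKK : \rank (kermx Kr^T) = h by rewrite mxrank_ker mxrank_tr rK addnK.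
(* Both E and, by isotropy, Kr *m Q lie in the annihilator of Kr, and all three have rank h.
   Isotropy thus passes to E for the inverse form Q'. *)
have EK : (E <= Kr *m Q)%MS.
  have K1 : (Kr *m Q <= kermx Kr^T)%MS by apply/sub_kermxP.
  have K2 : (E <= kermx Kr^T)%MS.
    by apply/sub_kermxP/trmx_inj; rewrite trmx_mul trmxK mulmx_ker trmx0.
  have rKQ : \rank (Kr *m Q) = h by rewrite mxrankMfree ?row_free_unit.
  apply: submx_trans K2 _.
  by have := mxrank_leqif_sup K1; rewrite rKQ rKK => -[_ <-].
have BQB : B *m Q' *m B^T = 0.
  have /submxP[Y YE] := submx_trans BE EK.
  have QT : Q^T = Q by exact: tr_diag_mx.
  rewrite YE (trmx_mul Y) (trmx_mul Kr Q) QT.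
  transitivity (Y *m (Kr *m (Q *m Q') *m Q *m Kr^T) *m Y^T); first by rewrite !mulmxA.
  by rewrite QQ' mulmx1 iso mulmx0 mul0mx.
have Q'u : Q' \in unitmx by case: (mulmx1_unit QQ').
have BQfree : row_free (B *m Q') by rewrite /row_free mxrankMfree ?row_free_unit.
have [Z BZ] := row_freeP BQfree.
pose N := Z^T; have BN : B *m Q' *m N^T = 1%:M by rewrite trmxK.
pose P := col_mx B N.
have PQP : \det (P *m Q' *m P^T) = (-1) ^+ h.
  rewrite /P mul_col_mx tr_col_mx mul_col_row BQB BN.
  have -> : N *m Q' *m B^T = 1%:M.
    have Q'T : Q'^T = Q' by exact: tr_diag_mx.
    by apply: trmx_inj; rewrite trmx1 !trmx_mul trmxK Q'T mulmxA BN.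
  exact: det_hyperbolic.
have detQ' : \det Q' = (\prod_b la b)^-1.
  by rewrite det_diag -prodfV; apply: eq_bigr => b _; rewrite mxE.
have prod0 : \prod_b la b != 0 by apply/prodf_neq0.
have rho2 : \det P ^+ 2 = (-1) ^+ h * \prod_b la b.
  by rewrite -PQP !det_mulmx det_tr detQ' mulrAC divfK ?expr2.
exists (\det P); split=> //.
  have : \det P ^+ 2 != 0 by rewrite rho2 mulf_neq0 ?signr_eq0.
  by rewrite expf_eq0.
(* The conjugate of N with its columns moved back; like N it is dual to B. *)
pose N' := col_perm pi^-1 (map_mx phi N).
have phiP : map_mx phi P = col_perm pi (col_mx B N').
  rewrite /P map_col_mx Bphi; apply/matrixP => i j.
  rewrite !mxE; case: splitP => k _; rewrite !mxE //.
  by rewrite permK.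
have BN' : B *m Q' *m N'^T = 1%:M.
  have entry (M1 M2 : 'M_(h, h + h)) i j :
      (M1 *m Q' *m M2^T) i j = \sum_b M1 i b * (la b)^-1 * M2 j b.
    by rewrite mxE; apply: eq_bigr => b _; rewrite mul_mx_diag !mxE.
  apply/matrixP => i j; have := congr1 (fun M : 'M_h => phi (M i j)) BN.
  rewrite !entry !mxE rmorph_nat => <-; rewrite rmorph_sum (reindex_inj (@perm_inj _ pi)).
  apply: eq_bigr => b _; rewrite !rmorphM fmorphV laphi !mxE permK /=.
  by have /matrixP/(_ i b) := Bphi; rewrite !mxE => ->.
(* N' - N is orthogonal to B, whose row space is its own orthogonal; adding multiples of B leaves
   the determinant unchanged. *)
have [Y YE] : exists Y, N' = N + Y *m B.
  have K1 : (B <= kermx (B *m Q')^T)%MS.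
    apply/sub_kermxP/trmx_inj; by rewrite trmx_mul !trmxK trmx0.
  have K2 : (N' - N <= kermx (B *m Q')^T)%MS.
    apply/sub_kermxP/trmx_inj; rewrite trmx_mul !trmxK trmx0 linearB /= mulmxBr.
    by rewrite BN BN' subrr.
  have rB : \rank B = h by apply/eqP.
  have rk : \rank (kermx (B *m Q')^T) = h.
    by rewrite mxrank_ker mxrank_tr (eqP BQfree) addnK.
  have := mxrank_leqif_sup K1; rewrite rB rk => -[_ /esym]; rewrite eqxx => KB.
  have /submxP[Y YE] := submx_trans K2 KB.
  by exists Y; rewrite -YE addrC subrK.
have detN : \det (col_mx B N') = \det P.
  have -> : col_mx B N' = block_mx 1%:M 0 Y 1%:M *m P.
    by rewrite /P -[block_mx _ _ _ _]/(col_mx (row_mx _ _) (row_mx _ _)) mul_col_mx !mul_row_col YE !mul1mx mul0mx addr0 addrC.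
  by rewrite det_mulmx det_lblock !det1 !mul1r.
by rewrite -det_map_mx phiP col_permE det_mulmx det_perm odd_permV mulrC detN.
Qed.
End LagrangianDeterminant.

(** * The Frobenius endomorphisms over the finite field *)

Definition frob (F : finFieldType) (L : closedFieldType)
  (iota : {rmorphism F -> L}) (k : nat) (x : L) : L := x ^+ (#|F| ^ k).

Section Frobenius.
Variables (F : finFieldType) (L : closedFieldType) (iota : {rmorphism F -> L}).

Local Notation q := #|F|.

Local Notation frob := (frob iota).

Lemma card_gt0_field k : (0 < q ^ k)%N.
Proof. by rewrite expn_gt0 (ltnW (finNzRing_gt1 F)). Qed.

Lemma pchar_nat_card k : [pchar L].-nat (q ^ k)%N.
Proof.
have [p p_pr pF] := finPcharP F.
rewrite (eq_pnat _ (fmorph_pchar iota)) (eq_pnat _ (pcharf_eq pF)) pnatX.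
have /abelem_pgroup := fin_ring_pchar_abelem pF.
by rewrite /pgroup cardsT => ->.
Qed.

Fact frob_is_zmod_morphism k : zmod_morphism (frob k).
Proof.
move=> x y; rewrite /frob exprDn_pchar ?pchar_nat_card //.
congr (_ + _); apply/eqP; rewrite -subr_eq0 opprK addrC.
by rewrite -exprDn_pchar ?pchar_nat_card // subrr expr0n eqn0Ngt card_gt0_field.
Qed.

Fact frob_is_monoid_morphism k : monoid_morphism (frob k).
Proof. by split=> [|x y]; rewrite /frob ?expr1n ?exprMn. Qed.

HB.instance Definition _ k :=
  GRing.isZmodMorphism.Build L L (frob k) (frob_is_zmod_morphism k).
HB.instance Definition _ k :=
  GRing.isMonoidMorphism.Build L L (frob k) (frob_is_monoid_morphism k).

Lemma frobD k l x : frob (k + l) x = frob k (frob l x).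
Proof. by rewrite /frob -exprM -expnD addnC. Qed.

Lemma frob0 x : frob 0 x = x.
Proof. by rewrite /frob expr1. Qed.

Lemma frob_iota k a : frob k (iota a) = iota a.
Proof.
elim: k => [|k IH]; first exact: frob0.
by rewrite -addn1 frobD /frob expn1 -rmorphXn expf_card.
Qed.

(** Over F the polynomial X^q - X is the product of all X - a, so its roots in L come from F. *)
Lemma frob_fixed_base x : frob 1 x = x -> exists a, x = iota a.
Proof.
move=> xq; have /(congr1 (map_poly iota)) := finField_genPoly F.
rewrite rmorphB /= map_polyXn map_polyX rmorph_prod => /(congr1 (fun r : {poly L} => r.[x])).
rewrite hornerD hornerN hornerXn hornerX -[x ^+ _]/(x ^+ (q ^ 1)) -/(frob 1 x) xq subrr.
rewrite horner_prod => /esym/eqP/prodf_eq0 [a _].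
by rewrite rmorphB /= map_polyX map_polyC hornerXsubC subr_eq0 => /eqP ->; exists a.
Qed.

Lemma natr_card_eq0 k : (0 < k)%N -> (q ^ k)%:R = 0 :> L.
Proof.
move=> k0; have [p p_pr pF] := finPcharP F.
have pL : p \in [pchar L] by rewrite (fmorph_pchar iota).
apply/eqP; rewrite -(dvdn_pcharf pL).
have : p.-nat (q ^ k)%N by rewrite -(eq_pnat _ (pcharf_eq pL)) pchar_nat_card.
case/p_natP=> [[|e] qE]; last by rewrite qE expnS dvdn_mulr.
have : (1 < q ^ k)%N by rewrite -(exp1n k) ltn_exp2r // finNzRing_gt1.
by rewrite qE.
Qed.

Lemma fixed_by_frob k : (0 < k)%N -> exists s : seq L,
  [/\ uniq s, size s = (q ^ k)%N & forall a, (a \in s) = (frob k a == a)].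
Proof.
move=> k0; set Q := (q ^ k)%N.
have Q1 : (1 < Q)%N by rewrite -(exp1n k) ltn_exp2r // finNzRing_gt1.
have [s sP] := closed_field_poly_normal ('X^Q - 'X : {poly L}).
have sz : size ('X^Q - 'X : {poly L}) = Q.+1.
  by rewrite size_polyDl size_polyXn // size_polyN size_polyX.
have lc : lead_coef ('X^Q - 'X : {poly L}) = 1.
  by rewrite lead_coefDl ?lead_coefXn // size_polyXn size_polyN size_polyX.
rewrite lc scale1r in sP; exists s; split=> [||a].
- rewrite -separable_prod_XsubC -sP unlock derivB derivXn derivX.
  have -> : 'X^(Q.-1) *+ Q = 0 :> {poly L}.
    by apply/polyP => i; rewrite coefMn coef0 -mulr_natr natr_card_eq0 ?mulr0.
  by rewrite sub0r -[X in coprimep _ X]scaleN1r coprimepZr ?oppr_eq0 ?oner_eq0 // coprimep1.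
- by apply: succn_inj; rewrite -sz sP size_prod_XsubC.
- rewrite -root_prod_XsubC -sP /root hornerD hornerN hornerXn hornerX.
  by rewrite subr_eq0.
Qed.

Lemma gevalE n (x : 'rV[L]_n.+1) g :
  geval iota x g = (map_mpoly iota g).@[fun i => x 0 i].
Proof.
elim/mpoly_algebra_ind: g => [a|i|g h Hg Hh|g h Hg Hh].
- by rewrite /geval mmapC map_mpolyC mevalC.
- by rewrite /geval mmapX mmap1U map_mpolyX mevalXU.
- by rewrite rmorphD /= mevalD -Hg -Hh /geval mmapD.
- by rewrite rmorphM /= mevalM -Hg -Hh /geval rmorphM.
Qed.

Lemma mderiv_map_mpoly n i (g : {mpoly F[n]}) :
  (map_mpoly iota g)^`M(i) = map_mpoly iota (g^`M(i)).
Proof.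
by apply/mpolyP => m; rewrite mcoeff_mderiv !mcoeff_map_mpoly mcoeff_mderiv raddfMn.
Qed.

Lemma geval_morph n (sigma : {rmorphism L -> L}) (x : 'rV[L]_n.+1) g :
  (forall a, sigma (iota a) = iota a) ->
  geval iota (map_mx sigma x) g = sigma (geval iota x g).
Proof.
move=> si; elim/mpoly_algebra_ind: g => [a|i|g h Hg Hh|g h Hg Hh].
- by rewrite /geval !mmapC si.
- by rewrite /geval !mmapX !mmap1U mxE.
- by rewrite /geval !mmapD [sigma (_ + _)]rmorphD; congr (_ + _).
- by rewrite /geval !rmorphM /=; congr (_ * _).
Qed.

End Frobenius.

Section NormalizedMorphism.
Variables (n : nat) (L : closedFieldType) (sigma : {rmorphism L -> L}).
Implicit Types (x : 'rV[L]_n.+1).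

Lemma lead_morph x : lead (map_mx sigma x) = lead x.
Proof.
congr odflt; apply: eq_pick => l /=; rewrite mxE fmorph_eq1; congr (_ && _).
by apply: eq_forallb => j; rewrite mxE fmorph_eq0.
Qed.

Lemma normalized_morph x : normalized (map_mx sigma x) = normalized x.
Proof.
rewrite /normalized lead_morph mxE fmorph_eq1; congr (_ && _).
by apply: eq_forallb => j; rewrite mxE fmorph_eq0.
Qed.

End NormalizedMorphism.

(** * Frobenius and closed points *)

Section GaloisAction.
Variables (F : finFieldType) (L : closedFieldType) (iota : {rmorphism F -> L}).
Variables (n : nat) (f : 'I_n -> {mpoly F[n.+1]}).

Local Notation q := #|F|.
Local Notation frob := (frob iota).

Definition base_change i := map_mpoly iota (f i).

Lemma common_zero_geval x :
  common_zero base_change x <-> forall i, geval iota x (f i) = 0.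
Proof. by split=> H i; have := H i; rewrite gevalE. Qed.

Lemma common_zero_morph (sigma : {rmorphism L -> L}) x :
  (forall a, sigma (iota a) = iota a) ->
  common_zero base_change x -> common_zero base_change (map_mx sigma x).
Proof.
move=> si /common_zero_geval x0; apply/common_zero_geval => i.
by rewrite geval_morph // x0 rmorph0.
Qed.

Lemma lambda_morph (sigma : {rmorphism L -> L}) x :
  (forall a, sigma (iota a) = iota a) ->
  lambda base_change (map_mx sigma x) = sigma (lambda base_change x).
Proof.
move=> si; rewrite /lambda lead_morph /bordered_jac -det_map_mx; congr (\det _).
apply/matrixP => i j; rewrite [RHS]mxE; case: (unliftP ord0 i) => [k ->|->].
  by rewrite !jac_slice mderiv_map_mpoly -!gevalE geval_morph.
by rewrite !jac_slice0 mxE rmorph_nat.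
Qed.

Variables (c : nat) (X : 'I_c -> 'rV[L]_n.+1).
Hypothesis X_inj : injective X.
Hypothesis XP : forall x,
  common_zero base_change x /\ normalized x <-> exists b, x = X b.

Lemma enumerated_common_zero b : common_zero base_change (X b).
Proof. by apply: proj1 (proj2 (XP _) _); exists b. Qed.

Lemma enumerated_normalized b : normalized (X b).
Proof. by apply: proj2 (proj2 (XP _) _); exists b. Qed.

Lemma morph_enumerated (sigma : {rmorphism L -> L}) b :
  (forall a, sigma (iota a) = iota a) -> exists b', map_mx sigma (X b) = X b'.
Proof.
move=> si; apply/XP; rewrite normalized_morph enumerated_normalized; split=> //.
exact/common_zero_morph/enumerated_common_zero.
Qed.

Lemma frobenius_permutation : exists pi : 'S_c,
  forall b, map_mx (frob 1) (X b) = X (pi b).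
Proof.
have /choice[p pP] b : exists b', map_mx (frob 1) (X b) = X b'.
  exact: (morph_enumerated _ (frob_iota iota 1)).
have p_inj : injective p.
  move=> b b' e; apply: X_inj; apply/rowP => j.
  have /rowP/(_ j) : map_mx (frob 1) (X b) = map_mx (frob 1) (X b') by rewrite !pP e.
  by rewrite !mxE => /fmorph_inj.
by exists (perm p_inj) => b; rewrite permE.
Qed.

Variable pi : 'S_c.
Hypothesis piP : forall b, map_mx (frob 1) (X b) = X (pi b).

Lemma frobenius_iterate k b : map_mx (frob k) (X b) = X ((pi ^+ k)%g b).
Proof.
elim: k => [|k IH]; first by rewrite expg0 perm1; apply/rowP => j; rewrite mxE frob0.
rewrite expgSr permM -piP -IH; apply/rowP => j.
by rewrite !mxE -frobD add1n.
Qed.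

Variable t : nat.
Hypothesis rank_t : \rank (form_mx t X) = c.

(* A Frobenius-equivariant function on the common zeros is the evaluation of  *)
(* a form with coefficients in F: its coordinates in a basis of evaluations   *)
(* of monomials are fixed by Frobenius.                                       *)
Lemma equivariant_interpolation (w : 'I_c -> L) :
    (forall b, frob 1 (w b) = w (pi b)) ->
  exists2 g : {mpoly F[n.+1]}, g \is t.-homog & forall b, geval iota (X b) g = w b.
Proof.
move=> wE; pose E := form_mx t X.
have [mf Bfree] : exists mf : 'I_c -> 'I_(#|{: 'X_{1..n.+1 < t.+1}}|), row_free (rowsub mf E).
  have := maxrowsub_free E; move: (maxrankfun E : 'I_(\rank E) -> _).
  by rewrite rank_t => mf; exists mf.
set B := rowsub mf E in Bfree; have Bu : B \in unitmx by rewrite -row_free_unit.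
have Bphi : map_mx (frob 1) B = col_perm pi B.
  apply/matrixP => i j; rewrite !mxE -piP; case: ifP => _; last exact: rmorph0.
  by rewrite !mevalX rmorph_prod; apply: eq_bigr => l _; rewrite mxE rmorphXn.
pose wr := \row_b w b; pose v := wr *m invmx B.
have vphi : map_mx (frob 1) v = v.
  have wphi : map_mx (frob 1) wr = col_perm pi wr by apply/rowP => b; rewrite !mxE wE.
  have vB : v *m B = wr by rewrite mulmxKV.
  have Pu : (perm_mx pi^-1 : 'M[L]_c) \in unitmx by rewrite unitmx_perm.
  have := congr1 (map_mx (frob 1)) vB; rewrite map_mxM Bphi wphi !col_permE mulmxA.
  move/(can_inj (mulmxK Pu)) => vB'.
  by rewrite {2}/v -vB' mulmxK.
have /choice[v0 v0P] k : exists a, v 0 k = iota a.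
  by apply: frob_fixed_base; have /rowP/(_ k) := vphi; rewrite mxE.
pose m k : 'X_{1..n.+1} := (enum_val (mf k) : 'X_{1..n.+1 < t.+1}).
exists (\sum_(k | mdeg (m k) == t) v0 k *: 'X_[m k]).
  by apply: rpred_sum => k mk; apply: dhomogZ; rewrite dhomogX.
move=> b; rewrite gevalE (raddf_sum (map_mpoly iota)) (raddf_sum (meval _)) /=.
transitivity ((v *m B) 0 b); last by rewrite mulmxKV // mxE.
rewrite mxE [LHS]big_mkcond; apply: eq_bigr => k _ /=.
have -> : B k b = if mdeg (m k) == t then ('X_[m k]).@[fun i => X b 0 i] else 0.
  by rewrite !mxE.
rewrite v0P; case: ifP => _; last by rewrite mulr0.
by rewrite map_mpolyZ map_mpolyX mevalZ.
Qed.

(** Propagate a along the orbit by w(pi^k b) = [frob k a], which the hypothesis makes well defined,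
    and put 0 elsewhere. *)
Lemma orbit_function b a : (forall k, (pi ^+ k)%g b = b -> frob k a = a) ->
  exists2 w : 'I_c -> L, w b = a & forall j, frob 1 (w j) = w (pi j).
Proof.
move=> aP.
have /choice[e eP] (j : 'I_c) : exists k, j \in porbit pi b -> j = (pi ^+ k)%g b.
  have [/porbitP[k ->]|_] := boolP (j \in porbit pi b); last by exists 0%N.
  by exists k.
have eqf k l : (pi ^+ k)%g b = (pi ^+ l)%g b -> frob k a = frob l a.
  wlog kl : k l / (k <= l)%N => [H e0|].
    by case/orP: (leq_total k l) => kl; [apply: H|apply/esym/H].
  move=> e0; have e1 : (pi ^+ (l - k))%g b = b.
    by apply: (@perm_inj _ (pi ^+ k)%g); rewrite -permM -expgD subnK // e0.
  by rewrite -(subnKC kl) frobD (aP _ e1).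
exists (fun j => if j \in porbit pi b then frob (e j) a else 0) => [|j].
  rewrite porbit_id -[RHS](frob0 iota); apply: eqf.
  by rewrite expg0 perm1 -eP ?porbit_id.
have -> : (pi j \in porbit pi b) = (j \in porbit pi b).
  by rewrite -!eq_porbit_mem; congr (_ == _); rewrite (porbit_perm pi 1 j).
case: ifP => jb; last exact: rmorph0.
have e1 := eP j jb; have e2 : pi j = (pi ^+ e (pi j))%g b.
  apply: eP; have /porbitP[k ->] := jb; apply/porbitP; exists k.+1.
  by rewrite expgSr permM.
by rewrite -frobD; apply: eqf; rewrite -e2 add1n expgSr permM -e1.
Qed.

(** The converse direction extends a to an equivariant function, which is given by a form of degree
    t over F. Its quotient by the t-th power of the leading variable, equal to 1 at X b, is the
    required fraction. *)
Lemma in_residueP b a :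
  in_residue iota (X b) a <-> forall k, (pi ^+ k)%g b = b -> frob k a = a.
Proof.
split=> [[e [g [h [_ _ h0 ->]]]] k kb|aP].
  have Xk : map_mx (frob k) (X b) = X b by rewrite frobenius_iterate kb.
  rewrite fmorph_div -!(geval_morph _ _ (frob_iota iota k)).
  by rewrite /= Xk.
have [w <- wE] := orbit_function aP.
have [g gh gE] := equivariant_interpolation wE.
exists t, g, ('X_(lead (X b)) ^+ t); split=> //.
- rewrite -[t in t.-homog]mul1n; apply: dhomogMn.
  by rewrite dhomogX /= mdeg1.
- rewrite gevalE rmorphXn /= map_mpolyX rmorphXn /= mevalXU.
  by rewrite normalized_lead ?enumerated_normalized // expr1n oner_eq0.
- rewrite gE [X in _ / X]gevalE rmorphXn /= map_mpolyX rmorphXn /= mevalXU.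
  by rewrite normalized_lead ?enumerated_normalized // expr1n divr1.
Qed.

(** The indicator function of a Frobenius orbit is equivariant, hence given by a form over F, whose
    value 1 at X b is preserved by sigma. *)
Lemma morph_in_orbit (sigma : {rmorphism L -> L}) b b' :
  (forall a, sigma (iota a) = iota a) -> map_mx sigma (X b) = X b' ->
  b' \in porbit pi b.
Proof.
move=> si e; apply: contraT => b'b.
have wE j : frob 1 (j \in porbit pi b)%:R = (pi j \in porbit pi b)%:R.
  rewrite rmorph_nat; congr (_ %:R); congr nat_of_bool.
  by rewrite -!eq_porbit_mem; congr (_ == _); rewrite (porbit_perm pi 1 j).
have [g _ gE] := equivariant_interpolation wE.
have := geval_morph (X b) g si; rewrite e !gE porbit_id (negPf b'b) rmorph1.
by move/eqP; rewrite eq_sym oner_eq0.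
Qed.

End GaloisAction.

(** * Chart Jacobians as bordered determinants *)

Section ChartJacobian.
Variables (F : finFieldType) (L : closedFieldType) (iota : {rmorphism F -> L}).
Variables (n : nat) (f : 'I_n -> {mpoly F[n.+1]}) (l : 'I_n.+1) (x : 'rV[L]_n.+1).
Hypothesis xl : x 0 l != 0.

Let y := (x 0 l)^-1 *: x.
Let chart_pt (k : 'I_n) : L := chart_sign l (lift l k) * (x 0 (lift l k) / x 0 l).

Lemma val_chart_sign j : val (chart_sign l j : residue_field iota x) = chart_sign l j.
Proof. by rewrite /chart_sign; case: ifP => _; rewrite ?rmorphXn ?rmorphN ?rmorph1. Qed.

Lemma val_eval_chart g : val (eval_chart iota l x g) = (map_mpoly iota g).@[chart_pt].
Proof.
rewrite /eval_chart; elim/mpoly_algebra_ind: g => [a|i|g h Hg Hh|g h Hg Hh].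
- by rewrite mmapC map_mpolyC mevalC.
- by rewrite mmapX mmap1U map_mpolyX mevalXU /chart rmorphM /= val_chart_sign.
- by rewrite mmapD !rmorphD /= Hg Hh.
- by rewrite !rmorphM /= Hg Hh.
Qed.

Lemma chart_sign_sqr j : chart_sign l j * chart_sign l j = 1 :> L.
Proof. by rewrite /chart_sign; case: ifP => _; rewrite ?mulr1 // -expr2 sqrr_sign. Qed.

Lemma chart_signE j : chart_sign l j = iota (chart_sign l j).
Proof. by rewrite /chart_sign; case: ifP => _; rewrite ?rmorphXn ?rmorphN rmorph1. Qed.

Lemma dehomogE j : dehomog l ('X_j : {mpoly F[n.+1]}) = chart_subst F l j.
Proof. by rewrite /dehomog comp_mpolyXU -tnth_nth tnth_mktuple. Qed.

Lemma eval_dehomog (g : {mpoly F[n.+1]}) :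
  (map_mpoly iota (dehomog l g)).@[chart_pt] = geval iota y g /\
  forall k, (map_mpoly iota (dehomog l g)^`M(k)).@[chart_pt] =
    chart_sign l (lift l k) * geval iota y (g^`M(lift l k)).
Proof.
elim/mpoly_algebra_ind: g => [a|j|g h [Hg Dg] [Hh Dh]|g h [Hg Dg] [Hh Dh]].
- rewrite /dehomog comp_mpolyC /geval mmapC map_mpolyC mevalC; split=> // k.
  by rewrite !mderivC rmorph0 meval0 mmap0 mulr0.
- rewrite dehomogE /chart_subst /geval mmapX mmap1U mxE.
  case: (unliftP l j) => [k ->|->] /=; last first.
    rewrite rmorph1 meval1 mulVf //; split=> // k'.
    rewrite -mpolyC1 mderivC rmorph0 meval0 mderivX mnm1E.
    by rewrite (negPf (neq_lift l k')) scale0r mmap0 mulr0.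
  have signC : chart_sign l (lift l k) = (chart_sign l (lift l k) : F)%:MP :> {mpoly F[n]}.
    by rewrite /chart_sign; case: ifP => _; rewrite ?mpolyC1 // rmorphXn rmorphN1.
  rewrite signC mul_mpolyC map_mpolyZ map_mpolyX mevalZ mevalXU -chart_signE.
  rewrite /chart_pt mulrA chart_sign_sqr mul1r mulrC; split=> // k'.
  rewrite mderivZ map_mpolyZ mevalZ -chart_signE !mderivX !mnm1E (inj_eq (@lift_inj _ l)).
  case: eqP => [->|_]; last by rewrite !scale0r rmorph0 meval0 mmap0 !mulr0.
  rewrite !scale1r.
  have subU m (i : 'I_m) : (U_(i) - U_(i) = 0)%MM.
    by apply/mnmP => i'; rewrite mnmBE subnn mnm0E.
  by rewrite !subU !mpolyX0 !rmorph1 ?meval1.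
- have dD : dehomog l (g + h) = dehomog l g + dehomog l h by exact: comp_mpolyD.
  have gD u v : geval iota y (u + v) = geval iota y u + geval iota y v by exact: mmapD.
  have eD u v : (map_mpoly iota (u + v)).@[chart_pt] =
      (map_mpoly iota u).@[chart_pt] + (map_mpoly iota v).@[chart_pt].
    by rewrite rmorphD mevalD.
  rewrite dD (gD g h); move: (dehomog l g) (dehomog l h) Hg Dg Hh Dh => G H HG DG HH DH.
  rewrite eD HG HH; split=> // k; rewrite mderivD eD DG DH.
  by rewrite (mderivD (lift l k) g) (gD (g^`M(lift l k))) mulrDr.
- have dM : dehomog l (g * h) = dehomog l g * dehomog l h by exact: rmorphM.
  have gM u v : geval iota y (u * v) = geval iota y u * geval iota y v by exact: rmorphM.
  have gD u v : geval iota y (u + v) = geval iota y u + geval iota y v by exact: mmapD.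
  have eM u v : (map_mpoly iota (u * v)).@[chart_pt] =
      (map_mpoly iota u).@[chart_pt] * (map_mpoly iota v).@[chart_pt].
    by rewrite rmorphM mevalM.
  have eD u v : (map_mpoly iota (u + v)).@[chart_pt] =
      (map_mpoly iota u).@[chart_pt] + (map_mpoly iota v).@[chart_pt].
    by rewrite rmorphD mevalD.
  rewrite dM (gM g h); move: (dehomog l g) (dehomog l h) Hg Dg Hh Dh => G H HG DG HH DH.
  rewrite eM HG HH; split=> // k; rewrite mderivM eD !eM DG DH HG HH.
  rewrite (mderivM (lift l k) g) (gD (g^`M(lift l k) * h)).
  by rewrite (gM (g^`M(lift l k))) (gM g) mulrDr; congr (_ + _); rewrite ?mulrA // [X in X * _]mulrC.
Qed.

Lemma prod_chart_sign : \prod_(k < n) chart_sign l (lift l k) = (-1) ^+ l :> L.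
Proof.
case: (unliftP l ord0) => [k kE|<-]; last first.
  by rewrite expr0 big1 // => k _; rewrite /chart_sign -[_ == ord0]negbK eq_sym neq_lift.
rewrite (bigD1 k) //= -kE /chart_sign eqxx big1 ?mulr1 // => k' kk'.
by rewrite {1}kE (inj_eq (@lift_inj _ l)) (negPf kk').
Qed.

(** Expanding along the row bordering by x_l leaves a cofactor of sign (-1)^l. The signs in the
    chart multiply to (-1)^l as well, so the convention for charts removes any sign between the two
    sides. *)
Lemma val_jacobian :
  val (eval_chart iota l x (jacobian l f)) = bordered_jac (base_change iota f) (delta_mx 0 l) y.
Proof.
rewrite val_eval_chart /jacobian -det_map_mx -(det_map_mx (meval chart_pt)).
rewrite /bordered_jac (expand_det_row _ ord0) (bigD1 l) //= big1 => [|j jl]; last first.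
  by rewrite jac_slice0 mxE (negPf jl) andbF mul0r.
rewrite addr0 jac_slice0 mxE !eqxx mul1r /cofactor add0n -prod_chart_sign.
set A := row' _ _.
have -> : map_mx (meval chart_pt) (map_mx (map_mpoly iota) (jacobian_mx l f)) =
    A *m diag_mx (\row_k chart_sign l (lift l k)).
  apply/matrixP => i k; rewrite mul_mx_diag !mxE (proj2 (eval_dehomog (f i))) mulrC.
  by rewrite /slice liftK mderiv_map_mpoly -gevalE.
rewrite det_mulmx det_diag mulrC; congr (_ * _).
by apply: eq_bigr => k _; rewrite mxE.
Qed.

(** Smoothness makes each tangent space of codimension 1, so transversality makes their intersection
    zero. A singular Jacobian matrix would give a nonzero vector in it. *)
Lemma transverse_jacobian_neq0 : (0 < n)%N -> transverse_at iota f x ->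
  eval_chart iota l x (jacobian l f) != 0.
Proof.
move=> n0 /(_ l xl)[sm cod].
have evdet : eval_chart iota l x (jacobian l f) =
    \det (\matrix_(i < n, k < n) gradient iota l x (f i) k 0).
  rewrite /eval_chart /jacobian -det_map_mx; congr (\det _).
  by apply/matrixP => i k; rewrite !mxE.
rewrite evdet -det_tr; apply/negP => /det0P[v v0 vA].
have cod1 i : codim (tangent iota l x (f i)) = 1%N.
  rewrite /codim /tangent mxrank_ker.
  have -> : \rank (gradient iota l x (f i)) = 1%N.
    apply/eqP; rewrite eqn_leq rank_leq_col lt0n mxrank_eq0; exact: sm.
  by rewrite subKn.
move: cod; rewrite (eq_bigr _ (fun i _ => cod1 i)) sum1_card card_ord /codim => codn.
have : (v <= \bigcap_i tangent iota l x (f i))%MS.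
  apply/sub_bigcapmxP => i _; apply/sub_kermxP/matrixP => a b; rewrite !ord1 [RHS]mxE.
  have /rowP/(_ i) := vA; rewrite mxE [RHS]mxE => <-; rewrite mxE.
  by apply: eq_bigr => k _; rewrite !mxE.
have -> : (\bigcap_i tangent iota l x (f i))%MS = 0.
  apply/eqP; rewrite -mxrank_eq0 eqn0Ngt; apply/negP => r0.
  have : (n - \rank (\bigcap_i tangent iota l x (f i))%MS < n)%N by rewrite ltn_subrL r0.
  by rewrite codn ltnn.
by rewrite submx0 (negPf v0).
Qed.

End ChartJacobian.

(** * Finite cardinals and orbits of permutations *)

Lemma card_eq_fin (I : finType) (S : {set I}) (T : Type) (g : I -> T) (A : set T) :
    {in S &, injective g} -> (forall x, A x <-> exists2 i, i \in S & g i = x) ->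
  (A #= `I_#|S|)%card.
Proof.
move=> ginj AE; have -> : A = [set g i | i in [set` S]]%classic.
  by apply/seteqP; split=> x /AE.
apply: (card_eq_trans (inj_card_eq _)); first by move=> i j /set_mem iS /set_mem; apply: ginj.
rewrite card_eq_sym; have -> : (`I_#|S| = [set index i (enum S) | i in [set` S]])%classic.
  apply/seteqP; split=> [k /= kS|k [i /= iS <-]]; last by rewrite cardE index_mem mem_enum.
  have [i0 _] : exists i0, i0 \in S by apply/card_gt0P; apply: leq_ltn_trans kS.
  rewrite cardE in kS; exists (nth i0 (enum S) k); first by rewrite /= -mem_enum mem_nth.
  by rewrite index_uniq ?enum_uniq.
apply: inj_card_eq => i j /set_mem /= iS /set_mem /= jS.
by apply: (index_inj i); rewrite mem_enum.
Qed.

Section PermutationOrbits.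
Variables (T : finType) (s : {perm T}).

Lemma porbit_fixed x k : (s ^+ k)%g x = x <-> (#|porbit s x| %| k)%N.
Proof.
set b := #|porbit s x|; have sb : (s ^+ b)%g x = x by rewrite permX iter_porbit.
have sbm m : (s ^+ (b * m))%g x = x.
  by elim: m => [|m IH]; rewrite ?muln0 ?expg0 ?perm1 // mulnS expgD permM sb.
have b0 : (0 < b)%N by apply/card_gt0P; exists x; apply: porbit_id.
split=> [sk|/dvdnP[m ->]]; last by rewrite mulnC sbm.
have sr : (s ^+ (k %% b))%g x = x.
  by move: sk; rewrite {1}(divn_eq k b) mulnC expgD permM sbm.
apply: contraT; rewrite /dvdn -lt0n => r0.
have := uniq_traject_porbit s x; rewrite -/b => /uniqP U.
have rb : (k %% b < b)%N by rewrite ltn_mod.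
have := U x (k %% b)%N 0%N; rewrite !inE size_traject => /(_ rb b0).
rewrite !nth_traject //= -permX sr => /(_ erefl) e.
by rewrite e in r0.
Qed.

Lemma porbit_prod (R : comNzRingType) (la : T -> R) x :
  \prod_(y in porbit s x) la y = \prod_(k < #|porbit s x|) la ((s ^+ k)%g x).
Proof.
rewrite (eq_bigl _ _ (porbit_traject s x)) -big_uniq ?uniq_traject_porbit //=.
rewrite (big_nth x) size_traject big_mkord; apply: eq_bigr => k _.
by rewrite nth_traject // permX.
Qed.

(** A cycle of length b has sign (-1)^(b-1); b + 1 has the same parity. *)
Lemma sign_perm_porbits (R : comNzRingType) :
  (-1) ^+ s = \prod_(O in porbits s) (-1) ^+ (#|O|).+1 :> R.
Proof.
have cE : #|T| = (\sum_(O in porbits s) #|O|)%N.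
  rewrite -sum1_card (partition_big (porbit s) (mem (porbits s))) => [|x _] /=.
    apply: eq_bigr => O /imsetP[y _ ->]; rewrite -sum1_card; apply: eq_bigl => x.
    by rewrite eq_porbit_mem.
  exact: imset_f.
rewrite prodrXr /odd_perm -oddD signr_odd; congr (_ ^+ _).
rewrite cE -sum1_card -big_split /=; apply: eq_bigr => O _.
by rewrite addn1.
Qed.

End PermutationOrbits.

(** The dimension enters as an equation, as the number of common zeros is not syntactically a sum h
    + h. *)
Lemma lagrangian_sign (K : fieldType) (phi : {rmorphism K -> K}) c h r (E : 'M[K]_(r, c))
    (la : 'I_c -> K) (pi : 'S_c) : c = (h + h)%N ->
    \rank E = h -> (forall b, la b != 0) ->
    kermx E^T *m diag_mx (\row_b la b) *m (kermx E^T)^T = 0 ->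
    map_mx phi E = col_perm pi E -> (forall b, phi (la b) = la (pi b)) ->
  exists rho, [/\ rho != 0, rho ^+ 2 = (-1) ^+ h * \prod_b la b &
                  phi rho = (-1) ^+ pi * rho].
Proof.
by move=> e; subst c; apply: lagrangian_determinant.
Qed.

(** * Closed points as Frobenius orbits, and their signs *)

Section ClosedPoints.
Variables (F : finFieldType) (L : closedFieldType) (iota : {rmorphism F -> L}).
Variables (n : nat) (f : 'I_n -> {mpoly F[n.+1]}) (d : 'I_n -> nat).
Hypothesis n0 : (0 < n)%N.
Hypothesis d0 : forall i, (0 < d i)%N.
Hypothesis fh : forall i, f i \is (d i).-homog.
Hypothesis ftrans : forall x, common_point iota f x -> transverse_at iota f x.
Variable s : nat.
Hypothesis sE : (\sum_i (d i).-1 = s.*2.+1)%N.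
Hypothesis oddF : odd #|F|.

Local Notation q := #|F|.
Local Notation frob := (frob iota).
Local Notation fL := (base_change iota f).

Lemma base_change_homog i : fL i \is (d i).-homog.
Proof.
have /homog_supp fi := fh i; apply/homog_supp => m mi.
by rewrite mcoeff_map_mpoly (fi m mi) raddf0.
Qed.

Lemma common_zero_point x : x != 0 -> common_zero fL x -> common_point iota f x.
Proof. by move=> x0 /common_zero_geval. Qed.

Lemma base_change_transversal x l : common_zero fL x -> x 0 l = 1 ->
  bordered_jac fL (delta_mx 0 l) x != 0.
Proof.
move=> x0 xl; have xl0 : x 0 l != 0 by rewrite xl oner_eq0.
have xn0 : x != 0 by apply: contraNneq xl0 => ->; rewrite mxE.
have := transverse_jacobian_neq0 xl0 n0 (ftrans (common_zero_point xn0 x0)).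
rewrite -(fmorph_eq0 (val : residue_field iota x -> L)) /= val_jacobian //.
by rewrite xl invr1 scale1r.
Qed.

Variables (c : nat) (X : 'I_c -> 'rV[L]_n.+1) (pi : 'S_c).
Hypothesis X_inj : injective X.
Hypothesis XP : forall x, common_zero fL x /\ normalized x <-> exists b, x = X b.
Hypothesis piP : forall b, map_mx (frob 1) (X b) = X (pi b).
Hypothesis rank_t : \rank (form_mx s.*2.+1 X) = c.

Let la b := lambda fL (X b).
Let blen i := #|porbit pi i|.

Lemma geval_scale e (g : {mpoly F[n.+1]}) (k : L) (x : 'rV[L]_n.+1) : g \is e.-homog ->
  geval iota (k *: x) g = k ^+ e * geval iota x g.
Proof.
move=> ge; rewrite !gevalE; apply: meval_homog_scale.
move/homog_supp: ge => ge; apply/homog_supp => m mi.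
by rewrite mcoeff_map_mpoly (ge m mi) raddf0.
Qed.

Lemma in_residue_scale (k : L) (x : 'rV[L]_n.+1) a : k != 0 -> in_residue iota (k *: x) a <-> in_residue iota x a.
Proof.
move=> k0; split=> -[e [g [h [gh hh h0 ->]]]]; exists e, g, h; split=> //.
- by move: h0; rewrite (geval_scale _ _ hh) mulf_eq0 negb_or => /andP[].
- by rewrite (geval_scale _ _ hh) (geval_scale _ _ gh) -mulf_div divff ?mul1r ?expf_neq0.
- by rewrite (geval_scale _ _ hh) mulf_neq0 ?expf_neq0.
- by rewrite (geval_scale _ _ hh) (geval_scale _ _ gh) -mulf_div divff ?mul1r ?expf_neq0.
Qed.

Lemma blen_gt0 i : (0 < blen i)%N.
Proof. by apply/card_gt0P; exists i; apply: porbit_id. Qed.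

Lemma in_residue_frob i (k : L) a : k != 0 ->
  in_residue iota (k *: X i) a <-> frob (blen i) a = a.
Proof.
move=> k0; rewrite in_residue_scale // (in_residueP XP piP rank_t); split=> [|ab m].
  by apply; apply/porbit_fixed.
case/porbit_fixed/dvdnP => m' ->; elim: m' => [|m' IH]; first exact: frob0.
by rewrite mulSn frobD IH.
Qed.

Lemma residue_memP i (k : L) (a : L) : k != 0 ->
  (a \in residue_pred iota (k *: X i)) = (frob (blen i) a == a).
Proof.
move=> k0; apply/asboolP/eqP; by rewrite in_residue_frob.
Qed.

Lemma residue_card i (k : L) : k != 0 ->
  ([set: residue_field iota (k *: X i)] #= `I_(q ^ blen i))%card.
Proof.
move=> k0; have [r [ur sr rP]] := fixed_by_frob iota (blen_gt0 i).
rewrite -sr -[size r]card_ord -cardsT.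
pose g (j : 'I_(size r)) : residue_field iota (k *: X i) := insubd 0 (tnth (in_tuple r) j).
have gE j : val (g j) = tnth (in_tuple r) j.
  by rewrite insubdK // residue_memP // -rP mem_tnth.
apply: (card_eq_fin (g := g)) => [j j' _ _ /(congr1 val)|x].
  by rewrite !gE => /tuple_uniqP; apply.
split=> // _; have xr : val x \in in_tuple r.
  by rewrite /= rP -(residue_memP _ _ k0); exact: valP.
have /tnthP[j jE] := xr; exists j; rewrite ?inE //.
by apply: val_inj; rewrite gE jE.
Qed.

Lemma field_of_definitionE i (k : L) b : k != 0 ->
  field_of_definition iota (k *: X i) b <-> b = blen i.
Proof.
move=> k0; rewrite /field_of_definition; split=> [H|->]; last exact: residue_card.
have := card_eq_trans (etrans (card_eq_sym _ _) (residue_card i k0)) H.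
move/card_eq_II/eqP; rewrite eqn_exp2l ?finNzRing_gt1 // => /eqP ->.
by [].
Qed.

Lemma lambda_neq0 i : la i != 0.
Proof.
apply: base_change_transversal; first exact: (enumerated_common_zero XP).
exact/normalized_lead/(enumerated_normalized XP).
Qed.

Lemma frob_lambda i : frob 1 (la i) = la (pi i).
Proof. by rewrite /la -piP lambda_morph // => a; apply: frob_iota. Qed.

Lemma frob_lambda_iter m i : frob m (la i) = la ((pi ^+ m)%g i).
Proof.
elim: m => [|m IH]; first by rewrite expg0 perm1 frob0.
by rewrite expgSr permM -frob_lambda -IH -frobD add1n.
Qed.

Lemma odd_card_pow k : odd (q ^ k).
Proof. by rewrite oddX oddF orbT. Qed.

Lemma card_pow_half k : (q ^ k).-1 = ((q ^ k).-1./2).*2.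
Proof.
case: (q ^ k)%N (odd_card_pow k) => //= m mo.
by rewrite -[LHS]odd_double_half (negPf mo).
Qed.

Lemma frob_fixed_pow k (a : L) : a != 0 -> (frob k a == a) = (a ^+ (q ^ k).-1 == 1).
Proof.
move=> a0; rewrite /frob -{1}(prednK (card_gt0_field F k)) exprSr.
by rewrite -{3}[a]mul1r (inj_eq (mulIf a0)).
Qed.

(** Euler's criterion for lambda to be a square in the field with q^b elements, b being the length
    of the orbit. *)
Definition square_orbit i := la i ^+ (q ^ blen i).-1./2 == 1.

Lemma lambda_sign i : la i ^+ (q ^ blen i).-1./2 = (-1) ^+ (~~ square_orbit i).
Proof.
rewrite /square_orbit; case: eqP => [-> //|ne]; rewrite expr1.
have : la i ^+ ((q ^ blen i).-1./2).*2 == 1.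
  rewrite -card_pow_half -frob_fixed_pow ?lambda_neq0 // frob_lambda_iter.
  by rewrite (proj2 (porbit_fixed pi i (blen i))).
by rewrite -muln2 exprM sqrf_eq1 => /orP[/eqP //|/eqP //].
Qed.

Lemma square_orbit_const i j : j \in porbit pi i -> square_orbit j = square_orbit i.
Proof.
move=> ji; have bE : blen j = blen i by rewrite /blen; congr #|pred_of_set _|; apply/eqP; rewrite eq_porbit_mem.
have /porbitP[m jE] := ji; rewrite /square_orbit bE jE -frob_lambda_iter.
by rewrite /frob -exprM mulnC exprM -/(frob m _) fmorph_eq1.
Qed.

(** In any chart and for any homogeneous coordinates the Jacobian is u^(2 s) lambda, with u the
    inverse of the l-th coordinate of X i. Since u lies in the residue field, this even power does
    not affect squareness. *)
Lemma jacobian_squareP i (k : L) l : k != 0 -> (k *: X i) 0 l != 0 ->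
  jacobian_square iota f l (k *: X i) <-> square_orbit i.
Proof.
move=> k0 xl; set x := k *: X i in xl *; pose u := (X i 0 l)^-1; pose b := blen i.
have Xl : X i 0 l != 0 by apply: contraNneq xl => e; rewrite mxE e mulr0.
have u0 : u != 0 by rewrite invr_eq0.
have Jval : val (eval_chart iota l x (jacobian l f)) = u ^+ s.*2 * la i.
  rewrite val_jacobian //.
  have -> : (x 0 l)^-1 *: x = u *: X i.
    by rewrite /x mxE scalerA invfM mulrAC mulVf // mul1r.
  rewrite (bordered_jac_scale base_change_homog) sE exprSr -mulrA; congr (_ * _).
  have := bordered_jac_dot base_change_homog (delta_mx 0 l) (delta_mx 0 (lead (X i)))
    (enumerated_common_zero XP i).
  rewrite !dot_delta normalized_lead ?(enumerated_normalized XP) // mulr1 => ->.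
  by rewrite mulrC mulfK.
have u1 : u ^+ (q ^ b).-1 = 1.
  apply/eqP; rewrite -frob_fixed_pow // -(residue_memP _ _ k0).
  apply/asboolP; apply/(in_residue_scale _ _ k0); have := ratio_in_residue iota (X i) (lead (X i)) l.
  by move/asboolP; rewrite normalized_lead ?(enumerated_normalized XP) // mul1r.
have us1 : (u ^+ s.*2) ^+ (q ^ b).-1./2 = 1.
  by rewrite -exprM -muln2 -mulnA mul2n -card_pow_half mulnC exprM u1 expr1n.
have powJ : (u ^+ s.*2 * la i) ^+ (q ^ b).-1./2 = la i ^+ (q ^ b).-1./2.
  by rewrite exprMn us1 mul1r.
have half v : v ^+ (q ^ b).-1 = (v ^+ 2) ^+ (q ^ b).-1./2 :> L.
  by rewrite -exprM mul2n -card_pow_half.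
split=> [[w [w0 wE]]|sq].
  have wb : val w ^+ (q ^ b).-1 = 1.
    apply/eqP; rewrite -frob_fixed_pow ?fmorph_eq0 // -(residue_memP _ _ k0).
    exact: valP.
  rewrite /square_orbit -powJ -Jval wE rmorphXn /= -half.
  exact/eqP.
have [v vE] : exists v, v ^+ 2 = u ^+ s.*2 * la i.
  have /closed_rootP[v] : size ('X^2 - (u ^+ s.*2 * la i)%:P) != 1%N.
    by rewrite size_XnsubC.
  by rewrite /root !hornerE subr_eq0 => /eqP; exists v.
have v0 : v != 0.
  have : v ^+ 2 != 0 by rewrite vE mulf_neq0 ?expf_neq0 ?lambda_neq0.
  by rewrite expf_eq0.
have vK : v \in residue_pred iota x.
  by rewrite residue_memP // frob_fixed_pow // half vE powJ.
exists (exist _ v vK); split; first by apply: contraNneq v0 => /(congr1 val) /= ->.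
by apply: val_inj; rewrite Jval rmorphXn /= vE.
Qed.

(** All homogeneous coordinates of the points of an orbit, to match the representation of closed
    points by [closed_point]. *)
Definition orbit_points (O : {set 'I_c}) : set 'rV[L]_n.+1 :=
  fun z => exists (k : L) j, [/\ k != 0, j \in O & z = k *: X j].

Lemma closed_pointE i (k : L) : k != 0 ->
  closed_point iota (k *: X i) = orbit_points (porbit pi i).
Proof.
move=> k0; apply/seteqP; split=> z.
  move=> [sigma [a [si a0 ->]]]; have [j jE] := morph_enumerated XP i si.
  exists (a * sigma k), j; split; rewrite ?mulf_neq0 ?fmorph_eq0 //.
    exact: (morph_in_orbit piP rank_t si jE).
  by rewrite map_mxZ jE scalerA.
move=> [a [j [a0 /porbitP[m ->] ->]]].
exists (frob m : {rmorphism L -> L}), (a / frob m k); split.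
- by move=> y; apply: frob_iota.
- by rewrite mulf_neq0 ?invr_eq0 ?fmorph_eq0.
- by rewrite map_mxZ (frobenius_iterate piP) scalerA divfK ?fmorph_eq0.
Qed.

Lemma orbit_points_inj : {in porbits pi &, injective orbit_points}.
Proof.
move=> O O' /imsetP[i _ ->] /imsetP[i' _ ->] e; apply/eqP; rewrite eq_porbit_mem.
have : orbit_points (porbit pi i) (X i).
  by exists 1, i; rewrite oner_eq0 porbit_id scale1r.
rewrite e => -[a [j [a0 ji aE]]].
have := enumerated_normalized XP i; rewrite aE.
move/(normalized_scale (enumerated_normalized XP j)) => a1.
by have -> : i = j by apply: X_inj; rewrite aE a1 scale1r.
Qed.

Lemma common_pointP x : common_point iota f x ->
  exists i (k : L), k != 0 /\ x = k *: X i.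
Proof.
move=> [x0 /common_zero_geval xz]; have [k k0 kn] := normalizable x0.
have [i iE] := proj1 (XP _) (conj (common_zeroZ base_change_homog k xz) kn).
by exists i, k^-1; rewrite invr_eq0 -iE scalerA mulVf ?scale1r.
Qed.

Lemma enumerated_common_point i : common_point iota f (1 *: X i).
Proof.
rewrite scale1r; apply: common_zero_point; last exact: (enumerated_common_zero XP).
exact/normalized_neq0/(enumerated_normalized XP).
Qed.

Definition square_orbits (O : {set 'I_c}) := [exists i in O, square_orbit i].

Lemma square_orbitsE i : square_orbits (porbit pi i) = square_orbit i.
Proof.
apply/existsP/idP => [[j /andP[/square_orbit_const -> //]]|sq].
by exists i; rewrite porbit_id.
Qed.

Definition positive_even_orbits :=
  [set O in porbits pi | ~~ odd #|O| && square_orbits O].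
Definition negative_odd_orbits :=
  [set O in porbits pi | odd #|O| && ~~ square_orbits O].

Lemma enumerated_lead i : (1 *: X i) 0 (lead (X i)) != 0.
Proof.
by rewrite scale1r normalized_lead ?oner_eq0 // (enumerated_normalized XP).
Qed.

Lemma card_positive_even :
  (positive_even_points iota f #= `I_#|positive_even_orbits|)%card.
Proof.
apply: (card_eq_fin (g := orbit_points)) => [O O'|p].
  by rewrite !inE => /andP[OP _] /andP[OP' _]; apply: orbit_points_inj.
split=> [[x [b [-> xc xb bodd [_ [l xl sq]]]]]|].
  have [i [k [k0 xE]]] := common_pointP xc; rewrite xE in xb xl sq *.
  exists (porbit pi i); last by rewrite closed_pointE.
  rewrite inE imset_f //= square_orbitsE; move/(field_of_definitionE _ _ k0): xb => bE.
  rewrite -/(blen i) -bE bodd /=; exact/(jacobian_squareP k0 xl).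
case=> O; rewrite inE => /andP[/imsetP[i _ ->] /andP[bodd]]; rewrite square_orbitsE => sq <-.
have one0 : 1 != 0 :> L by rewrite oner_eq0.
exists (1 *: X i), (blen i); split=> //; first by rewrite closed_pointE.
- exact: enumerated_common_point.
- exact/field_of_definitionE.
split; first exact/ftrans/enumerated_common_point.
by exists (lead (X i)); [exact: enumerated_lead|apply/jacobian_squareP => //; exact: enumerated_lead].
Qed.

Lemma card_negative_odd :
  (negative_odd_points iota f #= `I_#|negative_odd_orbits|)%card.
Proof.
apply: (card_eq_fin (g := orbit_points)) => [O O'|p].
  by rewrite !inE => /andP[OP _] /andP[OP' _]; apply: orbit_points_inj.
split=> [[x [b [-> xc xb bodd [_ [l xl sq]]]]]|].
  have [i [k [k0 xE]]] := common_pointP xc; rewrite xE in xb xl sq *.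
  exists (porbit pi i); last by rewrite closed_pointE.
  rewrite inE imset_f //= square_orbitsE; move/(field_of_definitionE _ _ k0): xb => bE.
  rewrite -/(blen i) -bE bodd /=; by apply/negP => /(jacobian_squareP k0 xl).
case=> O; rewrite inE => /andP[/imsetP[i _ ->] /andP[bodd]]; rewrite square_orbitsE => sq <-.
have one0 : 1 != 0 :> L by rewrite oner_eq0.
exists (1 *: X i), (blen i); split=> //; first by rewrite closed_pointE.
- exact: enumerated_common_point.
- exact/field_of_definitionE.
split; first exact/ftrans/enumerated_common_point.
exists (lead (X i)); first exact: enumerated_lead.
by move/(jacobian_squareP one0 (enumerated_lead i)); apply/negP.
Qed.

(** The product over an orbit is the norm lambda^(1 + q + ... + q^(b-1)), and the power (q - 1)/2
    turns the exponent into (q^b - 1)/2. *)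
Lemma orbit_lambda_sign i :
  (\prod_(j in porbit pi i) la j) ^+ q.-1./2 = (-1) ^+ (~~ square_orbit i).
Proof.
rewrite porbit_prod -lambda_sign -/(blen i).
under eq_bigr => k _ do rewrite -frob_lambda_iter.
rewrite /frob prodrXr -exprM; congr (_ ^+ _).
have qE : q.-1 = (q.-1./2).*2 by have := card_pow_half 1; rewrite expn1.
have : ((q ^ blen i).-1./2).*2 = (q.-1./2 * \sum_(k < blen i) q ^ k).*2.
  by rewrite -card_pow_half predn_exp doubleMl -qE.
by move/double_inj => ->; rewrite mulnC.
Qed.

(** An orbit contributes (-1)^(b+1) times the quadratic character of lambda. This is -1 for b even
    with a square and for b odd with a nonsquare. *)
Lemma orbit_sign :
  (-1) ^+ (#|positive_even_orbits| + #|negative_odd_orbits|) =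
  (-1) ^+ pi * (\prod_j la j) ^+ q.-1./2.
Proof.
rewrite sign_perm_porbits.
rewrite (partition_big (porbit pi) (mem (porbits pi))) => [|j _] /=; last exact: imset_f.
rewrite -prodrXl -big_split /= exprD.
have signE (S : {set {set 'I_c}}) : S \subset porbits pi ->
    (-1) ^+ #|S| = \prod_(O in porbits pi) (-1) ^+ (O \in S) :> L.
  move=> /fintype.subsetP SP; rewrite -sum1_card -prodrXr big_mkcond [RHS]big_mkcond /=.
  apply: eq_bigr => O _; case: (boolP (O \in S)) => [/SP -> //|_].
  by rewrite if_same.
rewrite !signE; try by apply/fintype.subsetP => O; rewrite inE => /andP[].
rewrite -big_split /=; apply: eq_bigr => O /imsetP[i _ ->].
have -> : \prod_(j | porbit pi j == porbit pi i) la j = \prod_(j in porbit pi i) la j.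
  by apply: eq_bigl => j; rewrite eq_porbit_mem.
rewrite orbit_lambda_sign !inE imset_f //= square_orbitsE -/(blen i).
rewrite -[(-1) ^+ _.+1]signr_odd /= -!signr_addb.
by case: (odd _); case: (square_orbit i).
Qed.

Lemma pchar_two_neq0 : 2%:R != 0 :> L.
Proof.
have [p p_pr pF] := finPcharP F.
have pL : p \in [pchar L] by rewrite (fmorph_pchar iota).
rewrite -(dvdn_pcharf pL); apply/negP => p2.
have : p.-nat q by rewrite -[q]expn1 -(eq_pnat _ (pcharf_eq pL)) (pchar_nat_card iota).
have -> : p = 2%N by apply/eqP; rewrite -(dvdn_prime2 p_pr).
case/p_natP => [[|e] qE]; first by have := finNzRing_gt1 F; rewrite qE.
by move: oddF; rewrite qE expnS oddM.
Qed.

Lemma signr_inj a b : (-1) ^+ a = (-1) ^+ b :> L -> odd a = odd b.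
Proof.
have N1 : (-1 : L) != 1.
  by rewrite eq_sym -subr_eq0 opprK -mulr2n pchar_two_neq0.
rewrite -signr_odd -[RHS]signr_odd; case: (odd a) (odd b) => -[] //.
  by move/eqP; rewrite expr1 expr0 (negPf N1).
by move/eqP; rewrite expr1 expr0 eq_sym (negPf N1).
Qed.

Variable h : nat.
Hypothesis rank_h : \rank (form_mx s X) = h.
Hypothesis ch : c = h.*2.
Hypothesis iso : kermx (form_mx s X)^T *m diag_mx (\row_b lambda fL (X b)) *m
  (kermx (form_mx s X)^T)^T = 0.

Lemma orbit_count_parity :
  odd (#|positive_even_orbits| + #|negative_odd_orbits|) = odd (h * q.-1./2).
Proof.
apply: signr_inj; rewrite orbit_sign.
have formE : map_mx (frob 1) (form_mx s X) = col_perm pi (form_mx s X).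
  apply/matrixP => i j; rewrite !mxE -piP; case: ifP => _; last exact: rmorph0.
  by rewrite !mevalX rmorph_prod; apply: eq_bigr => l _; rewrite mxE rmorphXn.
have c2 : c = (h + h)%N by rewrite addnn.
have [rho [rho0 rho2 rhoF]] := lagrangian_sign c2 rank_h lambda_neq0 iso formE frob_lambda.
(* Frobenius is the q-th power, so phi rho = sgn(pi) rho can be divided by rho. *)
have rhoq : rho ^+ q.-1 = (-1) ^+ pi.
  have E : rho ^+ (q ^ 1) = (-1) ^+ pi * rho := rhoF.
  have qK : q.-1.+1 = (q ^ 1)%N by rewrite expn1 prednK // ltnW // finNzRing_gt1.
  by apply: (mulIf rho0); rewrite -exprSr qK.
have qE : q.-1 = (q.-1./2).*2 by have := card_pow_half 1; rewrite expn1.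
(* Substituting rho^2 gives (-1)^(h (q-1)/2) (prod lambda)^((q-1)/2) = sgn(pi). All factors square
   to 1, so the equation can be solved for the first one. *)
have := rhoq; rewrite [in rho ^+ _]qE -mul2n exprM rho2 exprMn -exprM => sE'.
apply: (@mulfI _ ((-1) ^+ (h * q.-1./2) * (-1) ^+ (h * q.-1./2))).
  by rewrite mulf_neq0 ?signr_eq0.
have ss k : (-1) ^+ k * (-1) ^+ k = 1 :> L by rewrite -expr2 sqrr_sign.
rewrite ss !mul1r -sE'.
set e := (-1) ^+ _; set T := _ ^+ _.
have : (e * T) * (e * T) = 1 by rewrite /e /T sE' ss.
rewrite mulrACA ss mul1r => TT.
by rewrite -mulrA TT mulr1.
Qed.

End ClosedPoints.

(** * Parity of the numerical data and conclusion *)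

Lemma odd_card_field (F : finFieldType) p : p \in [pchar F] -> odd p -> odd #|F|.
Proof.
move=> pF oddp; have /abelem_pgroup := fin_ring_pchar_abelem pF.
rewrite /pgroup cardsT => /p_natP[e ->].
by rewrite oddX oddp orbT.
Qed.

(** The even number sum d_i - n - 1 is one less than sum (d_i - 1), which is therefore 2 s + 1. *)
Lemma degree_excess_odd n (d : 'I_n -> nat) : (forall i, (1 <= d i)%N) ->
    (- n%:Z - 1 + \sum_(i < n) (d i)%:Z = 0 %[mod 2])%Z ->
  (\sum_i (d i).-1 = (\sum_i (d i).-1)./2.*2.+1)%N.
Proof.
move=> d1; have -> : \sum_i (d i)%:Z = (\sum_i (d i).-1 + n)%N%:Z.
  rewrite -[X in _ = (_ + X)%N%:Z]card_ord -sum1_card -big_split /=.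
  rewrite (big_morph Posz PoszD (erefl _)).
  by apply: eq_bigr => i _; rewrite addn1 prednK // d1.
set T := (\sum_i _)%N => H.
have : odd T by lia.
by move=> oT; rewrite -[LHS]odd_double_half oT.
Qed.

Theorem theorem6p9
    (F : finFieldType) (p : nat) (hp : p \in [pchar F]) (hodd : odd p)
    (L : closedFieldType) (iota : {rmorphism F -> L})
    (hL : forall a : L, algebraicOver iota a)
    (n : nat) (hn : (1 <= n)%N)
    (d : 'I_n -> nat) (hd : forall i, (1 <= d i)%N)
    (f : 'I_n -> {mpoly F[n.+1]})
    (hf0 : forall i, f i != 0)
    (hf : forall i, f i \is (d i).-homog)
    (htrans : forall x : 'rV[L]_n.+1,
       common_point iota f x -> transverse_at iota f x)
    (hpar : (- n%:Z - 1 + \sum_(i < n) (d i)%:Z = 0 %[mod 2])%Z) :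
  exists A B : nat,
    [/\ (positive_even_points iota f #= `I_A)%card,
        (negative_odd_points iota f #= `I_B)%card,
        ~~ odd ((\prod_(i < n) d i) %/ 2)%N \/ (#|F| = 1 %[mod 4])%N ->
          (A + B = 0 %[mod 2])%N &
        odd ((\prod_(i < n) d i) %/ 2)%N /\ (#|F| <> 1 %[mod 4])%N ->
          (A + B = 1 %[mod 2])%N].
Proof.
have oddF := odd_card_field hp hodd.
have sE := degree_excess_odd hd hpar.
set s := (_./2) in sE.
have [c [X [[X_inj XP] cE rank_s rank_t iso]]] :=
  forms_lagrangian hd (base_change_homog iota hf) (base_change_transversal hn htrans) sE.
have [pi piP] := frobenius_permutation X_inj XP.
exists #|positive_even_orbits iota f X pi|, #|negative_odd_orbits iota f X pi|.
have hE : ((\prod_(i < n) d i) %/ 2 = \rank (form_mx s X))%N by rewrite -(etrans rank_s cE) divn2 doubleK.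
have parity := orbit_count_parity hn htrans oddF XP piP (erefl _) (esym rank_s) iso.
split.
- exact: (card_positive_even hn hf htrans sE oddF X_inj XP piP rank_t).
- exact: (card_negative_odd hn hf htrans sE oddF X_inj XP piP rank_t).
(* As q is odd, (q - 1)/2 is even exactly when q is 1 modulo 4. *)
- rewrite hE !modn2 parity oddM; lia.
- rewrite hE !modn2 parity oddM; lia.
Qed.
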